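(* Let $T_0:S^1\to S^1$ satisfy (A0) and (A1) with constant $\alpha<1$, let $L_0$ be its transfer operator acting on $W^{1,1}(S^1,\mathbb{C})$, and let $\lambda_0>\alpha$ be a real, positive, simple isolated eigenvalue of $L_0$. Let $\varphi_0$ be the corresponding eigenfunctional of $L_0^*$ and $v_0$ the corresponding eigenfunction of $L_0$ (normalised by $\varphi_0(\mathbf 1)=1$, $\varphi_0(v_0)=1$), and let $\phi_0\in H^1(S^1,\mathbb{R})$ be such that $\varphi_0(f)=\int_{S^1}\phi_0\bar f\,dx+\int_{S^1}\phi_0'\overline{f'}\,dx$ for all $f\in H^1(S^1,\mathbb{R})$. For $\dot T\in H^4(S^1,\mathbb{R})$ let $\dot\lambda(\dot T)=\varphi_0(\dot L(\dot T)v_0)$ be the linear response of $\lambda_0$ to families $T_\delta$ satisfying (A0), (A1), (A2) with first-order perturbation $\dot T$. Assume that $\dot\lambda$ is not identically zero on $H^4(S^1,\mathbb{R})$. Then the perturbation $\dot T\in H^4(S^1,\mathbb{R})$ that maximises $\dot\lambda(\dot T)$ subject to $\|\dot T\|_{H^4}\le1$ is given by $\dot T=\sum_{n=-\infty}^\infty a_ne_n$, where $e_n(x)=\exp(2\pi i n x)$ and $$a_n=\frac{-\displaystyle\int_{S^1}\phi_0\cdot\overline{L_0\left(\left(\frac{e_nv_0}{T_0'}\right)'\right)}dx-\int_{S^1}\phi_0'\cdot\overline{\left(L_0\left(\left(\frac{e_nv_0}{T_0'}\right)'\right)\right)'}dx}{2\nu\displaystyle\sum_{k=0}^4(4\pi^2n^2)^k},\qquad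 n\in\mathbb{Z},$$ where $\nu>0$ is chosen so that $\|\dot T\|_{H^4}=1$, that is, $\sum_{n=-\infty}^\infty\sum_{k=0}^4(4\pi^2n^2)^k|a_n|^2=1$. Moreover, the maximal linear response is given by $$\dot\lambda(\dot T)=-\int_{S^1}\phi_0\cdot\overline{L_0\left(\left(\frac{\dot Tv_0}{T_0'}\right)'\right)}dx-\int_{S^1}\phi_0'\cdot\overline{\left(L_0\left(\left(\frac{\dot Tv_0}{T_0'}\right)'\right)\right)'}dx.$$
   Context: $S^1=\mathbb{R}/\mathbb{Z}$. $W^{k,p}$ is the Sobolev space of functions with weak derivatives up to order $k$ in $L^p$; $H^k=W^{k,2}$, and $\|f\|_{H^4}^2=\sum_{k=0}^4\int_{S^1}|f^{(k)}|^2dx$ (so $H^4(S^1)\subset C^3(S^1)$). A family of $C^3$ maps $\{T_\delta:S^1\to S^1\}_{\delta\in[0,\bar\delta)}$ ($\bar\delta>0$) satisfies: (A0) if $T_0\in C^4(S^1)$; (A1) if there is $\alpha<1$ such that $|T_0'(x)|\ge\alpha^{-1}$ for all $x\in S^1$; (A2) if $T_\delta(x)=T_0(x)+\delta\dot T(x)+F_\delta(x)$ (mod 1) with $\dot T\in C^3(S^1,\mathbb{R})$ and $\sup_{\delta\in(0,\bar\delta)}\|F_\delta\|_{C^3}/\delta^2<\infty$. Conditions (A0) and (A1) concern only $T_0$. The transfer operator of $T_\delta$ is $L_\delta f(x)=\sum_{y\in T_\delta^{-1}(x)}f(y)/|T_\delta'(y)|$, acting on $W^{1,1}(S^1,\mathbb{C})$.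 The derivative operator in direction $\dot T$ is $\dot L(\dot T)f:=\dot L(f):=-L_0\left(\left[f\dot T/T_0'\right]'\right)$. $\varphi_0\in(W^{1,1}(S^1,\mathbb{C}))^*$ satisfies $L_0^*\varphi_0=\lambda_0\varphi_0$ and is scaled so that $\varphi_0(\mathbf 1)=1$; $v_0$ satisfies $L_0v_0=\lambda_0v_0$ and is scaled so that $\varphi_0(v_0)=1$ (it lies in $W^{3,1}$). For a family with first-order perturbation $\dot T$, $L_\delta$ has for small $\delta$ a simple isolated eigenvalue $\lambda_\delta$ continuing $\lambda_0$, and $\dot\lambda(\dot T)=\frac{d\lambda_\delta}{d\delta}\big|_{\delta=0}=\varphi_0(\dot L(\dot T)v_0)$. *)

(* Defs.v *)
From mathcomp Require Import all_boot all_order all_algebra.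
From mathcomp Require Import all_classical all_reals all_analysis.
From mathcomp Require Import complex.

Set Implicit Arguments.
Unset Strict Implicit.
Unset Printing Implicit Defensive.

Import Order.TTheory GRing.Theory Num.Theory.
Import numFieldNormedType.Exports.

Local Open Scope classical_set_scope.
Local Open Scope ring_scope.
Local Open Scope complex_scope.

(* A function on the circle is a 1-periodic function on the line, considered up
   to almost-everywhere equality. Integrals over the circle are taken over the
   fundamental domain [0, 1]. Real-valued functions are embedded by [cplx]. *)

Definition cplx {R : realType} (f : R -> R) : R -> R[i] := fun x => (f x)%:C.

Definition circle_int {R : realType} (f : R -> R) : R :=
  \int[lebesgue_measure]_(x in `[0%R, 1%R]) f x.

Definition circle_cint {R : realType} (f : R -> R[i]) : R[i] :=
  circle_int (fun x => complex.Re (f x)) +i* circle_int (fun x => complex.Im (f x)).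

Definition ae_equal {R : realType} {V : Type} (f g : R -> V) : Prop :=
  {ae (@lebesgue_measure R), forall x, f x = g x}.

Definition Lp_circle {R : realType} (p : nat) (f : R -> R[i]) : Prop :=
  [/\ periodic f 1,
      measurable_fun setT (fun x => complex.Re (f x)),
      measurable_fun setT (fun x => complex.Im (f x)) &
      (@lebesgue_measure R).-integrable `[0%R, 1%R]
        (fun x => (Normc.normc (f x) ^+ p)%:E)].

Definition test_function {R : realType} (psi : R -> R) : Prop :=
  periodic psi 1 /\ forall (n : nat) (x : R), derivable (derive1n n psi) x 1.

Definition weak_derivative {R : realType} (f g : R -> R[i]) : Prop :=
  [/\ Lp_circle 1 f, Lp_circle 1 g &
      forall psi : R -> R, test_function psi ->
        circle_cint (fun x => f x * (derive1 psi x)%:C) =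
        - circle_cint (fun x => g x * (psi x)%:C)].

(* A representative of the weak derivative, and 0 if there is none; the
   representative depends on f only up to almost-everywhere equality. *)
Definition wderiv {R : realType} (f : R -> R[i]) : R -> R[i] :=
  xget (fun=> 0) [set g | weak_derivative f g].

Fixpoint Sobolev {R : realType} (k p : nat) (f : R -> R[i]) : Prop :=
  match k with
  | 0%N => Lp_circle p f
  | k'.+1 =>
      Lp_circle p f /\ exists g, weak_derivative f g /\ Sobolev k' p g
  end.

Definition W11_norm {R : realType} (f : R -> R[i]) : R :=
  circle_int (fun x => Normc.normc (f x)) +
  circle_int (fun x => Normc.normc (wderiv f x)).

Definition H_norm {R : realType} (k : nat) (f : R -> R[i]) : R :=
  Num.sqrt (\sum_(j < k.+1)
    circle_int (fun x => Normc.normc (iter j wderiv f x) ^+ 2)).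

(* A C^k circle map is represented by a C^k lift to the line; its derivative is
   the 1-periodic function [derive1 tau]. *)
Definition circle_lift {R : realType} (tau : R -> R) : Prop :=
  exists d : int, forall x, tau (x + 1) = tau x + d%:~R.

Definition C_class {R : realType} (k : nat) (f : R -> R) : Prop :=
  (forall (j : nat) (x : R), (j < k)%N -> derivable (derive1n j f) x 1) /\
  continuous (derive1n k f).

Definition circle_preimage {R : realType} (tau : R -> R) (x : R) : set R :=
  [set y | `[0%R, 1%R[%classic y /\ exists m : int, tau y = x + m%:~R].

Definition transfer {R : realType} (tau : R -> R) (f : R -> R[i]) : R -> R[i] :=
  fun x => \sum_(y \in circle_preimage tau x) (f y / (`|derive1 tau y|)%:C).

Definition transfer_shift {R : realType} (tau : R -> R) (z : R[i])
    (f : R -> R[i]) : R -> R[i] :=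
  fun x => transfer tau f x - z * f x.

Definition in_resolvent_set {R : realType} (tau : R -> R) (z : R[i]) : Prop :=
  exists C : R, forall g : R -> R[i], Sobolev 1 1 g ->
    exists f : R -> R[i],
      [/\ Sobolev 1 1 f, ae_equal (transfer_shift tau z f) g,
          W11_norm f <= C * W11_norm g &
          forall h : R -> R[i], Sobolev 1 1 h ->
            ae_equal (transfer_shift tau z h) g -> ae_equal h f].

Definition isolated_in_spectrum {R : realType} (tau : R -> R) (z : R[i]) :
    Prop :=
  exists2 eps : R, 0 < eps & forall w : R[i],
    0 < Normc.normc (w - z) < eps -> in_resolvent_set tau w.

Definition eigenfunction {R : realType} (tau : R -> R) (z : R[i])
    (f : R -> R[i]) : Prop :=
  [/\ Sobolev 1 1 f, ~ ae_equal f (fun=> 0) &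
      ae_equal (transfer tau f) (fun x => z * f x)].

(* Algebraic multiplicity one: the generalised eigenspace is a line. *)
Definition simple_eigenvalue {R : realType} (tau : R -> R) (z : R[i]) : Prop :=
  exists2 f : R -> R[i], eigenfunction tau z f &
    forall (m : nat) (g : R -> R[i]), Sobolev 1 1 g ->
      ae_equal (iter m (transfer_shift tau z) g) (fun=> 0) ->
      exists c : R[i], ae_equal g (fun x => c * f x).

(* Only the values of [phi] on W^{1,1} are meaningful; boundedness makes it
   depend on the almost-everywhere class of its argument only. *)
Definition W11_dual {R : realType} (phi : (R -> R[i]) -> R[i]) : Prop :=
  (forall (c : R[i]) (f g : R -> R[i]), Sobolev 1 1 f -> Sobolev 1 1 g ->
     phi (fun x => c * f x + g x) = c * phi f + phi g) /\
  exists C : R, forall f : R -> R[i], Sobolev 1 1 f ->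
    Normc.normc (phi f) <= C * W11_norm f.

Definition eigenfunctional {R : realType} (tau : R -> R) (z : R[i])
    (phi : (R -> R[i]) -> R[i]) : Prop :=
  W11_dual phi /\
  forall f : R -> R[i], Sobolev 1 1 f -> phi (transfer tau f) = z * phi f.

Definition dot_transfer {R : realType} (tau Tdot : R -> R) (f : R -> R[i]) :
    R -> R[i] :=
  fun x => - transfer tau
    (wderiv (fun y => f y * (Tdot y)%:C / (derive1 tau y)%:C)) x.

(* The derivative at delta = 0 of the eigenvalue of the family
   T_0 + delta Tdot + O(delta^2), given by first-order perturbation theory as
   phi (dL v0). *)
Definition dot_lambda {R : realType} (tau : R -> R)
    (phi : (R -> R[i]) -> R[i]) (v0 : R -> R[i]) (Tdot : R -> R) : R[i] :=
  phi (dot_transfer tau Tdot v0).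

(* The inequality is that of the partial order of [R[i]], in which x <= y means
   that y - x is a nonnegative real. As Tdot = 0 is admissible, it entails that
   the value at a maximiser is real. *)
Definition maximiser {R : realType} (J : (R -> R) -> R[i]) (S : R -> R) :
    Prop :=
  [/\ Sobolev 4 2 (cplx S), H_norm 4 (cplx S) <= 1 &
      forall S' : R -> R, Sobolev 4 2 (cplx S') -> H_norm 4 (cplx S') <= 1 ->
        J S' <= J S].

Definition fourier_mode {R : realType} (n : int) : R -> R[i] :=
  fun x => cos (2 * pi * n%:~R * x) +i* sin (2 * pi * n%:~R * x).

Definition fourier_weight {R : realType} (n : int) : R :=
  \sum_(k < 5) (4 * pi ^+ 2 * n%:~R ^+ 2) ^+ k.

Definition response_formula {R : realType} (tau : R -> R) (v0 : R -> R[i])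
    (phi0 : R -> R) (h : R -> R[i]) : R[i] :=
  let u := transfer tau (wderiv (fun y => h y * v0 y / (derive1 tau y)%:C)) in
  - circle_cint (fun x => (phi0 x)%:C * (u x)^*)
  - circle_cint (fun x => wderiv (cplx phi0) x * (wderiv u x)^*).

Definition opt_coeff {R : realType} (tau : R -> R) (v0 : R -> R[i])
    (phi0 : R -> R) (nu : R) (n : int) : R[i] :=
  response_formula tau v0 phi0 (fourier_mode n) /
  (2 * nu * fourier_weight n)%:C.

Definition fourier_partial_sum {R : realType} (a : int -> R[i]) (M N : nat) :
    R -> R[i] :=
  fun x => \sum_(k < (M + N).+1) a (k%:Z - M%:Z) * fourier_mode (k%:Z - M%:Z) x.

(* f is the sum of the two-sided Fourier series, with convergence in H^4. *)
Definition is_fourier_sum {R : realType} (a : int -> R[i]) (f : R -> R[i]) :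
    Prop :=
  H_norm 4 (fun x => f x - fourier_partial_sum a MN.1 MN.2 x)
    @[MN --> filter_prod (\oo : set_system nat) (\oo : set_system nat)]
    --> (0 : R).

(* Main.v *)
Require Import Defs.
From mathcomp Require Import all_boot all_order all_algebra.
From mathcomp Require Import all_classical all_reals all_analysis.
From mathcomp Require Import complex ring lra measurable_realfun.
Import Order.TTheory GRing.Theory Num.Theory.
Import numFieldNormedType.Exports.
(** In the end the theorem is the Riesz representation of the functional
    S |-> dot_lambda S on H4, written in Fourier coordinates: the maximiser of a
    nonzero bounded functional over the unit ball is its normalised Riesz
    representative. The dynamics enters only in showing that the response is
    defined, real and bounded in a norm weaker than that of H4.

    Regularity of the eigenfunction. A function v of class W11 has a continuous
    representative with a weak derivative w. If L v = lambda v, pairing with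
    test functions shows that w solves, weakly,
    lambda w = L (w / tau') + L ((1 / tau')' v). The operator
    f |-> L (f / tau') / lambda is dominated by alpha / lambda times L, and the
    densities L^n 1 stay bounded ([density_bound]), so that its resolvent
    series converges uniformly as soon as lambda > alpha, with one derivative
    more when the source has one ([deriv_transfer_resolvent]). The weak solution
    is unique by duality ([dual_contraction_zero]); hence v is C2
    ([eigenfunction_C2]). As lambda is real and simple and phi v0 = 1, the
    function v0 is moreover real ([eigenfunction_real_C2]).

    The response. For a real perturbation s of class C2 this gives
    dot_lambda s = J s, where J is linear, real and bounded by the sup norms of
    s, s' and s'' ([dot_lambdaE], [response_bound]); the Fourier-type formula of
    the statement is the conjugate-linear extension of J to complex perturbations
    ([response_formulaE]).

    Riesz representation by hand. Let A n and B n be the values of J on the n-th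
    cosine and sine. They are O(n^2), so that the trigonometric series T whose
    coefficients are those of J divided by the H4 weights of the modes, which
    grow like n^8, converges with its first four derivatives. The identity
    J s = <s, T> in H4 holds on modes by construction, and passes to every s in H4
    because the Fourier series of s converges to s in C2 ([fourier_C2],
    [riesz_representative]). Only the uniqueness of Fourier coefficients is
    needed, not the completeness of the modes in L2.

    Maximisation. Put U = T / (2 nu). The condition on nu says that
    (2 nu)^2 = J T = |T|^2, that is |U| = 1. Then J s = 2 nu <s, U> is at most
    2 nu on the unit ball, with equality only for s = U ([unit_maximiser]), and
    the coefficients of U on the complex exponentials are those of the statement
    ([two_sided_fourier_sum]). *)

Set Implicit Arguments.
Unset Strict Implicit.
Unset Printing Implicit Defensive.

Local Open Scope classical_set_scope.
Local Open Scope ring_scope.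


(** * Integration over the circle *)

Section CircleIntegral.
Context {R : realType}.
Implicit Types f g h : R -> R.
Notation mu := (@lebesgue_measure R).

Definition circle_integrable f := mu.-integrable `[0%R, 1%R] (EFin \o f).
Notation intg := circle_integrable.
Notation I := circle_int.
Local Notation U01 := (`[0%R, 1%R]%classic : set (measurableTypeR R)).

Lemma measurable_unit : measurable (`[0%R, 1%R] : set (measurableTypeR R)).
Proof. exact: measurable_itv. Qed.
Hint Resolve measurable_unit : core.

Lemma continuous_integrable f : continuous f -> intg f.
Proof.
move=> cf; apply: continuous_compact_integrable; first exact: segment_compact.
exact: continuous_subspaceT.
Qed.

Lemma continuous_measurable f : continuous f -> measurable_fun setT f.
Proof. exact: continuous_measurable_fun. Qed.

Lemma circle_integrable_measurable f : intg f -> measurable_fun U01 f.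
Proof. by move=> /integrableP[/measurable_EFinP]. Qed.

Lemma eq_circle_integrable f g : (forall x, f x = g x) -> intg f -> intg g.
Proof. by move=> fg; rewrite (_ : f = g)//; exact/funext. Qed.

Lemma circle_integrableD f g : intg f -> intg g -> intg (fun x => f x + g x).
Proof.
by move=> F G; rewrite /intg (_ : _ \o _ = (EFin \o f) \+ (EFin \o g))%E //; exact: integrableD.
Qed.

Lemma circle_integrableZ k f : intg f -> intg (fun x => k * f x).
Proof.
by move=> F; rewrite /intg (_ : _ \o _ = (fun x => k%:E * (EFin \o f) x))%E //; exact: integrableZl.
Qed.

Lemma circle_integrableN f : intg f -> intg (fun x => - f x).
Proof.
by move/(circle_integrableZ (-1)); apply: eq_circle_integrable => x; rewrite mulN1r.
Qed.

Lemma circle_integrableB f g : intg f -> intg g -> intg (fun x => f x - g x).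
Proof. by move=> F G; apply: circle_integrableD => //; exact: circle_integrableN. Qed.

Lemma circle_integrable_norm f : intg f -> intg (fun x => `|f x|).
Proof. exact: integrable_norm. Qed.

Lemma circle_integrableM f h (B : R) : intg f -> measurable_fun U01 h ->
  (forall x : R, U01 x -> `|h x| <= B) -> intg (fun x => f x * h x).
Proof.
move=> F mh hB.
rewrite (_ : circle_integrable _ = mu.-integrable U01 ((EFin \o f) \* (EFin \o h))%E)//.
apply: integrableMl => //.
exists B; split; first by rewrite num_real.
by move=> y By x Dx; exact: le_trans (hB x Dx) (ltW By).
Qed.

Lemma circle_integrable_cst (k : R) : intg (fun=> k).
Proof. by apply: continuous_integrable => x; exact: cvg_cst. Qed.

Lemma circle_integrable_bounded f (B : R) : measurable_fun U01 f ->
  (forall x : R, U01 x -> `|f x| <= B) -> intg f.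
Proof.
move=> mf fB; have := circle_integrableM (circle_integrable_cst 1) mf fB.
by apply: eq_circle_integrable => x; rewrite mul1r.
Qed.

Lemma circle_intD f g : intg f -> intg g -> I (fun x => f x + g x) = I f + I g.
Proof. by move=> F G; rewrite /circle_int RintegralD. Qed.

Lemma circle_intB f g : intg f -> intg g -> I (fun x => f x - g x) = I f - I g.
Proof. by move=> F G; rewrite /circle_int RintegralB. Qed.

Lemma circle_intZ k f : intg f -> I (fun x => k * f x) = k * I f.
Proof. by move=> F; rewrite /circle_int RintegralZl. Qed.

Lemma eq_circle_int f g : (forall x, f x = g x) -> I f = I g.
Proof. by move=> fg; congr (I _); exact/funext. Qed.

Lemma circle_intN f : intg f -> I (fun x => - f x) = - I f.
Proof.
by move=> F; rewrite -mulN1r -circle_intZ//; apply: eq_circle_int => x; rewrite mulN1r.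
Qed.

Lemma circle_int_cst (k : R) : I (fun=> k) = k.
Proof. rewrite /circle_int Rintegral_cst//.
rewrite [X in _ * fine X](_ : _ = 1%E) ?mulr1//.
have : lebesgue_measure (`[0%R, 1%R]%classic : set R) = 1%E.
  by rewrite lebesgue_measure_itv/= lte_fin ltr01 oppr0 adde0.
by move=> <-. Qed.

Lemma le_circle_int f g : intg f -> intg g ->
  (forall x : R, U01 x -> f x <= g x) -> I f <= I g.
Proof. by move=> F G fg; apply: le_Rintegral. Qed.

Lemma circle_int_ge0 f : (forall x, 0 <= f x) -> 0 <= I f.
Proof. by move=> f0; apply: Rintegral_ge0. Qed.

Lemma le_norm_circle_int f : intg f -> `|I f| <= I (fun x => `|f x|).
Proof. by move=> F; apply: le_normr_Rintegral. Qed.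

Lemma norm_circle_intM f h (B : R) : intg f -> measurable_fun U01 h ->
  (forall x : R, U01 x -> `|h x| <= B) ->
  `|I (fun x => f x * h x)| <= B * I (fun x => `|f x|).
Proof.
move=> F mh hB; have FH := circle_integrableM F mh hB.
apply: le_trans (le_norm_circle_int FH) _.
rewrite -circle_intZ; last exact: circle_integrable_norm.
apply: le_circle_int; first exact: circle_integrable_norm.
  exact/circle_integrableZ/circle_integrable_norm.
by move=> x Dx; rewrite normrM mulrC ler_wpM2r// hB.
Qed.

Lemma norm_circle_int_bounded f (B : R) : measurable_fun U01 f ->
  (forall x : R, U01 x -> `|f x| <= B) -> `|I f| <= B.
Proof.
move=> mf fB; rewrite (_ : I f = I (fun x => 1 * f x)); last first.
  by apply: eq_circle_int => x; rewrite mul1r.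
apply: le_trans (norm_circle_intM (circle_integrable_cst 1) mf fB) _.
rewrite (_ : I (fun x : R => `|(fun=> 1) x|) = 1); first by rewrite mulr1.
by rewrite -[RHS](circle_int_cst 1); apply: eq_circle_int => x; rewrite normr1.
Qed.

Lemma circle_int_sum (n : nat) (F : nat -> R -> R) : (forall i, intg (F i)) ->
  I (fun x => \sum_(i < n) F i x) = \sum_(i < n) I (F i) /\
  intg (fun x => \sum_(i < n) F i x).
Proof.
move=> iF; elim: n => [|n [IHn1 IHn2]].
  split; first by rewrite big_ord0 -[RHS](circle_int_cst 0); apply: eq_circle_int => x; rewrite big_ord0.
  by apply: eq_circle_integrable (circle_integrable_cst 0) => x; rewrite big_ord0.
have e : (fun x => \sum_(i < n.+1) F i x) = fun x => \sum_(i < n) F i x + F n x.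
  by apply/funext => x; rewrite big_ord_recr.
rewrite e big_ord_recr/= -IHn1; split; first by rewrite circle_intD.
exact: circle_integrableD.
Qed.

(** Almost everywhere on the fundamental domain; [ae_periodic] extends such
    properties of periodic functions to the line. *)
Definition ae_unit (P : R -> Prop) :=
  {ae mu, forall x, U01 x -> P x}.

Lemma circle_int_ae f g : measurable_fun U01 f ->
  measurable_fun U01 g -> ae_unit (fun x => f x = g x) -> I f = I g.
Proof.
move=> mf mg fg; rewrite /circle_int /Rintegral; congr fine.
apply: ae_eq_integral => //; first exact/measurable_EFinP.
  exact/measurable_EFinP.
by move: fg; rewrite /ae_unit; apply: filterS => x /[swap] Dx /(_ Dx) ->.
Qed.

Lemma circle_integrable_ae f g : measurable_fun U01 g ->
  ae_unit (fun x => f x = g x) -> intg f -> intg g.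
Proof.
move=> mg fg F; have mf := circle_integrable_measurable F.
move/integrableP : F => [_ F]; apply/integrableP; split; first exact/measurable_EFinP.
rewrite (_ : (\int[_]_(x in _) _ = \int[mu]_(x in `[0%R, 1%R]) `|(f x)%:E|)%E)//.
apply: ae_eq_integral => //.
- by apply/measurable_EFinP; exact: measurableT_comp.
- by apply/measurable_EFinP; exact: measurableT_comp.
by move: fg; rewrite /ae_unit; apply: filterS => x /[swap] Dx /(_ Dx) ->.
Qed.

End CircleIntegral.

(** * Derivatives and limits of real functions *)

Section Calculus.
Context {R : realType}.
Implicit Types f g h : R -> R.
Notation mu := (@lebesgue_measure R).
Notation intg := circle_integrable.
Notation I := circle_int.

Definition has_deriv f f' := forall x : R, is_derive x 1 f (f' x).

Lemma has_deriv_continuous f f' : has_deriv f f' -> continuous f.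
Proof.
move=> fD x; apply/differentiable_continuous/derivable1_diffP.
by case: (fD x).
Qed.

Lemma eq_has_deriv f f' g' : (forall x, f' x = g' x) -> has_deriv f f' -> has_deriv f g'.
Proof. by move=> e; rewrite (_ : f' = g')//; exact/funext. Qed.

Lemma has_deriv_cst (k : R) : has_deriv (fun=> k) (fun=> 0).
Proof. by move=> x; exact: is_derive_cst. Qed.

Lemma has_derivD f f' g g' : has_deriv f f' -> has_deriv g g' ->
  has_deriv (fun x => f x + g x) (fun x => f' x + g' x).
Proof. by move=> F G x; apply: is_deriveD. Qed.

Lemma has_derivM f f' g g' : has_deriv f f' -> has_deriv g g' ->
  has_deriv (fun x => f x * g x) (fun x => f' x * g x + f x * g' x).
Proof.
move=> F G x; have := is_deriveM (F x) (G x).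
by rewrite addrC /GRing.scale/= [g x * f' x]mulrC.
Qed.

Lemma has_derivZ k f f' : has_deriv f f' ->
  has_deriv (fun x => k * f x) (fun x => k * f' x).
Proof.
move=> F; apply: eq_has_deriv (has_derivM (has_deriv_cst k) F) => x.
by rewrite mul0r add0r.
Qed.

Lemma has_derivB f f' g g' : has_deriv f f' -> has_deriv g g' ->
  has_deriv (fun x => f x - g x) (fun x => f' x - g' x).
Proof. by move=> F G x; apply: is_deriveB. Qed.

Lemma has_deriv_comp f f' g g' : has_deriv f f' -> has_deriv g g' ->
  has_deriv (fun x => f (g x)) (fun x => f' (g x) * g' x).
Proof. by move=> F G x; apply: is_derive1_comp. Qed.

Lemma has_deriv_shift f f' a : has_deriv f f' ->
  has_deriv (fun x => f (x + a)) (fun x => f' (x + a)).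
Proof.
move=> F; have D : has_deriv (fun x => x + a) (fun=> 1 + 0).
  apply: has_derivD; last exact: has_deriv_cst.
  by move=> x; exact: is_derive_id.
by apply: eq_has_deriv (has_deriv_comp F D) => x; rewrite addr0 mulr1.
Qed.

Lemma has_deriv_sum n (F F' : nat -> R -> R) :
  (forall i, has_deriv (F i) (F' i)) ->
  has_deriv (fun x => \sum_(i < n) F i x) (fun x => \sum_(i < n) F' i x).
Proof.
move=> D; elim: n => [|n IH].
  rewrite (_ : (fun x : R => \sum_(_ < 0) F _ x) = fun=> 0); last first.
    by apply/funext => x; rewrite big_ord0.
  by apply: eq_has_deriv (has_deriv_cst 0) => x; rewrite big_ord0.
rewrite (_ : (fun x => _) = fun x => \sum_(i < n) F i x + F n x); last first.
  by apply/funext => x; rewrite big_ord_recr.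
by apply: eq_has_deriv (has_derivD IH (D n)) => x; rewrite big_ord_recr.
Qed.

Lemma has_deriv_derive f f' : has_deriv f f' -> derive1 f = f'.
Proof. by move=> F; apply/funext => x; rewrite derive1E; case: (F x). Qed.

Lemma has_deriv_unique f f' g' : has_deriv f f' -> has_deriv f g' -> f' = g'.
Proof. by move=> /has_deriv_derive <- /has_deriv_derive. Qed.

Lemma eq_deriv_cst f g h : has_deriv f h -> has_deriv g h ->
  forall x y, f x - f y = g x - g y.
Proof.
move=> F G x y; suff : f x - g x = f y - g y by lra.
apply: (@is_derive_0_is_cst _ (fun x => f x - g x)) => z.
by rewrite -(subrr (h z)); apply: is_deriveB.
Qed.

Lemma FTC f f' a b : has_deriv f f' -> continuous f' -> a <= b ->
  \int[mu]_(x in `[a, b]) f' x = f b - f a.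
Proof.
move=> D cf'; rewrite le_eqVlt => /predU1P[<-|ab].
  by rewrite subrr set_itv1 Rintegral_set1.
rewrite /Rintegral (@continuous_FTC2 _ f' f a b)//.
- exact: continuous_subspaceT.
- have cf := has_deriv_continuous D; split.
  + by move=> x _; case: (D x).
  + by apply: cvg_at_right_filter; exact: cf.
  + by apply: cvg_at_left_filter; exact: cf.
- by move=> x _; rewrite (has_deriv_derive D).
Qed.

Lemma FTC_unit f f' : has_deriv f f' -> continuous f' -> I f' = f 1 - f 0.
Proof. by move=> D c; rewrite /circle_int (FTC D c). Qed.

Lemma Rintegral_itv_split f a b c : a <= b -> b <= c ->
  mu.-integrable `[a, c] (EFin \o f) ->
  \int[mu]_(t in `[a, c]) f t = \int[mu]_(t in `[a, b]) f t + \int[mu]_(t in `[b, c]) f t.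
Proof.
move=> ab bc itf.
have := @Rintegral_itvB _ f (BLeft a) (BRight c) b itf.
rewrite !bnd_simp => /(_ ab bc) /eqP; rewrite subr_eq => /eqP ->; rewrite addrC.
congr (_ + _); rewrite Rintegral_itv_obnd_cbnd//.
by apply: integrableS itf => //; apply: subset_itvr; rewrite bnd_simp.
Qed.

(** An integral with a variable upper bound needs a lower bound to its left; the
    base point - |x| - 1 moves with x, and [Gind] shows that the value does not
    depend on it. *)
Lemma antiderivative f : continuous f -> exists F, has_deriv F f.
Proof.
move=> cf.
have itg a b : mu.-integrable `[a, b] (EFin \o f).
  apply: continuous_compact_integrable; first exact: segment_compact.
  exact: continuous_subspaceT.
pose G a x := \int[mu]_(t in `[a, x]) f t - \int[mu]_(t in `[a, 0]) f t.
have Gind a b x : b <= a -> a <= 0 -> a <= x -> G b x = G a x.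
  move=> ba a0 ax; rewrite /G.
  have E y : a <= y -> \int[mu]_(t in `[b, y]) f t =
      \int[mu]_(t in `[b, a]) f t + \int[mu]_(t in `[a, y]) f t.
    by move=> ay; exact: Rintegral_itv_split.
  by rewrite (E x)// (E 0)// opprD addrACA subrr add0r.
pose F x := G (- `|x| - 1) x.
exists F => x.
have l0 : forall y : R, - `|y| <= 0 by move=> y; rewrite oppr_le0.
apply: (@near_eq_is_derive _ _ _ (G (- `|x| - 2))).
  near=> y; rewrite /F.
  have xy : `|y - x| < 1.
    near: y; apply/nbhs_ballP; exists 1 => //= z.
    by rewrite /ball/= distrC.
  have yx : `|y| <= `|x| + 1.
    rewrite (_ : y = x + (y - x)); last by ring.
    by rewrite (le_trans (ler_normD _ _))// lerD2l ltW.
  have := ler_norm (- y); rewrite normrN => ny; have ? := l0 y.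
  by apply: Gind; lra.
have := ler_norm (- x); rewrite normrN => nx; have ? := l0 x.
have x1 : x < x + 1 by rewrite ltrDl.
have x2 : - `|x| - 2 < x by lra.
have [D1 D2] := continuous_FTC1_closed x1 (itg (- `|x| - 2) (x + 1)) x2 (cf x).
have D : is_derive x 1 (fun y => \int[mu]_(t in `[- `|x| - 2, y]) f t) (f x).
  by apply: (DeriveDef D1); rewrite -derive1E.
have := is_deriveB D (is_derive_cst (\int[mu]_(t in `[- `|x| - 2, 0]) f t) x 1).
by rewrite subr0.
Unshelve. all: by end_near. Qed.

Lemma deriv_bound_lip f f' (B : R) : has_deriv f f' -> (forall x, `|f' x| <= B) ->
  forall x y, `|f x - f y| <= B * `|x - y|.
Proof.
move=> D fB x y; wlog xy : x y / y <= x.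
  move=> H; case/orP: (le_total y x) => h; first exact: H.
  by rewrite distrC [`|x - y|]distrC H.
have cf : {within `[y, x], continuous f}.
  exact/continuous_subspaceT/(has_deriv_continuous D).
have [z _ ->] := @MVT_segment R f f' y x xy (fun z _ => D z) cf.
by rewrite normrM ler_wpM2r.
Qed.

Lemma eq_cvg0 (u : nat -> R) (l e : R) : (forall n, `|l - e| <= u n) ->
  u @ \oo --> (0 : R) -> l = e.
Proof.
move=> lu u0; apply/eqP; rewrite -subr_eq0 -normr_le0.
have : (lim (u @ \oo)) = (0 : R) by apply/cvg_lim.
by move=> <-; apply: limr_ge; [apply/cvg_ex; exists 0 | apply: nearW].
Qed.

Lemma cvg_by_bound (u r : nat -> R) (l : R) : (forall n, `|u n - l| <= r n) ->
  r @ \oo --> (0 : R) -> u @ \oo --> l.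
Proof.
move=> ur r0; apply/cvgrPdist_lt => e e0; have /cvgrPdist_lt/(_ _ e0) := r0.
apply: filterS => n /=; rewrite sub0r normrN distrC; apply: le_lt_trans.
exact: le_trans (ur n) (ler_norm _).
Qed.

Lemma uniform_limit_continuousR (F : nat -> R -> R) f (rho : nat -> R) :
  (forall n, continuous (F n)) -> (forall n x, `|F n x - f x| <= rho n) ->
  rho @ \oo --> (0 : R) -> continuous f.
Proof.
move=> cF Ff r0 x; apply/cvgrPdist_lt => e e0.
have e3 : 0 < e / 3 by apply: divr_gt0.
have [n _ /(_ n (leqnn n)) rn] : \forall n \near \oo, rho n < e / 3.
  have /cvgrPdist_lt/(_ _ e3) := r0; apply: filterS => n /=.
  by rewrite sub0r normrN; apply: le_lt_trans; exact: ler_norm.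
have /cvgrPdist_lt/(_ _ e3) := cF n x; apply: filterS => y /= h.
have -> : f x - f y = - (F n x - f x) + (F n x - F n y) + (F n y - f y) by ring.
apply: le_lt_trans (ler_normD _ _) _.
have := ler_normD (- (F n x - f x)) (F n x - F n y).
rewrite normrN; have := Ff n x; have := Ff n y; lra.
Qed.

(** The limit and an antiderivative of f' differ by a constant, because the
    differences F n - G have small Lipschitz constants. *)
Lemma has_deriv_limit (F F' : nat -> R -> R) f f' (rho : nat -> R) :
  (forall n, has_deriv (F n) (F' n)) -> (forall n, continuous (F' n)) ->
  (forall x, F ^~ x @ \oo --> f x) ->
  (forall n x, `|F' n x - f' x| <= rho n) -> rho @ \oo --> (0 : R) ->
  has_deriv f f'.
Proof.
move=> D cF' Ff F'f r0.
have cf' := uniform_limit_continuousR cF' F'f r0.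
have [G DG] := antiderivative cf'.
suff E x : f x = G x + (f 0 - G 0).
  rewrite (_ : f = fun x => G x + (f 0 - G 0)); last exact/funext.
  apply: (@eq_has_deriv _ (fun x => f' x + 0)) => [x|]; first by rewrite addr0.
  by apply: has_derivD => //; exact: has_deriv_cst.
suff : f x - G x = f 0 - G 0 by lra.
have H y : (fun n => F n y - G y) @ \oo --> f y - G y.
  by apply: cvgB; [exact: Ff|exact: cvg_cst].
have H2 : (fun n => (F n x - G x) - (F n 0 - G 0)) @ \oo --> (f x - G x) - (f 0 - G 0).
  by apply: cvgB; exact: H.
have H3 : (fun n => (F n x - G x) - (F n 0 - G 0)) @ \oo --> (0 : R).
  have : (fun n => rho n * `|x|) @ \oo --> (0 : R).
    by rewrite -(mul0r `|x|); apply: cvgM => //; exact: cvg_cst.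
  apply: cvg_by_bound => n; rewrite subr0.
  have := deriv_bound_lip (has_derivB (D n) DG) (F'f n) x 0.
  by rewrite subr0.
by apply/eqP; rewrite -subr_eq0; apply/eqP; exact: cvg_unique H2 H3.
Qed.

(** Telescoping majorants make the tails of a series explicit. *)
Lemma telescope_series (t : nat -> R) (rho : nat -> R) :
  (forall n, `|t n| <= rho n - rho n.+1) -> rho @ \oo --> (0 : R) ->
  exists s, forall N, `|(\sum_(i < N) t i) - s| <= rho N.
Proof.
move=> tr r0.
have tail N M : (N <= M)%N -> `|(\sum_(i < M) t i) - \sum_(i < N) t i| <= rho N - rho M.
  elim: M => [|M IH]; first by rewrite leqn0 => /eqP ->; rewrite !subrr normr0.
  rewrite leq_eqVlt => /predU1P[->|]; first by rewrite !subrr normr0.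
  rewrite ltnS => /IH h; rewrite big_ord_recr/= addrAC.
  apply: le_trans (ler_normD _ _) _; have := tr M; lra.
have rd N M : (N <= M)%N -> rho M <= rho N.
  by move=> NM; rewrite -subr_ge0; apply: le_trans (tail N M NM); exact: normr_ge0.
have rho_ge0 N : 0 <= rho N.
  have <- : lim (rho @ \oo) = (0 : R) by apply/cvg_lim.
  apply: limr_le; first by apply/cvg_ex; exists 0.
  by near=> M; apply: rd; near: M; exists N.
pose S N := \sum_(i < N) t i.
have cS : cvg (S @ \oo).
  apply/cauchy_cvgP/cauchyP => e e0.
  have [n _ rn] : \forall n \near \oo, rho n < e.
    have /cvgrPdist_lt/(_ _ e0) := r0; apply: filterS => n /=.
    by rewrite sub0r normrN; apply: le_lt_trans; exact: ler_norm.
  exists (S n); exists n => // k nk; rewrite /ball/= distrC.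
  apply: le_lt_trans (tail n k nk) _.
  by have := rn n (leqnn n); have := rho_ge0 k; lra.
exists (lim (S @ \oo)) => N.
have H : (fun M => `|S M - S N|) @ \oo --> `|lim (S @ \oo) - S N|.
  by apply: cvg_norm; apply: cvgB => //; exact: cvg_cst.
rewrite distrC; have <- := cvg_lim (@Rhausdorff R) H.
apply: limr_le; first by apply/cvg_ex; eexists; exact: H.
near=> M; have NM : (N <= M)%N by near: M; exists N.
by have := tail N M NM; have := rho_ge0 M; rewrite /S; lra.
Unshelve. all: by end_near. Qed.

End Calculus.

(** * Periodic functions of class C1 *)

Section Periodic.
Context {R : realType}.
Implicit Types f g h : R -> R.
Notation mu := (@lebesgue_measure R).
Notation intg := circle_integrable.
Notation I := circle_int.
Local Notation U01 := (`[0%R, 1%R]%classic : set (measurableTypeR R)).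

Lemma periodic_int (V : Type) (f : R -> V) : (forall x, f (x + 1) = f x) ->
  forall (n : int) x, f (x + n%:~R) = f x.
Proof.
move=> pf; have pn (n : nat) x : f (x + n%:R) = f x.
  elim: n x => [|n IH] x; first by rewrite addr0.
  by rewrite -natr1 addrA pf IH.
by case=> n x; [exact: pn | rewrite NegzE intrN -[in RHS](subrK (n.+1%:R) x) pn].
Qed.

Lemma frac_unit (x : R) : 0 <= x - (Num.floor x)%:~R < 1.
Proof.
have /andP[h1 h2] := real_floor_itv (num_real x).
by move: h2; rewrite intrD; lra.
Qed.

Lemma periodic_frac (V : Type) (f : R -> V) : (forall x, f (x + 1) = f x) ->
  forall x, f x = f (x - (Num.floor x)%:~R).
Proof. by move=> pf x; rewrite -intrN periodic_int. Qed.

Lemma periodic_deriv f f' : has_deriv f f' -> periodic f 1 -> periodic f' 1.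
Proof.
move=> D pf x; have := has_deriv_shift 1 D.
rewrite (_ : (fun x => f (x + 1)) = f); last exact/funext.
by move/(has_deriv_unique D)/(congr1 (@^~ x))/esym.
Qed.

Lemma periodic_bounded f : continuous f -> periodic f 1 ->
  exists B : R, forall x, `|f x| <= B.
Proof.
move=> cf pf; have cnf : {within `[0%R, 1%R], continuous (fun x => `|f x|)}.
  apply: continuous_subspaceT => x; apply: cvg_norm; exact: cf.
have [c _ H] := EVT_max ler01 cnf; exists `|f c| => x.
rewrite (periodic_frac pf); apply: H; rewrite in_itv/=.
by have := frac_unit x; lra.
Qed.

Definition circleC1 f f' := [/\ has_deriv f f', continuous f' & periodic f 1].

Lemma circleC1_continuous f f' : circleC1 f f' -> continuous f.
Proof. by case=> /has_deriv_continuous. Qed.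

Lemma circleC1_periodic f f' : circleC1 f f' -> periodic f' 1.
Proof. by case=> D _ /(periodic_deriv D). Qed.

Lemma eq_circleC1 f f' g' : (forall x, f' x = g' x) -> circleC1 f f' -> circleC1 f g'.
Proof. by move=> e; rewrite (_ : f' = g')//; exact/funext. Qed.

Lemma circleC1_cst (k : R) : circleC1 (fun=> k) (fun=> 0).
Proof. by split => //; [exact: has_deriv_cst | move=> x; exact: cvg_cst]. Qed.

Lemma continuousDR f g : continuous f -> continuous g -> continuous (fun x => f x + g x).
Proof. by move=> F G x; apply: cvgD; [exact: F|exact: G]. Qed.

Lemma continuousMR f g : continuous f -> continuous g -> continuous (fun x => f x * g x).
Proof. by move=> F G x; apply: cvgM; [exact: F|exact: G]. Qed.

Lemma continuousZR (k : R) f : continuous f -> continuous (fun x => k * f x).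
Proof. by move=> F; apply: continuousMR => // x; exact: cvg_cst. Qed.

Lemma continuousBR f g : continuous f -> continuous g -> continuous (fun x => f x - g x).
Proof. by move=> F G x; apply: cvgB; [exact: F|exact: G]. Qed.

Lemma continuous_compR f g : continuous f -> continuous g -> continuous (fun x => f (g x)).
Proof. by move=> F G x; apply: continuous_comp; [exact: G|exact: F]. Qed.

Lemma continuous_sumR n (F : nat -> R -> R) :
  (forall i, continuous (F i)) -> continuous (fun x => \sum_(i < n) F i x).
Proof.
move=> cF; elim: n => [|n IH].
  rewrite (_ : (fun x : R => \sum_(_ < 0) F _ x) = fun=> 0).
    by move=> x; exact: cvg_cst.
  by apply/funext => x; rewrite big_ord0.
rewrite (_ : (fun x => _) = fun x => \sum_(i < n) F i x + F n x).
  exact: continuousDR.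
by apply/funext => x; rewrite big_ord_recr.
Qed.

Lemma circleC1D f f' g g' : circleC1 f f' -> circleC1 g g' ->
  circleC1 (fun x => f x + g x) (fun x => f' x + g' x).
Proof.
move=> [D1 c1 p1] [D2 c2 p2]; split; first exact: has_derivD.
  exact: continuousDR.
by move=> x; rewrite p1 p2.
Qed.

Lemma circleC1Z (k : R) f f' : circleC1 f f' ->
  circleC1 (fun x => k * f x) (fun x => k * f' x).
Proof.
move=> [D1 c1 p1]; split; first exact: has_derivZ.
  exact: continuousZR.
by move=> x; rewrite p1.
Qed.

Lemma circleC1M f f' g g' : circleC1 f f' -> circleC1 g g' ->
  circleC1 (fun x => f x * g x) (fun x => f' x * g x + f x * g' x).
Proof.
move=> [D1 c1 p1] [D2 c2 p2]; split; first exact: has_derivM.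
  apply: continuousDR; apply: continuousMR => //; exact: has_deriv_continuous.
by move=> x; rewrite p1 p2.
Qed.

Lemma circleC1_sum n (F F' : nat -> R -> R) : (forall i, circleC1 (F i) (F' i)) ->
  circleC1 (fun x => \sum_(i < n) F i x) (fun x => \sum_(i < n) F' i x).
Proof.
move=> D; split; first by apply: has_deriv_sum => i; case: (D i).
  by apply: continuous_sumR => i; case: (D i).
by move=> x; apply: eq_bigr => i _; case: (D i).
Qed.

Lemma circle_int_deriv f f' : circleC1 f f' -> I f' = 0.
Proof. by case=> D c p; rewrite (FTC_unit D c) -[1]add0r p subrr. Qed.

Lemma circle_int_by_parts f f' g g' : circleC1 f f' -> circleC1 g g' ->
  I (fun x => f x * g' x) = - I (fun x => f' x * g x).
Proof.
move=> F G; have := circle_int_deriv (circleC1M F G).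
have [_ cf' _] := F; have [_ cg' _] := G.
have cf := circleC1_continuous F; have cg := circleC1_continuous G.
rewrite circle_intD; [|exact/continuous_integrable/continuousMR..].
by move=> /eqP; rewrite addrC addr_eq0 => /eqP.
Qed.

(** A function that is constant outside the unit interval glues to a continuous
    periodic one: near each point only two consecutive translates matter. *)
Lemma periodic_extension f k : continuous f -> (forall x, x <= 0 -> f x = k) ->
  (forall x, 1 <= x -> f x = k) ->
  exists F : R -> R, [/\ continuous F, periodic F 1 & forall x : R, 0 <= x <= 1 -> F x = f x].
Proof.
move=> cf f0 f1; pose F x := f (x - (Num.floor x)%:~R).
have pF : periodic F 1.
  by move=> x; rewrite /F floorDrz ?intr1// floor1 intrD; congr f; ring.
have FE (m : int) x : m%:~R - 1 < x < m%:~R + 1 ->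
    F x = f (x - m%:~R) + f (x - m%:~R + 1) - k.
  move=> /andP[h1 h2]; rewrite /F; have [mx|xm] := leP m%:~R x.
    rewrite (_ : Num.floor x = m); last by apply/floor_def; rewrite mx intrD.
    by rewrite [X in _ + X - _]f1 ?addrK//; lra.
  rewrite (_ : Num.floor x = m - 1); last first.
    by apply/floor_def; rewrite subrK xm intrB ltW.
  rewrite intrB [X in _ = X + _ - _]f0; last lra.
  rewrite [k + _]addrC addrK; congr f; ring.
exists F; split => //; last first.
  move=> x /andP[x0]; rewrite le_eqVlt => /predU1P[->|x1].
    by rewrite -[in LHS](add0r 1) pF /F floor0 subr0 f0// f1.
  rewrite /F (_ : Num.floor x = 0) ?subr0//.
  by apply/floor_def; rewrite x0 add0r.
move=> x; pose m := Num.floor x; have := frac_unit x; rewrite -/m => mx.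
pose G y := f (y - m%:~R) + f (y - m%:~R + 1) - k.
have nFG : {near x, G =1 F}.
  near=> y; rewrite (FE m)//.
  have xy : `|y - x| < Num.min (x - m%:~R + 1) (m%:~R + 1 - x).
    near: y; apply/nbhs_ballP.
    exists (Num.min (x - m%:~R + 1) (m%:~R + 1 - x)) => /=.
      by rewrite lt_min; apply/andP; split; lra.
    by move=> z; rewrite /ball/= distrC.
  move: xy; rewrite lt_min !ltr_norml => /andP[/andP[h1 h2] /andP[h3 h4]].
  by apply/andP; split; lra.
have cG : continuous G.
  have cs : continuous (fun y : R => y - m%:~R).
    by apply: continuousBR => // y; [exact: cvg_id | exact: cvg_cst].
  apply: continuousBR; last by move=> y; exact: cvg_cst.
  apply: continuousDR; first exact: continuous_compR.
  apply: continuous_compR => //; apply: continuousDR => // y; exact: cvg_cst.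
rewrite /continuous_at; have -> : F x = G x by rewrite (FE m)//; lra.
exact: cvg_trans (near_eq_cvg nFG) (cG x).
Unshelve. all: by end_near. Qed.
End Periodic.

(** * Integration by parts for primitives of integrable functions *)

Section PrimitiveByParts.
Context {R : realType}.
Implicit Types f g h : R -> R.
Notation mu := (@lebesgue_measure R).
Notation intg := circle_integrable.
Notation I := circle_int.
Local Notation U01 := (`[0%R, 1%R]%classic : set (measurableTypeR R)).

Lemma eq_circle_int_unit f g : (forall x : R, 0 <= x <= 1 -> f x = g x) -> I f = I g.
Proof.
move=> fg; apply: eq_Rintegral => x; rewrite inE/= in_itv/=; exact: fg.
Qed.

Lemma unitP (x : R) : U01 x = (0 <= x <= 1) :> Prop.
Proof. by rewrite /= in_itv. Qed.

Lemma measurable_funU f : measurable_fun setT f -> measurable_fun U01 f.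
Proof. exact: measurable_funTS. Qed.

Lemma continuous_measurableU f : continuous f -> measurable_fun U01 f.
Proof. by move/continuous_measurable/measurable_funU. Qed.

(** Indicators of half-lines turn integrals with a variable bound into integrals
    over the circle, where all estimates are available. *)
Definition below (x : R) : R -> R := \1_(`]-oo, x]%classic : set (measurableTypeR R)).

Lemma measurable_below x : measurable_fun setT (below x).
Proof. exact: measurable_indic. Qed.

Lemma belowE x t : below x t = if t <= x then 1 else 0.
Proof.
rewrite /below indicE; case: ifPn => tx; last by rewrite memNset//= in_itv/=; exact/negP.
by rewrite mem_set//= in_itv.
Qed.

Lemma norm_below x t : `|below x t| <= 1.
Proof. by rewrite belowE; case: ifP; rewrite ?normr1 ?normr0. Qed.

Lemma circle_integrable_below f x : intg f -> intg (fun t => f t * below x t).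
Proof.
move=> F; apply: (circle_integrableM F (measurable_funU (measurable_below x))).
by move=> t _; exact: norm_below.
Qed.

Lemma circle_int_below f x : I (fun t => f t * below x t) =
  \int[mu]_(t in U01 `&` `]-oo, x]) f t.
Proof.
rewrite Rintegral_mkcondr; apply: eq_Rintegral => t _.
rewrite patchE belowE; case: ifPn => tx; first by rewrite mulr1 mem_set//= in_itv.
by rewrite mulr0 memNset//= in_itv/=; exact/negP.
Qed.

Lemma circle_int_below_deriv g' g x : has_deriv g g' -> continuous g' ->
  I (fun t => g' t * below x t) = g (Num.min 1 (Num.max 0 x)) - g 0.
Proof.
move=> D cg; rewrite circle_int_below; have [x0|x0] := ltP x 0.
  rewrite (_ : _ `&` _ = set0) ?Rintegral_set0; last first.
    by apply/seteqP; split => // t [/=]; rewrite !in_itv/=; lra.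
  by rewrite (min_idPr ler01) subrr.
rewrite (_ : _ `&` _ = `[0%R, Num.min 1 x]%classic).
  by rewrite (FTC D cg)// le_min ler01.
by apply/seteqP; split => t /=; rewrite !in_itv/= le_min; [move=> [/andP[-> ->] ->]|move=> /and3P[-> -> ->]].
Qed.

(** Primitives of integrable functions obey integration by parts: this is
    classical for a continuous integrand, and both sides are continuous for the
    L1 norm of the integrand. *)
Lemma primitive_by_parts w : intg w -> I w = 0 ->
  exists F : R -> R, [/\ continuous F, periodic F 1 &
    forall psi psi', circleC1 psi psi' ->
      I (fun x => F x * psi' x) = - I (fun x => w x * psi x)].
Proof.
move=> iw w0; pose P x := I (fun t => w t * below x t).
have [g [cg ig gw]] := approximation_continuous_integrable measurable_unit
  (compact_finite_measure (@segment_compact _ 0 1)) iw.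
pose r k := I (fun t => `|w t - g k t|).
have r0 : r @ \oo --> (0 : R).
  by apply: (@fine_cvg _ _ _ _ (fun n => \int[mu]_(z in `[0%R, 1%R]) `|(w z - g n z)%:E|)%E).
have igw k : intg (fun t => w t - g k t) by apply: circle_integrableB => //; exact: ig.
pose G k := projT1 (cid (antiderivative (cg k))).
have DG k : has_deriv (G k) (g k) by rewrite /G; case: cid.
pose Pk k x := G k (Num.min 1 (Num.max 0 x)) - G k 0.
have cPk k : continuous (Pk k).
  apply: continuousBR; last by move=> x; exact: cvg_cst.
  apply: (@continuous_compR _ (G k)); first exact: has_deriv_continuous (DG k).
  move=> x; apply: continuous_min; first exact: cvg_cst.
  by apply: continuous_max; [exact: cvg_cst | exact: cvg_id].
have PkP k x : `|Pk k x - P x| <= r k.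
  rewrite /Pk -(circle_int_below_deriv x (DG k) (cg k)) distrC /P.
  rewrite -circle_intB; [|by apply: circle_integrable_below => //; exact: ig..].
  rewrite (_ : I _ = I (fun t => (w t - g k t) * below x t)); last first.
    by apply: eq_circle_int => t; rewrite mulrBl.
  rewrite -[r k]mul1r; apply: norm_circle_intM => //.
    exact: (measurable_funU (measurable_below x)).
  by move=> t _; exact: norm_below.
have cP : continuous P := uniform_limit_continuousR cPk PkP r0.
have P0 x : x <= 0 -> P x = 0.
  move=> x0; apply: (eq_cvg0 (u := r)) => // k.
  apply: le_trans (PkP k x); rewrite distrC.
  by rewrite /Pk (max_idPl x0) (min_idPr ler01) subrr.
have P1 x : 1 <= x -> P x = 0.
  move=> x1; rewrite /P -w0; apply: eq_circle_int_unit => t /andP[_ t1].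
  by rewrite belowE (le_trans t1 x1) mulr1.
have [F [cF pF FP]] := periodic_extension cP P0 P1.
exists F; split => // psi psi' [D cpsi' ppsi].
have cpsi := has_deriv_continuous D.
have [B psiB] := periodic_bounded cpsi ppsi.
have [B' psiB'] := periodic_bounded cpsi' (periodic_deriv D ppsi).
have mpsi := continuous_measurableU cpsi.
have mpsi' := continuous_measurableU cpsi'.
have -> : I (fun x => F x * psi' x) = I (fun x => P x * psi' x).
  by apply: eq_circle_int_unit => x /FP ->.
have iPk k : intg (Pk k) by exact: continuous_integrable.
have iP : intg P by exact: continuous_integrable.
apply/eqP; rewrite -addr_eq0; apply/eqP.
apply: (eq_cvg0 (u := fun k => r k * (B' + B + B))); last first.
  by rewrite -(mul0r (B' + B + B)); apply: cvgM => //; exact: cvg_cst.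
move=> k; rewrite subr0.
have parts : I (fun x => Pk k x * psi' x) + I (fun x => g k x * psi x) = I (g k) * psi 1.
  have DH : has_deriv (fun x => (G k x - G k 0) * psi x)
      (fun x => g k x * psi x + (G k x - G k 0) * psi' x).
    apply: has_derivM => //.
    apply: eq_has_deriv (has_derivB (DG k) (has_deriv_cst (G k 0))) => x.
    by rewrite subr0.
  have cGk : continuous (fun x => G k x - G k 0).
    apply: continuousBR; last by move=> x; exact: cvg_cst.
    exact: has_deriv_continuous (DG k).
  rewrite (FTC_unit (DG k) (cg k)).
  have := FTC_unit DH; rewrite subrr mul0r subr0 => <-; last first.
    by apply: continuousDR; exact: continuousMR.
  rewrite circle_intD; [|exact/continuous_integrable/continuousMR..].
  rewrite addrC; congr (_ + _); apply: eq_circle_int_unit => x /andP[x0 x1].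
  by rewrite /Pk (max_idPr x0) (min_idPr x1).
have igk : `|I (g k)| <= r k.
  have : `|I (fun t => w t - g k t)| <= r k by exact: le_norm_circle_int.
  by rewrite (circle_intB iw (ig k)) w0 sub0r normrN.
have e1 : `|I (fun x => P x * psi' x) - I (fun x => Pk k x * psi' x)| <= r k * B'.
  rewrite -circle_intB; [|exact/continuous_integrable/continuousMR..].
  apply: norm_circle_int_bounded.
    by apply: continuous_measurableU; apply: continuousBR; exact: continuousMR.
  by move=> x _; rewrite -mulrBl normrM distrC ler_pM.
have iM f : intg f -> intg (fun x => f x * psi x).
  by move=> iF; apply: (circle_integrableM iF mpsi (B := B)) => x _.
have e2 : `|I (fun x => w x * psi x) - I (fun x => g k x * psi x)| <= B * r k.
  rewrite -circle_intB; [|by apply: iM => //; exact: ig..].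
  rewrite (_ : I _ = I (fun t => (w t - g k t) * psi t)); last first.
    by apply: eq_circle_int => t; rewrite mulrBl.
  exact: norm_circle_intM.
have -> : I (fun x => P x * psi' x) + I (fun x => w x * psi x) =
    (I (fun x => P x * psi' x) - I (fun x => Pk k x * psi' x)) +
    (I (fun x => w x * psi x) - I (fun x => g k x * psi x)) + I (g k) * psi 1.
  by rewrite -parts; ring.
apply: le_trans (ler_normD _ _) _; rewrite [leRHS]mulrDr.
apply: lerD; last by rewrite normrM ler_pM.
apply: le_trans (ler_normD _ _) _; rewrite mulrDr; apply: lerD => //.
by rewrite mulrC.
Qed.

End PrimitiveByParts.

(** * Uniqueness of Fourier coefficients *)

Section FourierUniqueness.
Context {R : realType}.
Implicit Types f g h : R -> R.
Notation mu := (@lebesgue_measure R).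
Notation intg := circle_integrable.
Notation I := circle_int.
Local Notation U01 := (`[0%R, 1%R]%classic : set (measurableTypeR R)).

Definition cosn (n : nat) (x : R) := cos (2 * pi * n%:R * x).
Definition sinn (n : nat) (x : R) := sin (2 * pi * n%:R * x).

Lemma has_deriv_lin (k : R) : has_deriv (fun x => k * x) (fun=> k).
Proof.
have D : has_deriv (fun x : R => x) (fun=> 1) by move=> x; exact: is_derive_id.
by apply: eq_has_deriv (has_derivZ k D) => x; rewrite mulr1.
Qed.

Lemma has_deriv_cosn n : has_deriv (cosn n) (fun x => - (2 * pi * n%:R) * sinn n x).
Proof.
have D : has_deriv (@cos R) (fun x => - sin x) by move=> x; exact: is_derive_cos.
by apply: eq_has_deriv (has_deriv_comp D (has_deriv_lin _)) => x; rewrite mulNr mulrC mulNr.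
Qed.

Lemma has_deriv_sinn n : has_deriv (sinn n) (fun x => 2 * pi * n%:R * cosn n x).
Proof.
have D : has_deriv (@sin R) (@cos R) by move=> x; exact: is_derive_sin.
by apply: eq_has_deriv (has_deriv_comp D (has_deriv_lin _)) => x; rewrite mulrC.
Qed.

Lemma continuous_cosn n : continuous (cosn n).
Proof. exact: has_deriv_continuous (has_deriv_cosn n). Qed.

Lemma continuous_sinn n : continuous (sinn n).
Proof. exact: has_deriv_continuous (has_deriv_sinn n). Qed.

Lemma angle_shift n (x : R) : 2 * pi * n%:R * (x + 1) = 2 * pi * n%:R * x + pi *+ 2 *+ n.
Proof. by rewrite -[pi *+ 2 *+ n]mulr_natr -[pi *+ 2]mulr_natr; ring. Qed.

Lemma periodic_cosn n : periodic (cosn n) 1.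
Proof. by move=> x; rewrite /cosn angle_shift; apply: periodicn; exact: cosD2pi. Qed.

Lemma periodic_sinn n : periodic (sinn n) 1.
Proof. by move=> x; rewrite /sinn angle_shift; apply: periodicn; exact: sinD2pi. Qed.

Lemma norm_cosn n x : `|cosn n x| <= 1.
Proof. by rewrite ler_norml cos_geN1 cos_le1. Qed.

Lemma norm_sinn n x : `|sinn n x| <= 1.
Proof. by rewrite ler_norml sin_geN1 sin_le1. Qed.

Lemma cosn0 x : cosn 0 x = 1. Proof. by rewrite /cosn mulr0 mul0r cos0. Qed.
Lemma sinn0 x : sinn 0 x = 0. Proof. by rewrite /sinn mulr0 mul0r sin0. Qed.

Lemma angleS n (x : R) : 2 * pi * n.+1%:R * x = 2 * pi * n%:R * x + 2 * pi * 1%:R * x.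
Proof. by rewrite -addn1 natrD; ring. Qed.

Lemma cosnS n x : cosn n.+1 x = cosn n x * cosn 1 x - sinn n x * sinn 1 x.
Proof. by rewrite /cosn angleS cosD. Qed.

Lemma sinnS n x : sinn n.+1 x = sinn n x * cosn 1 x + cosn n x * sinn 1 x.
Proof. by rewrite /sinn angleS sinD. Qed.

Lemma cosnsinn1 x : cosn 1 x ^+ 2 + sinn 1 x ^+ 2 = 1.
Proof. exact: cos2Dsin2. Qed.

Section Uniqueness.
Context (f : R -> R) (intf : intg f).
Context (f_cos : forall n, I (fun x => f x * cosn n x) = 0).
Context (f_sin : forall n, I (fun x => f x * sinn n x) = 0).

(** Testing against every mode makes this class of multipliers stable under
    multiplication by the first harmonics, hence by polynomials in them. *)
Let annihilates (q : R -> R) := continuous q /\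
  forall n, I (fun x => f x * (q x * cosn n x)) = 0 /\
            I (fun x => f x * (q x * sinn n x)) = 0.

Let intfM q : continuous q -> intg (fun x => f x * q x).
Proof.
move=> cq; have cn : {within `[0%R, 1%R], continuous (fun x => `|q x|)}.
  by apply: continuous_subspaceT => x; apply: cvg_norm; exact: cq.
have [c _ H] := EVT_max ler01 cn.
apply: (circle_integrableM intf (continuous_measurableU cq) (B := `|q c|)) => x.
by rewrite unitP => x01; apply: H; rewrite in_itv.
Qed.

Let annihilates_lin a b q r : annihilates q -> annihilates r ->
  annihilates (fun x => a * q x + b * r x).
Proof.
move=> [cq Hq] [cr Hr].
split; first by apply: continuousDR; exact: continuousZR.
have L (e : R -> R) : continuous e ->
    I (fun x => f x * ((a * q x + b * r x) * e x)) =
    a * I (fun x => f x * (q x * e x)) + b * I (fun x => f x * (r x * e x)).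
  move=> ce; have i1 := intfM (continuousMR cq ce).
  have i2 := intfM (continuousMR cr ce).
  rewrite -!circle_intZ// -circle_intD; [|exact: circle_integrableZ..].
  by apply: eq_circle_int => x; ring.
move=> n; rewrite !L; [|exact: continuous_sinn|exact: continuous_cosn].
by have [-> ->] := Hq n; have [-> ->] := Hr n; rewrite !mulr0 addr0.
Qed.

Let eq_annihilates q r : (forall x, q x = r x) -> annihilates q -> annihilates r.
Proof. by move=> qr; rewrite (_ : q = r)//; exact/funext. Qed.

Let annihilates_harmonic q : annihilates q ->
  annihilates (fun x => q x * cosn 1 x) /\ annihilates (fun x => q x * sinn 1 x).
Proof.
move=> [cq Hq].
have ic n : intg (fun x => f x * (q x * cosn n x)).
  by apply/intfM/continuousMR => //; exact: continuous_cosn.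
have iS n : intg (fun x => f x * (q x * sinn n x)).
  by apply/intfM/continuousMR => //; exact: continuous_sinn.
have comb a b (u v w : R -> R) : intg u -> intg v ->
    (forall x, w x = a * u x + b * v x) -> I u = 0 -> I v = 0 -> I w = 0.
  move=> iu iv wE u0 v0; rewrite (eq_circle_int wE) circle_intD;
    [|exact: circle_integrableZ..].
  by rewrite !circle_intZ// u0 v0 !mulr0 addr0.
have c2 x := cosnsinn1 x.
have s2 x : sinn 1 x ^+ 2 = 1 - cosn 1 x ^+ 2 by rewrite -(c2 x); ring.
have step n x : cosn n x = cosn n.+1 x * cosn 1 x + sinn n.+1 x * sinn 1 x /\
    sinn n x = sinn n.+1 x * cosn 1 x - cosn n.+1 x * sinn 1 x.
  by rewrite (cosnS n) (sinnS n); split; rewrite -[LHS]mulr1 -(c2 x); ring.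
split; split.
- by apply: continuousMR => //; exact: continuous_cosn.
- case=> [|n]; split.
  + rewrite -[RHS](Hq 1%N).1; apply: eq_circle_int => x; rewrite cosn0; ring.
  + rewrite -[RHS](circle_int_cst 0); apply: eq_circle_int => x; rewrite sinn0; ring.
  + apply: (comb 2^-1 2^-1 _ _ _ (ic n) (ic n.+2)) => [x||]; last 2 first.
    * exact: (Hq _).1.
    * exact: (Hq _).1.
    by rewrite (cosnS n.+1) (step n x).1; field.
  + apply: (comb 2^-1 2^-1 _ _ _ (iS n) (iS n.+2)) => [x||]; last 2 first.
    * exact: (Hq _).2.
    * exact: (Hq _).2.
    by rewrite (sinnS n.+1) (step n x).2; field.
- by apply: continuousMR => //; exact: continuous_sinn.
- case=> [|n]; split.
  + rewrite -[RHS](Hq 1%N).2; apply: eq_circle_int => x; rewrite cosn0; ring.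
  + rewrite -[RHS](circle_int_cst 0); apply: eq_circle_int => x; rewrite sinn0; ring.
  + apply: (comb 2^-1 (- 2^-1) _ _ _ (iS n.+2) (iS n)) => [x||]; last 2 first.
    * exact: (Hq _).2.
    * exact: (Hq _).2.
    by rewrite (sinnS n.+1) (step n x).2; field.
  + apply: (comb 2^-1 (- 2^-1) _ _ _ (ic n) (ic n.+2)) => [x||]; last 2 first.
    * exact: (Hq _).1.
    * exact: (Hq _).1.
    by rewrite (cosnS n.+1) (step n x).1; field.
Qed.

Let annihilates1 : annihilates (fun=> 1).
Proof.
split; first by move=> x; exact: cvg_cst.
move=> n; split; [rewrite -[RHS](f_cos n)|rewrite -[RHS](f_sin n)];
  by apply: eq_circle_int => x; rewrite mul1r.
Qed.

Let annihilates_poly a b c (p : {poly R}) :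
  annihilates (fun x => p.[a + b * cosn 1 x + c * sinn 1 x]).
Proof.
elim/poly_ind: p => [|p k IH].
  apply: eq_annihilates (annihilates_lin 0 0 annihilates1 annihilates1) => x.
  by rewrite horner0 !mul0r addr0.
have [Hc Hs] := annihilates_harmonic IH.
have H1 := annihilates_lin a b IH Hc; have H2 := annihilates_lin 1 c H1 Hs.
apply: eq_annihilates (annihilates_lin 1 k H2 annihilates1) => x.
by rewrite hornerMXaddC; ring.
Qed.

Lemma annihilated_poly a b c (p : {poly R}) :
  I (fun x => f x * p.[a + b * cosn 1 x + c * sinn 1 x]) = 0.
Proof.
have [_ /(_ 0%N) [<- _]] := annihilates_poly a b c p.
by apply: eq_circle_int => x; rewrite cosn0 mulr1.
Qed.

End Uniqueness.
End FourierUniqueness.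
Section SignApproximation.
Context {R : realType}.
Implicit Types f g h : R -> R.
Notation mu := (@lebesgue_measure R).
Notation intg := circle_integrable.
Notation I := circle_int.
Local Notation U01 := (`[0%R, 1%R]%classic : set (measurableTypeR R)).

Lemma circle_int_dominated (F : nat -> R -> R) f g :
  (forall n, measurable_fun U01 (F n)) -> measurable_fun U01 f -> intg g ->
  (forall n x, `|F n x| <= g x) ->
  (forall x : R, 0 <= x <= 1 -> F ^~ x @ \oo --> f x) ->
  (fun n => I (F n)) @ \oo --> I f.
Proof.
move=> mF mf ig Fg Ff.
have mF' n : measurable_fun U01 (EFin \o F n) by exact/measurable_EFinP.
have mf' : measurable_fun U01 (EFin \o f) by exact/measurable_EFinP.
have cF : {ae mu, forall x, U01 x -> (fun n => (F n x)%:E) @ \oo --> (f x)%:E}.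
  apply: aeW => x; rewrite unitP => x01; apply: cvg_EFin; first by apply: nearW.
  exact: Ff.
have bF : {ae mu, forall x n, U01 x -> (`|(F n x)%:E| <= (g x)%:E)%E}.
  by apply: aeW => x n _; rewrite lee_fin.
have [iF _ H] := dominated_convergence measurable_unit mF' mf' cF ig bF.
apply: fine_cvg; rewrite fineK; first exact: H.
exact: integrable_fin_num.
Qed.

(** The fixed points 0 and 1, -1 of this odd cubic are respectively repelling and
    attracting on [-1, 1], so that its iterates tend to the sign function. *)
Definition cubic_step (t : R) := (3 * t - t ^+ 3) / 2.

Definition cubic_poly : nat -> {poly R} :=
  fix P k := if k is k'.+1 then (3 / 2) *: P k' - 2^-1 *: P k' ^+ 3 else 'X.

Lemma cubic_polyE k t : (cubic_poly k).[t] = iter k cubic_step t.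
Proof.
elim: k => [|k IH] /=; first by rewrite hornerX.
by rewrite hornerD hornerN !hornerZ horner_exp IH /cubic_step; field.
Qed.

Lemma cubic_iter_odd k t : iter k cubic_step (- t) = - iter k cubic_step t.
Proof. by elim: k => //= k ->; rewrite /cubic_step; field. Qed.

Lemma cubic_iter_pos k t : 0 <= t <= 1 ->
  t <= iter k cubic_step t <= 1 /\
  1 - iter k cubic_step t <= (1 - t / 2) ^+ k.
Proof.
move=> /andP[t0 t1]; elim: k => [|k [/andP[h1 h2] h3]] /=.
  by rewrite lexx t1 expr0; split => //; lra.
move: (iter k cubic_step t) h1 h2 h3 => u h1 h2 h3.
have u0 : 0 <= u by lra.
have e1 : 1 - cubic_step u = (1 - u) ^+ 2 * (2 + u) / 2 by rewrite /cubic_step; field.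
have e2 : cubic_step u - u = u * (1 - u) * (1 + u) / 2 by rewrite /cubic_step; field.
have p1 : 0 <= u * (1 - u) * (1 + u) by rewrite !mulr_ge0//; lra.
have p2 : 0 <= (1 - u) ^+ 2 * (2 + u) by rewrite mulr_ge0 ?sqr_ge0//; lra.
split; first by apply/andP; split; lra.
rewrite e1 [leRHS]exprSr; apply: le_trans (_ : (1 - u) * (1 - t / 2) <= _); last first.
  by apply: ler_wpM2r => //; lra.
have -> : (1 - u) ^+ 2 * (2 + u) / 2 = (1 - u) * ((1 - u) * (2 + u) / 2) by field.
apply: ler_wpM2l; first lra.
by have := mulr_ge0 u0 u0; lra.
Qed.

Lemma norm_cubic_iter k t : `|t| <= 1 -> `|iter k cubic_step t| <= 1.
Proof.
wlog t0 : t / 0 <= t => [H|].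
  case/orP: (le_total 0 t) => ht; first exact: H.
  have -> : iter k cubic_step t = - iter k cubic_step (- t).
    by rewrite cubic_iter_odd opprK.
  by rewrite normrN -(normrN t); apply: H; lra.
rewrite ger0_norm// => t1; have [] := @cubic_iter_pos k t; first by rewrite t0.
by move=> /andP[h1 h2] _; rewrite ger0_norm//; lra.
Qed.

Lemma cubic_iter_cvg t : `|t| <= 1 -> (fun k => iter k cubic_step t) @ \oo --> Num.sg t.
Proof.
have pos u : 0 < u <= 1 -> (fun k => iter k cubic_step u) @ \oo --> (1 : R).
  move=> /andP[u0 u1]; apply: (cvg_by_bound (r := fun k => (1 - u / 2) ^+ k)).
    move=> k; have [|/andP[h1 h2] h3] := @cubic_iter_pos k u; first by rewrite ltW.
    by rewrite distrC ger0_norm//; lra.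
  by apply: cvg_expr; rewrite ger0_norm; lra.
move=> tl; have [->|t0|t0] := sgrP t.
- rewrite (_ : (fun k => _) = fun=> 0); first exact: cvg_cst.
  by apply/funext; elim=> //= k ->; rewrite /cubic_step expr0n/= mulr0 subrr mul0r.
- by apply: pos; rewrite t0/=; apply: le_trans (ler_norm _) tl.
- rewrite (_ : (fun k => _) = fun k => - iter k cubic_step (- t)); last first.
    by apply/funext => k; rewrite cubic_iter_odd opprK.
  by apply: cvgN; apply: pos; have := ler_norm (- t); rewrite normrN; lra.
Qed.

Lemma ae_imply (P Q : R -> Prop) : (forall x, P x -> Q x) ->
  {ae mu, forall x, P x} -> {ae mu, forall x, Q x}.
Proof. by move=> PQ; apply: filterS; first exact: (ae_filter_ringOfSetsType mu). Qed.

Lemma ae_imply2 (P P' Q : R -> Prop) : (forall x, P x -> P' x -> Q x) ->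
  {ae mu, forall x, P x} -> {ae mu, forall x, P' x} -> {ae mu, forall x, Q x}.
Proof. by move=> PQ; apply: filterS2; first exact: (ae_filter_ringOfSetsType mu). Qed.

Lemma ae_all (P : R -> Prop) : (forall x, P x) -> {ae mu, forall x, P x}.
Proof. by apply: filterE; exact: (ae_filter_ringOfSetsType mu). Qed.

Lemma ae_neq (a b c : R) : {ae mu, forall x, [/\ x <> a, x <> b & x <> c]}.
Proof.
exists ([set a] `|` [set b] `|` [set c]); split.
- by apply: measurableU; [apply: measurableU|]; exact: measurable_set1.
- apply: countable_lebesgue_measure0; apply: finite_set_countable.
  by rewrite !finite_setU; split; [split|]; exact: finite_set1.
- move=> x /= /not_and3P[] /contrapT ->; [by left; left|by left; right|by right].
Qed.

(** Lebesgue differentiation of the vanishing primitive. *)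
Lemma zero_below_zero_ae f : intg f -> (forall x, I (fun t => f t * below x t) = 0) ->
  ae_unit (fun x => f x = 0).
Proof.
move=> iF f0; pose f1 := f \_ U01.
have if1 : mu.-integrable setT (EFin \o f1).
  rewrite /f1 -restrict_EFin; apply/(integrable_restrict _ measurable_unit) => //.
  by rewrite setTI.
have if1S (A : set (measurableTypeR R)) : measurable A -> mu.-integrable A (EFin \o f1).
  by move=> mA; apply: integrableS if1.
have E x : \int[mu]_(t in [set` `]-oo, x]]) f1 t = 0.
  by rewrite /f1 -Rintegral_mkcondr -[RHS](f0 x) circle_int_below setIC.
have loc : locally_integrable setT f1 by exact: integrable_locally.
have := FTC1Ny (fun y => if1S `]-oo, y]%classic (measurable_itv _)) loc.
apply: filterS; first exact: (ae_filter_ringOfSetsType mu).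
move=> x [_ +] Ux.
rewrite (_ : (fun x => _) = fun=> 0); last exact/funext.
by rewrite derive1E derive_cst /f1 patchE mem_set.
Qed.

(** By [zero_below_zero_ae] it suffices to integrate f against the indicator of
    each interval [0, b]. On the circle that interval is where
    sin (pi x) sin (pi (b - x)) is positive; this product is a trigonometric
    polynomial t, and the sign of t is the bounded pointwise limit of the
    polynomials [cubic_poly k] in t, all of which f annihilates. *)
Lemma fourier_unique f : intg f -> (forall n, I (fun x => f x * cosn n x) = 0) ->
  (forall n, I (fun x => f x * sinn n x) = 0) -> ae_unit (fun x => f x = 0).
Proof.
move=> iF fc fs; have mf := circle_integrable_measurable iF.
have If : I f = 0.
  by rewrite -(fc 0%N); apply: eq_circle_int => x; rewrite cosn0 mulr1.
apply: zero_below_zero_ae => // b; have [b1|b1] := leP 1 b.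
  rewrite -If; apply: eq_circle_int_unit => x /andP[_ x1].
  by rewrite belowE (le_trans x1 b1) mulr1.
have mfb : measurable_fun U01 (fun x => f x * below b x).
  by apply: measurable_funM => //; exact: (measurable_funU (measurable_below b)).
have [b0|b0] := leP b 0.
  rewrite -[RHS](circle_int_cst 0); apply: circle_int_ae => //.
  apply: ae_imply (ae_neq 0 0 0) => x [x0 _ _].
  rewrite unitP belowE => /andP[xge0 _]; case: ifP; rewrite ?mulr0// => xb.
  by case: x0; apply/eqP; rewrite eq_le xge0 (le_trans xb b0).
(* sin (pi x) * sin (pi (b - x)), as a polynomial in the first harmonics *)
pose t x := - (cos (pi * b) / 2) + (cos (pi * b) / 2) * cosn 1 x + (sin (pi * b) / 2) * sinn 1 x.
have tE x : t x = sin (pi * x) * sin (pi * (b - x)).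
  have e1 : cosn 1 x = 1 - 2 * sin (pi * x) ^+ 2.
    rewrite /cosn mulr1 (_ : 2 * pi * x = pi * x *+ 2); last by rewrite -mulr_natl; ring.
    rewrite cos_mulr2n -mulr_natl; have := cos2Dsin2 (pi * x); lra.
  have e2 : sinn 1 x = 2 * sin (pi * x) * cos (pi * x).
    rewrite /sinn mulr1 (_ : 2 * pi * x = pi * x *+ 2); last by rewrite -mulr_natl; ring.
    by rewrite sin_mulr2n -mulr_natl; ring.
  by rewrite /t mulrBr sinB e1 e2; field.
have ct : continuous t.
  apply: continuousDR; last by apply: continuousZR; exact: continuous_sinn.
  apply: continuousDR; first by move=> x; exact: cvg_cst.
  by apply: continuousZR; exact: continuous_cosn.
have t1 x : `|t x| <= 1.
  have sl (y : R) : `|sin y| <= 1 by rewrite ler_norml sin_geN1 sin_le1.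
  by rewrite tE normrM -[1]mulr1 ler_pM.
have mit k : measurable_fun U01 (fun x => iter k cubic_step (t x)).
  rewrite (_ : (fun x => _) = (fun x => (cubic_poly k).[x]) \o t); last first.
    by apply/funext => x; rewrite /= cubic_polyE.
  apply: continuous_measurableU; apply: continuous_compR => //.
  exact: continuous_horner.
have msg : measurable_fun U01 (fun x => Num.sg (t x)).
  apply/measurable_EFinP.
  apply: (@emeasurable_fun_cvg _ _ _ U01 (fun k x => (iter k cubic_step (t x))%:E)).
    by move=> k; exact/measurable_EFinP.
  by move=> x _; apply: cvg_EFin; [exact: nearW|exact: cubic_iter_cvg].
have Isg : I (fun x => f x * Num.sg (t x)) = 0.
  have z k : I (fun x => f x * iter k cubic_step (t x)) = 0.
    rewrite -[RHS](annihilated_poly iF fc fs (- (cos (pi * b) / 2)) (cos (pi * b) / 2) (sin (pi * b) / 2) (cubic_poly k)).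
    by apply: eq_circle_int => x; rewrite cubic_polyE.
  have H : (fun k => I (fun x => f x * iter k cubic_step (t x))) @ \oo -->
      I (fun x => f x * Num.sg (t x)).
    apply: (circle_int_dominated _ _ (circle_integrable_norm iF)).
    - by move=> k; apply: measurable_funM.
    - exact: measurable_funM.
    - by move=> k x; rewrite normrM ler_piMr// norm_cubic_iter.
    - by move=> x _; apply: cvgM; [exact: cvg_cst|exact: cubic_iter_cvg].
  move: H; rewrite (_ : (fun k => _) = fun=> 0); last exact/funext.
  by move/cvg_lim => <- //; rewrite lim_cst.
have isg : intg (fun x => f x * Num.sg (t x)).
  by apply: (circle_integrableM iF msg (B := 1)) => x _; rewrite normr_sg; case: (_ != _).
have : I (fun x => 2^-1 * f x + 2^-1 * (f x * Num.sg (t x))) = 0.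
  by rewrite circle_intD ?circle_intZ// ?If ?Isg ?mulr0 ?addr0//; exact: circle_integrableZ.
move=> <-; apply: circle_int_ae => //.
  by apply: measurable_funD; [exact: measurable_funM|apply: measurable_funM => //; exact: measurable_funM].
apply: ae_imply (ae_neq 0 b 1) => x [x0 xb x1].
rewrite unitP => /andP[xge0 xle1].
have {}x0 : 0 < x by rewrite lt_neqAle xge0 andbT; apply/eqP => e; apply: x0.
have {}x1 : x < 1 by rewrite lt_neqAle xle1 andbT; apply/eqP.
have pi0 : (0 : R) < pi := pi_gt0 R.
have spos (y : R) : 0 < y < 1 -> 0 < sin (pi * y).
  move=> /andP[y0 y1]; apply: sin_gt0_pi; apply/andP; split; first exact: mulr_gt0.
  by rewrite -[ltRHS]mulr1 ltr_pM2l.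
rewrite tE sgrM (gtr0_sg (spos x _)) ?x0 ?x1// mul1r belowE.
case: ltgtP => h; last by case: xb.
  rewrite gtr0_sg; first by field.
  by apply: spos; apply/andP; split; lra.
rewrite (_ : b - x = - (x - b)); last ring.
rewrite mulrN sinN sgrN gtr0_sg; first by field.
by apply: spos; apply/andP; split; lra.
Qed.
End SignApproximation.

(** * Null sets *)

Section NullSets.
Context {R : realType}.
Notation mu := (@lebesgue_measure R).
Local Notation l := (@wlength R idfun).

(** A Lipschitz map sends null sets to null sets, because it maps an interval of
    length r into one of length 2 M r; [sigma] is a right inverse of it. *)
Lemma ae_comp_lipschitz (tau sigma : R -> R) (M : R) (P : R -> Prop) : 0 <= M ->
  (forall x y, `|tau x - tau y| <= M * `|x - y|) -> (forall x, tau (sigma x) = x) ->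
  {ae mu, forall y, P y} -> {ae mu, forall x, P (sigma x)}.
Proof.
move=> M0 lip can; rewrite /prop_near1 /almost_everywhere => /negligible_outer_measure N0.
apply/negligible_outer_measure; apply/eqP; rewrite eq_le outer_measure_ge0 andbT.
apply/lee_addgt0Pr => e e0; rewrite add0e.
pose d := e / (2 * M + 1).
have d0 : 0 < d by rewrite divr_gt0//; lra.
have [F [Fitv AF] Fe] : exists2 I_, open_itv_cover (~` [set y | P y]) I_ &
    (\sum_(0 <= k <oo) l (I_ k) <= d%:E)%E.
  move: N0; rewrite outer_measure_open_itv_cover => N0.
  have : ereal_inf [set \sum_(0 <= k <oo) l (F k) | F in open_itv_cover (~` [set y | P y])]%E \is a fin_num.
    by rewrite N0.
  move=> /lb_ereal_inf_adherent-/(_ _ d0)[_/= [F]] AF <-.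
  by rewrite N0 add0e => Fe; exists F => //; exact/ltW.
pose G k := let ab := sval (cid (Fitv k)) in
  `[tau ab.1 - M * (ab.2 - ab.1), tau ab.1 + M * (ab.2 - ab.1)]%classic : set R.
have sub : ~` [set x | P (sigma x)] `<=` \bigcup_k G k.
  move=> x /= Nx; have [k _ Fk] := AF _ Nx; exists k => //; rewrite /G /=.
  move: Fk; case: cid => -[a b] /= ->; rewrite /= !in_itv/= => /andP[h1 h2].
  rewrite -ler_distl -[in leLHS](can x); apply: le_trans (lip _ _) _.
  by rewrite ler_wpM2l// ger0_norm; lra.
apply: le_trans; first by apply: le_outer_measure; exact: sub.
apply: le_trans; first exact: outer_measure_sigma_subadditive.
apply: (@le_trans _ _ (\sum_(0 <= k <oo) ((2 * M)%:E * l (F k)))%E); last first.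
  rewrite nneseriesZl; last by move=> k _; exact: wlength_ge0.
  apply: (@le_trans _ _ ((2 * M)%:E * d%:E)%E).
    by apply: lee_wpmul2l => //; rewrite lee_fin mulr_ge0.
  rewrite -EFinM lee_fin /d mulrA ler_pdivrMr; last lra.
  by rewrite [leRHS]mulrC ler_pM2r//; lra.
apply: lee_nneseries => k _; first by move=> _; exact: outer_measure_ge0.
rewrite /G; case: cid => -[a b] /= ->.
have -> : (l^* `[tau a - M * (b - a), tau a + M * (b - a)]%classic =
    mu `[tau a - M * (b - a), tau a + M * (b - a)]%classic)%mu by [].
rewrite lebesgue_measure_itv/= wlength_itv/= !lte_fin.
have [ab|ba] := ltP a b.
  by case: ifP => _; rewrite -!EFinB -EFinM lee_fin; have := mulr_ge0 M0 (ltW (_ : 0 < b - a)); lra.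
have : M * (b - a) <= 0 by rewrite mulr_ge0_le0//; lra.
by rewrite mule0; case: ifP => // _; rewrite -EFinB lee_fin; lra.
Qed.

Lemma ae_countable_all (I : countType) (P : I -> R -> Prop) :
  (forall i, {ae mu, forall x, P i x}) -> {ae mu, forall x, forall i, P i x}.
Proof.
move=> H; rewrite /prop_near1 /almost_everywhere.
have : mu.-negligible (\bigcup_(n : nat) if unpickle n is Some i then ~` [set x | P i x] else set0).
  apply: negligible_bigcup => n; case: unpickle => [i|]; first exact: H.
  exact: negligible_set0.
apply: negligibleS => x /= /existsNP[i nP]; exists (pickle i) => //.
by rewrite pickleK.
Qed.

(** Countably many translates of the unit interval cover the line, and
    translations preserve null sets. *)
Lemma ae_periodic (P : R -> Prop) : (forall x, P (x + 1) = P x) ->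
  ae_unit P -> {ae mu, forall x, P x}.
Proof.
move=> pP HP.
have H (n : int) : {ae mu, forall x, 0 <= x + n%:~R <= 1 -> P (x + n%:~R)}.
  apply: (@ae_comp_lipschitz (fun x => x - n%:~R) (fun x => x + n%:~R) 1
      (fun x => 0 <= x <= 1 -> P x)) => //.
  - by move=> x y; rewrite mul1r (_ : x - _ - _ = x - y)//; ring.
  - by move=> x; rewrite addrK.
have := ae_countable_all H; apply: ae_imply => x /(_ (- Num.floor x)).
rewrite (periodic_int pP); apply; rewrite intrN.
by have := frac_unit x; lra.
Qed.

End NullSets.

(** * Weak derivatives of real functions *)

Section WeakDerivative.
Context {R : realType}.
Implicit Types f g h v w psi : R -> R.
Notation mu := (@lebesgue_measure R).
Notation intg := circle_integrable.
Notation I := circle_int.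
Local Notation U01 := (`[0%R, 1%R]%classic : set (measurableTypeR R)).

Definition circleL1 f := [/\ periodic f 1, measurable_fun setT f & intg f].

(** The real counterpart of [weak_derivative], to which real and imaginary parts
    reduce it. *)
Definition real_weak_derivative f g := [/\ circleL1 f, circleL1 g &
  forall psi, test_function psi ->
    I (fun x => f x * derive1 psi x) = - I (fun x => g x * psi x)].

Lemma circleL1_continuous f : continuous f -> periodic f 1 -> circleL1 f.
Proof.
by move=> cf pf; split => //; [exact: continuous_measurable|exact: continuous_integrable].
Qed.

Lemma circleL1M f h : circleL1 f -> continuous h -> periodic h 1 ->
  circleL1 (fun x => f x * h x).
Proof.
move=> [pf mf iF] ch ph; have [B hB] := periodic_bounded ch ph; split.
- by move=> x; rewrite pf ph.
- by apply: measurable_funM => //; exact: continuous_measurable.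
- exact: circle_integrableM iF (continuous_measurableU ch) (fun x _ => hB x).
Qed.

Lemma circleL1B f g : circleL1 f -> circleL1 g -> circleL1 (fun x => f x - g x).
Proof.
move=> [pf mf iF] [pg mg ig]; split.
- by move=> x; rewrite pf pg.
- exact: measurable_funB.
- exact: circle_integrableB.
Qed.

Lemma ae_to_unit (P : R -> Prop) : {ae mu, forall x, P x} -> ae_unit P.
Proof. by apply: ae_imply => x. Qed.

Lemma circleL1_ae f g : periodic g 1 -> measurable_fun setT g ->
  {ae mu, forall x, f x = g x} -> circleL1 f -> circleL1 g.
Proof.
move=> pg mg fg [pf mf iF]; split => //.
by apply: circle_integrable_ae iF; [exact: measurable_funU|exact: ae_to_unit].
Qed.

Lemma circle_intM_ae f g h : measurable_fun setT f -> measurable_fun setT g ->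
  measurable_fun setT h -> {ae mu, forall x, f x = g x} ->
  I (fun x => f x * h x) = I (fun x => g x * h x).
Proof.
move=> mf mg mh fg; apply: circle_int_ae.
- by apply: measurable_funU; exact: measurable_funM.
- by apply: measurable_funU; exact: measurable_funM.
- by apply/ae_to_unit; apply: ae_imply fg => x ->.
Qed.

Lemma circleL1_unique f : circleL1 f ->
  (forall n, I (fun x => f x * cosn n x) = 0) ->
  (forall n, I (fun x => f x * sinn n x) = 0) -> {ae mu, forall x, f x = 0}.
Proof.
move=> [pf mf iF] fc fs; apply: ae_periodic; last exact: fourier_unique.
by move=> x; rewrite pf.
Qed.

Lemma test_function_circleC1 psi : test_function psi -> circleC1 psi (derive1 psi).
Proof.
move=> [ppsi dpsi]; split => //.
  by move=> x; apply: DeriveDef; [exact: (dpsi 0%N x) | rewrite derive1E].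
by move=> x; apply/differentiable_continuous/derivable1_diffP; exact: (dpsi 1%N x).
Qed.

Definition mode (n : nat) (a b x : R) := a * cosn n x + b * sinn n x.

Definition freq (n : nat) : R := 2 * pi * n%:R.

Lemma circleC1_mode n a b : circleC1 (mode n a b) (mode n (freq n * b) (- (freq n * a))).
Proof.
split.
- apply: eq_has_deriv (has_derivD (has_derivZ a (has_deriv_cosn n))
    (has_derivZ b (has_deriv_sinn n))) => x.
  by rewrite /mode /freq; ring.
- by apply: continuousDR; apply: continuousZR; [exact: continuous_cosn|exact: continuous_sinn].
- by move=> x; rewrite /mode periodic_cosn periodic_sinn.
Qed.

Lemma mode_deriv n a b : derive1 (mode n a b) = mode n (freq n * b) (- (freq n * a)).
Proof. by have [D _ _] := circleC1_mode n a b; exact: has_deriv_derive. Qed.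

Lemma mode_test n a b : test_function (mode n a b).
Proof.
split; first by case: (circleC1_mode n a b).
move=> k; have [a' [b' ->]] : exists a' b', derive1n k (mode n a b) = mode n a' b'.
  elim: k => [|k [a' [b' IH]]]; first by exists a, b.
  by exists (freq n * b'), (- (freq n * a')); rewrite derive1nS IH mode_deriv.
by move=> x; have [D _ _] := circleC1_mode n a' b'; case: (D x).
Qed.

Lemma mode_cos n x : mode n 1 0 x = cosn n x.
Proof. by rewrite /mode mul1r mul0r addr0. Qed.

Lemma mode_sin n x : mode n 0 1 x = sinn n x.
Proof. by rewrite /mode mul1r mul0r add0r. Qed.

Lemma circleL1_mode0 f : circleL1 f ->
  (forall n a b, I (fun x => f x * mode n a b x) = 0) -> {ae mu, forall x, f x = 0}.
Proof.
move=> Lf H; apply: circleL1_unique => // n.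
  by rewrite -(H n 1 0); apply: eq_circle_int => x; rewrite mode_cos.
by rewrite -(H n 0 1); apply: eq_circle_int => x; rewrite mode_sin.
Qed.

Lemma circleL1_intM f psi psi' : circleL1 f -> circleC1 psi psi' ->
  intg (fun x => f x * psi x).
Proof.
move=> Lf cpsi; have [_ _ ppsi] := cpsi.
by have [] := circleL1M Lf (circleC1_continuous cpsi) ppsi.
Qed.

Lemma circleL1_intM' f psi psi' : circleL1 f -> circleC1 psi psi' ->
  intg (fun x => f x * psi' x).
Proof.
move=> Lf cpsi; have [_ c _] := cpsi.
by have [] := circleL1M Lf c (circleC1_periodic cpsi).
Qed.

Lemma real_weak_derivative_unique f f' g g' : real_weak_derivative f g ->
  real_weak_derivative f' g' -> {ae mu, forall x, f x = f' x} ->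
  {ae mu, forall x, g x = g' x}.
Proof.
move=> [Lf Lg fg] [Lf' Lg' fg'] ff'.
suff : {ae mu, forall x, g x - g' x = 0}.
  by apply: ae_imply => x /eqP; rewrite subr_eq0 => /eqP.
apply: circleL1_mode0; first exact: circleL1B.
move=> n a b; have cm := circleC1_mode n a b.
rewrite (_ : I _ = I (fun x => g x * mode n a b x) - I (fun x => g' x * mode n a b x)); last first.
  rewrite -circle_intB; [|exact: circleL1_intM Lg cm|exact: circleL1_intM Lg' cm].
  by apply: eq_circle_int => x; rewrite mulrBl.
have tm := mode_test n a b; have e := fg _ tm; have e' := fg' _ tm.
apply/eqP; rewrite subr_eq0 -eqr_opp -e -e'; apply/eqP.
have [_ mf _] := Lf; have [_ mf' _] := Lf'.
apply: circle_intM_ae => //; apply: continuous_measurable.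
by have [_ c _] := test_function_circleC1 tm.
Qed.

Lemma real_weak_derivative_classical f a a' : periodic f 1 -> measurable_fun setT f ->
  circleC1 a a' -> {ae mu, forall x, f x = a x} -> real_weak_derivative f a'.
Proof.
move=> pf mf ca fa; have [D c p] := ca; have cona := circleC1_continuous ca.
split.
- apply: (circleL1_ae pf mf _ (circleL1_continuous cona p)).
  by apply: ae_imply fa => x ->.
- exact: circleL1_continuous c (circleC1_periodic ca).
- move=> psi /test_function_circleC1 cpsi; rewrite -(circle_int_by_parts ca cpsi).
  have [_ c' _] := cpsi.
  by apply: circle_intM_ae => //; exact: continuous_measurable.
Qed.

(** Every mode but the constant one is the derivative of a test function, so all
    Fourier coefficients of h - I h vanish. *)
Lemma zero_derivative_cst h : circleL1 h ->
  (forall psi, test_function psi -> I (fun x => h x * derive1 psi x) = 0) ->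
  {ae mu, forall x, h x = I h}.
Proof.
move=> Lh H; have [_ _ ih] := Lh; have ik := circle_integrable_cst (I h).
have Lk : circleL1 (fun=> I h) by apply: circleL1_continuous => // x; exact: cvg_cst.
suff : {ae mu, forall x, h x - I h = 0}.
  by apply: ae_imply => x /eqP; rewrite subr_eq0 => /eqP.
apply: circleL1_mode0; first exact: circleL1B.
move=> n a b; have cm := circleC1_mode n a b; case: n cm => [|n] cm.
  rewrite (_ : I _ = I (fun x => a * (h x - I h))); last first.
    by apply: eq_circle_int => x; rewrite /mode cosn0 sinn0 mulr1 mulr0 addr0 mulrC.
  rewrite circle_intZ; last exact: circle_integrableB ih ik.
  by rewrite (circle_intB ih ik) circle_int_cst subrr mulr0.
have f0 : freq n.+1 != 0.
  by rewrite /freq !mulf_neq0// ?pnatr_eq0// gt_eqF// pi_gt0.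
pose a' := - b / freq n.+1; pose b' := a / freq n.+1.
have cm' := circleC1_mode n.+1 a' b'; have [_ c _] := cm'.
rewrite (_ : I _ = I (fun x => h x * mode n.+1 (freq n.+1 * b') (- (freq n.+1 * a')) x) -
   I h * I (mode n.+1 (freq n.+1 * b') (- (freq n.+1 * a')))); last first.
  rewrite -circle_intZ; last exact: continuous_integrable.
  rewrite -circle_intB; first last.
  - exact/circle_integrableZ/continuous_integrable.
  - exact: circleL1_intM' Lh cm'.
  apply: eq_circle_int => x; rewrite -mulrBl; congr (_ * _).
  by rewrite /a' /b' /mode; congr (_ * _ + _ * _); field.
by rewrite (circle_int_deriv cm') mulr0 subr0 -mode_deriv (H _ (mode_test _ _ _)).
Qed.

(** Weakly differentiable functions are absolutely continuous: v differs from the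
    primitive of w by a function whose weak derivative is zero. *)
Lemma real_weak_derivative_primitive v w : real_weak_derivative v w ->
  exists F : R -> R, [/\ continuous F, periodic F 1, {ae mu, forall x, v x = F x} &
    forall psi psi', circleC1 psi psi' ->
      I (fun x => F x * psi' x) = - I (fun x => w x * psi x)].
Proof.
move=> [Lv Lw vw]; have [_ _ iw] := Lw.
have w0 : I w = 0.
  have := vw _ (mode_test 0 1 0); rewrite mode_deriv.
  rewrite (_ : I _ = 0); last first.
    rewrite -[RHS](circle_int_cst 0); apply: eq_circle_int => x.
    by rewrite /mode /freq; ring.
  move/eqP; rewrite eq_sym oppr_eq0 => /eqP e; rewrite -[RHS]e.
  by apply: eq_circle_int => x; rewrite mode_cos cosn0 mulr1.
have [F [cF pF FP]] := primitive_by_parts iw w0.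
have LF := circleL1_continuous cF pF.
have Lh := circleL1B Lv LF.
pose k := I (fun x => v x - F x).
have hk : {ae mu, forall x, v x - F x = k}.
  apply: zero_derivative_cst => // psi tpsi; have cpsi := test_function_circleC1 tpsi.
  rewrite (_ : I _ = I (fun x => v x * derive1 psi x) - I (fun x => F x * derive1 psi x)).
    by rewrite (vw _ tpsi) (FP _ _ cpsi) subrr.
  rewrite -circle_intB; first last.
  - exact: circleL1_intM' LF cpsi.
  - exact: circleL1_intM' Lv cpsi.
  by apply: eq_circle_int => x; rewrite mulrBl.
exists (fun x => F x + k); split.
- by apply: continuousDR => // x; exact: cvg_cst.
- by move=> x; rewrite pF.
- by apply: ae_imply hk => x /eqP; rewrite subr_eq addrC => /eqP.
- move=> psi psi' cpsi; rewrite -(FP _ _ cpsi).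
  rewrite -[RHS]addr0 -(mulr0 k) -(circle_int_deriv cpsi).
  have [_ c _] := cpsi.
  rewrite -circle_intZ; last exact: continuous_integrable.
  rewrite -circle_intD; first last.
  - exact/circle_integrableZ/continuous_integrable.
  - exact: circleL1_intM' LF cpsi.
  by apply: eq_circle_int => x; rewrite mulrDl.
Qed.

(** A ball has positive measure. *)
Lemma continuous_ae_eq f g : continuous f -> continuous g ->
  {ae mu, forall x, f x = g x} -> forall x, f x = g x.
Proof.
move=> cf cg fg x; apply/eqP; rewrite -subr_eq0; apply/negPn/negP => h0.
have ch : continuous (fun x => `|f x - g x|).
  by move=> y; apply: cvg_norm; apply: continuousBR.
have : \forall y \near x, 0 < `|f y - g y|.
  by apply: (cvgr_gt _ (ch x)); rewrite normr_gt0.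
move=> /nbhs_ballP[e /= e0 he].
have nb : mu.-negligible (ball x e).
  move: fg; apply: negligibleS => y /he; rewrite /= normr_gt0 subr_eq0 => /eqP.
  exact.
have : mu (ball x e) = 0 by apply/negligibleP => //; exact: measurable_ball.
rewrite lebesgue_measure_ball ?ltW// => /eqP; rewrite eqe; apply/negP.
by rewrite mulrn_eq0/= gt_eqF.
Qed.

End WeakDerivative.

(** * Complex functions and their real parts *)

Section ComplexFunctions.
Context {R : realType}.
Local Open Scope complex_scope.
Implicit Types f g : R -> R[i].
Notation mu := (@lebesgue_measure R).
Notation intg := circle_integrable.
Notation I := circle_int.
Notation Re := complex.Re.
Notation Im := complex.Im.
Local Notation U01 := (`[0%R, 1%R]%classic : set (measurableTypeR R)).

Definition re f x : R := Re (f x).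
Definition im f x : R := Im (f x).

Lemma complexP (z w : R[i]) : Re z = Re w -> Im z = Im w -> z = w.
Proof. by case: z w => [a b] [c d] /= -> ->. Qed.

Lemma normcE (z : R[i]) : Normc.normc z = Num.sqrt (Re z ^+ 2 + Im z ^+ 2).
Proof. by case: z. Qed.

Lemma normc_sqr (z : R[i]) : Normc.normc z ^+ 2 = Re z ^+ 2 + Im z ^+ 2.
Proof. by rewrite normcE sqr_sqrtr// addr_ge0// sqr_ge0. Qed.

Lemma normc_nonneg (z : R[i]) : 0 <= Normc.normc z.
Proof. by rewrite normcE sqrtr_ge0. Qed.

Lemma normc_re (z : R[i]) : `|Re z| <= Normc.normc z.
Proof. by rewrite normcE -sqrtr_sqr ler_wsqrtr// lerDl sqr_ge0. Qed.

Lemma normc_im (z : R[i]) : `|Im z| <= Normc.normc z.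
Proof. by rewrite normcE -sqrtr_sqr ler_wsqrtr// lerDr sqr_ge0. Qed.

Lemma normc_le (z : R[i]) : Normc.normc z <= `|Re z| + `|Im z|.
Proof.
rewrite normcE -[leRHS]ger0_norm ?addr_ge0// -sqrtr_sqr ler_wsqrtr// sqrrD.
by rewrite !real_normK ?num_real// addrAC lerDl mulrn_wge0// mulr_ge0.
Qed.

Lemma measurable_normc f : measurable_fun setT (re f) -> measurable_fun setT (im f) ->
  measurable_fun setT (fun x => Normc.normc (f x)).
Proof.
move=> mr mi; rewrite (_ : (fun x => _) = Num.sqrt \o (fun x => re f x ^+ 2 + im f x ^+ 2)).
  apply: (measurableT_comp (continuous_measurable (@sqrt_continuous R))).
  by apply: measurable_funD; exact: measurable_funX.
by apply/funext => x; rewrite normcE.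
Qed.

Lemma Lp1_parts f : Lp_circle 1 f <-> circleL1 (re f) /\ circleL1 (im f).
Proof.
split=> [[pf mr mi H]|[[pr mr ir] [pi mi ii]]].
  have {}H : intg (fun x => Normc.normc (f x)) by [].
  have dom (h : R -> R) : measurable_fun setT h -> (forall x, `|h x| <= Normc.normc (f x)) -> intg h.
    move=> mh hf; apply: (le_integrable measurable_unit _ _ H).
      by apply/measurable_EFinP; exact: measurable_funU.
    by move=> x _ /=; rewrite lee_fin [leRHS]ger0_norm ?normc_nonneg.
  split; split => //.
  - by move=> x; rewrite /re pf.
  - by apply: dom => // x; exact: normc_re.
  - by move=> x; rewrite /im pf.
  - by apply: dom => // x; exact: normc_im.
split => //.
  by move=> x; apply: complexP; [exact: pr|exact: pi].
have ii' : intg (fun x => `|re f x| + `|im f x|).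
  by apply: circle_integrableD; exact: circle_integrable_norm.
apply: (le_integrable measurable_unit _ _ ii').
  by apply/measurable_EFinP; apply: measurable_funU; exact: measurable_normc.
move=> x _ /=; rewrite lee_fin ger0_norm ?expr1 ?normc_nonneg//.
by rewrite (le_trans (normc_le _))// ler_norm.
Qed.

Lemma Lp_bounded p f (B : R) : periodic f 1 -> measurable_fun setT (re f) ->
  measurable_fun setT (im f) -> (forall x, Normc.normc (f x) <= B) -> Lp_circle p f.
Proof.
move=> pf mr mi fB; split => //; apply: (circle_integrable_bounded (B := B ^+ p)).
  by apply: measurable_funU; apply: measurable_funX; exact: measurable_normc.
by move=> x _; rewrite ger0_norm ?exprn_ge0 ?normc_nonneg// lerXn2r// ?nnegrE ?normc_nonneg// (le_trans _ (fB x))// normc_nonneg.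
Qed.

Lemma Lp2_sqr f : Lp_circle 2 f ->
  intg (fun x => re f x ^+ 2) /\ intg (fun x => im f x ^+ 2).
Proof.
move=> [pf mr mi H]; have {}H : intg (fun x => Normc.normc (f x) ^+ 2) by [].
have dom (h : R -> R) : measurable_fun setT h -> (forall x, `|h x| <= Normc.normc (f x) ^+ 2) -> intg h.
  move=> mh hf; apply: (le_integrable measurable_unit _ _ H).
    by apply/measurable_EFinP; exact: measurable_funU.
  by move=> x _ /=; rewrite lee_fin [leRHS]ger0_norm ?exprn_ge0 ?normc_nonneg.
split; apply: dom; [exact: measurable_funX| |exact: measurable_funX|] => x;
  rewrite ger0_norm ?sqr_ge0// normc_sqr /re /im ?lerDl ?lerDr sqr_ge0//.
Qed.

Lemma weak_derivative_parts f g : weak_derivative f g <->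
  real_weak_derivative (re f) (re g) /\ real_weak_derivative (im f) (im g).
Proof.
have E h psi : circle_cint (fun x => h x * (psi x)%:C) =
    I (fun x => re h x * psi x) +i* I (fun x => im h x * psi x).
  rewrite /circle_cint; congr (_ +i* _); apply: eq_circle_int => x;
    by rewrite /re /im; case: (h x) => a b /=; ring.
split=> [[/Lp1_parts[Lr Li] /Lp1_parts[Lr' Li'] H]|[[Lr Lr' Hr] [Li Li' Hi]]].
  by split; split => // psi tpsi; move: (H psi tpsi); rewrite !E => -[].
split; [exact/Lp1_parts|exact/Lp1_parts|] => psi tpsi.
by rewrite !E Hr// Hi//.
Qed.

Lemma ae_parts f g : {ae mu, forall x, re f x = re g x} ->
  {ae mu, forall x, im f x = im g x} -> ae_equal f g.
Proof. by apply: ae_imply2 => x; exact: complexP. Qed.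

Lemma ae_re f g : ae_equal f g -> {ae mu, forall x, re f x = re g x}.
Proof. by apply: ae_imply => x; rewrite /re => ->. Qed.

Lemma ae_im f g : ae_equal f g -> {ae mu, forall x, im f x = im g x}.
Proof. by apply: ae_imply => x; rewrite /im => ->. Qed.

Lemma weak_derivative_unique f f' g g' : weak_derivative f g ->
  weak_derivative f' g' -> ae_equal f f' -> ae_equal g g'.
Proof.
move=> /weak_derivative_parts[r i] /weak_derivative_parts[r' i'] ff'.
apply: ae_parts.
  exact: real_weak_derivative_unique r r' (ae_re ff').
exact: real_weak_derivative_unique i i' (ae_im ff').
Qed.

Lemma wderivP f g : weak_derivative f g ->
  weak_derivative f (wderiv f) /\ ae_equal (wderiv f) g.
Proof.
move=> fg; have H : weak_derivative f (wderiv f).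
  exact: (@xgetPex _ (fun=> 0) [set g | weak_derivative f g] (ex_intro _ g fg)).
by split => //; apply: weak_derivative_unique H fg _; exact: ae_all.
Qed.

Definition measurable_periodic f :=
  [/\ periodic f 1, measurable_fun setT (re f) & measurable_fun setT (im f)].

Lemma weak_derivative_classical f a a' b b' : measurable_periodic f ->
  circleC1 a a' -> circleC1 b b' -> ae_equal f (fun x => a x +i* b x) ->
  weak_derivative f (fun x => a' x +i* b' x).
Proof.
move=> [pf mr mi] ca cb fab; apply/weak_derivative_parts; split.
  apply: (real_weak_derivative_classical _ _ ca) => //.
    by move=> x; rewrite /re pf.
  exact: (ae_re fab).
apply: (real_weak_derivative_classical _ _ cb) => //.
  by move=> x; rewrite /im pf.
exact: (ae_im fab).
Qed.

Lemma weak_derivative_Lp1 f g : weak_derivative f g -> Lp_circle 1 f /\ Lp_circle 1 g.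
Proof. by case. Qed.

Lemma Sobolev11 f g : weak_derivative f g -> Sobolev 1 1 f.
Proof. by move=> fg; have [? ?] := weak_derivative_Lp1 fg; split => //; exists g. Qed.

Lemma measurable_periodic_Lp p f : Lp_circle p f -> measurable_periodic f.
Proof. by case. Qed.

End ComplexFunctions.

(** * The transfer operator through inverse branches *)

(** All that is used of the circle map. sigma is the inverse of the lift tau, of
    degree eps * D with eps = 1 or -1, and p = 1 / tau', with derivatives p1 and
    p2; every preimage of x on the circle is the class of some sigma (x + j). *)
Record expanding_lift {R : realType} (tau tau1 sigma p p1 p2 : R -> R) (D : nat)
    (eps alpha : R) : Prop := ExpandingLift {
  lift_D : (0 < D)%N;
  lift_alpha : 0 < alpha < 1;
  lift_eps : eps * eps = 1;
  lift_tauK : forall x, tau (sigma x) = x;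
  lift_sigmaK : forall x, sigma (tau x) = x;
  lift_tau_deriv : has_deriv tau tau1;
  lift_tau1_cont : continuous tau1;
  lift_tau1_p : forall x, tau1 x * p x = 1;
  lift_tau_shift : forall x, tau (x + 1) = tau x + eps * D%:R;
  lift_sigma_deriv : has_deriv sigma (fun x => p (sigma x));
  lift_sigma_shift : forall x, sigma (x + D%:R) = sigma x + eps;
  lift_p : circleC1 p p1;
  lift_p1 : circleC1 p1 p2;
  lift_p_bound : forall x, 0 < eps * p x <= alpha }.

Section RealTransfer.
Context {R : realType} {tau tau1 sigma p p1 p2 : R -> R} {D : nat} {eps alpha : R}.
Context (E : expanding_lift tau tau1 sigma p p1 p2 D eps alpha).
Implicit Types f g h psi : R -> R.
Notation I := circle_int.

(** The transfer operator on real functions, through the D inverse branches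
    x |-> sigma (x + j); the weight eps * p is the absolute value of 1 / tau'. *)
Definition real_transfer f x :=
  \sum_(j < D) eps * (p (sigma (x + j%:R)) * f (sigma (x + j%:R))).
Notation L := real_transfer.

Lemma eq_real_transfer f g x : (forall y, f y = g y) -> L f x = L g x.
Proof. by move=> fg; rewrite (_ : f = g)//; exact/funext. Qed.

Lemma real_transferD f g x : L (fun y => f y + g y) x = L f x + L g x.
Proof. by rewrite /L -big_split/=; apply: eq_bigr => j _; ring. Qed.

Lemma real_transferZ k f x : L (fun y => k * f y) x = k * L f x.
Proof. by rewrite /L big_distrr/=; apply: eq_bigr => j _; ring. Qed.

Lemma real_transferN f x : L (fun y => - f y) x = - L f x.
Proof. by rewrite -mulN1r -real_transferZ; apply: eq_real_transfer => y; rewrite mulN1r. Qed.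

Lemma real_transferB f g x : L (fun y => f y - g y) x = L f x - L g x.
Proof. by rewrite real_transferD real_transferN. Qed.

Let ep_ge0 y : 0 <= eps * p y.
Proof. by case/andP: (lift_p_bound E y) => /ltW. Qed.

Lemma le_real_transfer f g x : (forall y, f y <= g y) -> L f x <= L g x.
Proof. by move=> fg; apply: ler_sum => j _; rewrite !mulrA ler_wpM2l. Qed.

Lemma norm_real_transfer f x : `|L f x| <= L (fun y => `|f y|) x.
Proof.
rewrite ler_norml -real_transferN; apply/andP; split; apply: le_real_transfer => y.
  by rewrite lerNl; have := ler_norm (- f y); rewrite normrN.
exact: ler_norm.
Qed.

Lemma real_transfer_bound f (B : R) x : (forall y, `|f y| <= B) -> `|L f x| <= D%:R * B.
Proof.
move=> fB; have /andP[a0 a1] := lift_alpha E.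
apply: le_trans (ler_norm_sum _ _ _) _.
apply: (@le_trans _ _ (\sum_(j < D) B)); last by rewrite sumr_const card_ord mulr_natl.
apply: ler_sum => j _; rewrite mulrA normrM ger0_norm//.
have B0 : 0 <= B := le_trans (normr_ge0 _) (fB 0).
rewrite -[leRHS]mul1r ler_pM//.
by case/andP: (lift_p_bound E (sigma (x + j%:R))) => _ /le_trans; apply; exact: ltW.
Qed.

Lemma branch_deriv j : has_deriv (fun x => sigma (x + j)) (fun x => p (sigma (x + j))).
Proof. exact: has_deriv_shift (lift_sigma_deriv E). Qed.

Lemma real_transfer_continuous f : continuous f -> continuous (L f).
Proof.
move=> cf; apply: (continuous_sumR
  (F := fun j x => eps * (p (sigma (x + j%:R)) * f (sigma (x + j%:R))))) => j.
apply: continuousZR.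
have cj : continuous (fun x : R => sigma (x + j%:R) : R) := has_deriv_continuous (branch_deriv j%:R).
apply: continuousMR; last exact: continuous_compR.
by apply: (continuous_compR _ cj); exact: circleC1_continuous (lift_p E).
Qed.

(** A shift by 1 permutes the D branches cyclically. *)
Lemma sum_shift_periodic (h : R -> R) x : (forall x, h (x + D%:R) = h x) ->
  \sum_(j < D) h (x + 1 + j%:R) = \sum_(j < D) h (x + j%:R).
Proof.
move=> ph; have e1 : \sum_(j < D.+1) h (x + j%:R) = h x + \sum_(j < D) h (x + 1 + j%:R).
  rewrite big_ord_recl/= addr0; congr (_ + _); apply: eq_bigr => j _.
  by rewrite /bump/= natrD addrA.
have : \sum_(j < D.+1) h (x + j%:R) = \sum_(j < D) h (x + j%:R) + h x.
  by rewrite big_ord_recr/= ph.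
by rewrite e1 addrC => /addIr.
Qed.

Lemma eps_cases : eps = 1 \/ eps = - 1.
Proof.
have /eqP : (eps - 1) * (eps + 1) = 0 by rewrite -subr_sqr expr2 (lift_eps E) expr1n subrr.
by rewrite mulf_eq0 subr_eq0 addr_eq0 => /orP[/eqP|/eqP]; [left|right].
Qed.

Lemma eps_int f : periodic f 1 -> forall x, f (x + eps) = f x.
Proof.
move=> pf x; have [->|->] := eps_cases; first exact: pf.
by rewrite -{2}[x](subrK 1) pf.
Qed.

Lemma real_transfer_periodic f : periodic f 1 -> periodic (L f) 1.
Proof.
move=> pf x.
apply: (@sum_shift_periodic (fun x => eps * (p (sigma x) * f (sigma x)))) => {}x.
have [_ _ pp] := lift_p E.
by rewrite (lift_sigma_shift E) !eps_int.
Qed.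

Lemma real_transfer_C1 f f' : circleC1 f f' ->
  circleC1 (L f) (L (fun y => p y * f' y + p1 y * f y)).
Proof.
move=> cf; have cp := lift_p E; have cpf := circleC1M cp cf; split.
- apply: (@has_deriv_sum _ D
    (fun j x => eps * (p (sigma (x + j%:R)) * f (sigma (x + j%:R))))
    (fun j x => eps * (p (sigma (x + j%:R)) * (p (sigma (x + j%:R)) *
      f' (sigma (x + j%:R)) + p1 (sigma (x + j%:R)) * f (sigma (x + j%:R)))))) => j.
  apply: has_derivZ.
  have [Dpf _ _] := cpf.
  apply: eq_has_deriv (has_deriv_comp Dpf (branch_deriv j%:R)) => x; ring.
- apply: real_transfer_continuous; have [_ cp1 _] := cp; have [_ cf' _] := cf.
  by apply: continuousDR; apply: continuousMR => //; [exact: circleC1_continuous cp|exact: circleC1_continuous cf].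
- by apply: real_transfer_periodic; case: cf.
Qed.

Lemma tau_continuous : continuous tau.
Proof. exact: has_deriv_continuous (lift_tau_deriv E). Qed.

Lemma comp_tau_periodic psi : periodic psi 1 -> periodic (fun x => psi (tau x)) 1.
Proof.
move=> pp x; rewrite (lift_tau_shift E).
elim: D (tau x) => [|n IH] y; first by rewrite mulr0 addr0.
by rewrite -natr1 mulrDr mulr1 addrA eps_int// IH.
Qed.

(** Change of variables: the antiderivative of f * (psi o tau), read along the
    branches, is an antiderivative of L f * psi. *)
Lemma real_transfer_dual f psi : continuous f -> periodic f 1 ->
  continuous psi -> periodic psi 1 ->
  I (fun x => L f x * psi x) = I (fun x => f x * psi (tau x)).
Proof.
move=> cf pf cpsi ppsi.
have cfpsi : continuous (fun x : R => f x * psi (tau x)).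
  by apply: continuousMR => //; apply: continuous_compR => //; exact: tau_continuous.
have pfpsi : periodic (fun x : R => f x * psi (tau x)) 1.
  by move=> x; rewrite pf (comp_tau_periodic ppsi).
have [G DG] := antiderivative cfpsi.
pose H x := \sum_(j < D) eps * G (sigma (x + j%:R)).
have DH : has_deriv H (fun x => L f x * psi x).
  apply: (@eq_has_deriv _ _ (fun x => \sum_(j < D) eps * (f (sigma (x + j%:R)) *
      psi (tau (sigma (x + j%:R))) * p (sigma (x + j%:R))))); last first.
    apply: (@has_deriv_sum _ D (fun j x => eps * G (sigma (x + j%:R)))
      (fun j x => eps * (f (sigma (x + j%:R)) *
        psi (tau (sigma (x + j%:R))) * p (sigma (x + j%:R))))) => j.
    apply: has_derivZ; exact: has_deriv_comp DG (branch_deriv j%:R).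
  move=> x; rewrite /L big_distrl/=; apply: eq_bigr => j _.
  rewrite (lift_tauK E) (_ : psi (x + j%:R) = psi x); first by ring.
  exact: (periodic_int ppsi j).
rewrite (FTC_unit DH); last by apply: continuousMR => //; exact: real_transfer_continuous.
rewrite (FTC_unit DG cfpsi).
have -> : H 1 - H 0 = eps * G (sigma 0 + eps) - eps * G (sigma 0).
  pose u (n : nat) := eps * G (sigma n%:R).
  have e1 : H 1 = \sum_(j < D) u j.+1.
    by apply: eq_bigr => j _; rewrite /u -natr1 addrC.
  have e0 : H 0 = \sum_(j < D) u j by apply: eq_bigr => j _; rewrite /u add0r.
  have := lift_sigma_shift E 0; rewrite add0r => <-.
  rewrite e1 e0 -sumrB -(big_mkord xpredT (fun j => u j.+1 - u j)).
  by rewrite telescope_sumr.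
(* the increment of G over a period does not depend on the base point *)
have per x : G (x + 1) - G x = G 1 - G 0.
  have D1 : has_deriv (fun x => G (x + 1)) (fun x => f x * psi (tau x)).
    by apply: eq_has_deriv (has_deriv_shift 1 DG) => y; rewrite pfpsi.
  by have := eq_deriv_cst D1 DG x 0; rewrite add0r; lra.
have [->|->] := eps_cases.
  by rewrite !mul1r per.
by have := per (sigma 0 - 1); rewrite subrK; lra.
Qed.

End RealTransfer.

(** * Bounded densities and the resolvent of the derivative operator *)

Section GeometricSeries.
Context {R : realType}.
Implicit Types f g h : R -> R.

Lemma geometric_tail_cvg (C theta : R) : 0 <= theta < 1 ->
  (fun N => C / (1 - theta) * theta ^+ N) @ \oo --> (0 : R).
Proof.
move=> /andP[t0 t1]; rewrite -(mulr0 (C / (1 - theta))); apply: cvgM; first exact: cvg_cst.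
by apply: cvg_expr; rewrite ger0_norm.
Qed.

Lemma geometric_series (t : nat -> R -> R) (C theta : R) : 0 <= theta < 1 ->
  (forall n x, `|t n x| <= C * theta ^+ n) ->
  exists h : R -> R, forall N x,
    `|(\sum_(i < N) t i x) - h x| <= C / (1 - theta) * theta ^+ N.
Proof.
move=> th tC; have := geometric_tail_cvg C th; case/andP: (th) => t0 t1 r0.
have H x : exists s, forall N, `|(\sum_(i < N) t i x) - s| <= C / (1 - theta) * theta ^+ N.
  apply: (telescope_series (t := t^~ x)) => // n; apply: le_trans (tC n x) _.
  rewrite exprS; have d0 : 1 - theta != 0 by rewrite subr_eq0 gt_eqF.
  by rewrite le_eqVlt; apply/orP; left; apply/eqP; field.
by exists (fun x => projT1 (cid (H x))) => N x; case: cid => s /= ->.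
Qed.
End GeometricSeries.

Section Regularity.
Context {R : realType} {tau tau1 sigma p p1 p2 : R -> R} {D : nat} {eps alpha : R}.
Context (E : expanding_lift tau tau1 sigma p p1 p2 D eps alpha).
Implicit Types f g h psi : R -> R.
Notation I := circle_int.
Notation intg := circle_integrable.
Notation mu := (@lebesgue_measure R).
Local Notation L := (@real_transfer R sigma p D eps).

Lemma norm_p_le y : `|p y| <= alpha.
Proof.
have := lift_p_bound E y.
have [->|->] := eps_cases E; rewrite ?mul1r ?mulN1r => /andP[h1 h2].
  by rewrite ger0_norm// ltW.
by rewrite -normrN ger0_norm// ltW.
Qed.
Let p_le := norm_p_le.

Let a0 : 0 < alpha. Proof. by case/andP: (lift_alpha E). Qed.
Let a1 : alpha < 1. Proof. by case/andP: (lift_alpha E). Qed.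

Let p1_bound : exists P : R, 0 <= P /\ forall y, `|p1 y| <= P.
Proof.
have [_ c pp] := lift_p1 E; have cp1 := circleC1_continuous (lift_p1 E).
have [P HP] := periodic_bounded cp1 pp; exists P; split => //.
exact: le_trans (normr_ge0 _) (HP 0).
Qed.

Definition density n : R -> R := iter n L (fun=> 1).

(** The iterated densities stay in the cone of positive functions whose
    logarithmic derivative is at most Q, and have mass one. *)
Lemma density_bound : exists B : R, 0 < B /\
  forall n x, 0 <= density n x <= B.
Proof.
have [P [P0 HP]] := p1_bound.
(* One application of L turns the bound Q into alpha * Q + P, which this Q fixes. *)
pose Q := P / (1 - alpha).
have d0 : 0 < 1 - alpha by rewrite subr_gt0.
have Q0 : 0 <= Q by rewrite divr_ge0// ltW.
have QE : alpha * Q + P = Q by rewrite /Q; field; rewrite gt_eqF.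
have cone n : exists F', [/\ circleC1 (density n) F', forall x, 0 <= density n x,
    I (density n) = 1 & forall x, `|F' x| <= Q * density n x].
  elim: n => [|n [F' [cF F0 F1 FQ]]].
    exists (fun=> 0); split => //=; first exact: circleC1_cst.
      exact: circle_int_cst.
    by move=> x; rewrite normr0 mulr1.
  have [_ _ pF] := cF; have conF := circleC1_continuous cF.
  exists (L (fun y => p y * F' y + p1 y * density n y)); split.
  - exact: (real_transfer_C1 E).
  - move=> x; apply: sumr_ge0 => j _; rewrite mulrA mulr_ge0//.
    by case/andP: (lift_p_bound E (sigma (x + j%:R))) => /ltW.
  - rewrite -F1 -[RHS](eq_circle_int (f := fun x => density n x * 1)); last first.
      by move=> x; rewrite mulr1.
    rewrite -(real_transfer_dual E conF pF (psi := fun=> 1))//; last first.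
      by move=> x; exact: cvg_cst.
    by apply: eq_circle_int => x; rewrite mulr1.
  - move=> x; apply: le_trans (norm_real_transfer E _ _) _.
    rewrite -[density n.+1]/(L (density n)) -real_transferZ; apply: (le_real_transfer E) => y.
    apply: le_trans (ler_normD _ _) _; rewrite !normrM -[in leRHS]QE mulrDl -mulrA.
    by apply: lerD; [rewrite ler_pM|rewrite (ger0_norm (F0 y)) ler_wpM2r].
exists (1 + Q); split; first by rewrite ltr_wpDr.
move=> n x; have [F' [[DF cF' pF] F0 F1 FQ]] := cone n; rewrite F0/=.
have cF := has_deriv_continuous DF.
have [c c01 cmin] := EVT_min ler01 (continuous_subspaceT cF).
move: c01; rewrite in_itv/= => /andP[c0 c1].
have Fc : density n c <= 1.
  rewrite -F1 -[leLHS]circle_int_cst; apply: le_circle_int.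
  - exact: circle_integrable_cst.
  - exact: continuous_integrable.
  - by move=> y; rewrite unitP => y01; apply: cmin; rewrite in_itv.
have := frac_unit x; rewrite (periodic_frac pF); set y := x - _ => /andP[y0 /ltW y1].
suff : `|density n y - density n c| <= Q.
  by have := ler_norm (density n y - density n c); lra.
have B01 z : 0 <= z -> z <= 1 -> I (fun t => F' t * below z t) = density n z - density n 0.
  by move=> z0 z1; rewrite (circle_int_below_deriv z DF cF') (max_idPr z0) (min_idPr z1).
have -> : density n y - density n c = (density n y - density n 0) - (density n c - density n 0) by ring.
rewrite -!B01//; have iF := continuous_integrable cF'.
rewrite -circle_intB; [|exact: circle_integrable_below..].
rewrite (_ : I _ = I (fun t => F' t * (below y t - below c t))); last first.
  by apply: eq_circle_int => t; rewrite mulrBr.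
apply: le_trans (norm_circle_intM iF _ (B := 1) _) _.
- apply: measurable_funU; apply: measurable_funB; exact: measurable_below.
- by move=> t _; rewrite !belowE; case: ifP; case: ifP => _ _; rewrite ?subrr ?subr0 ?sub0r ?normrN ?normr1 ?normr0.
rewrite mul1r -[Q]mulr1 -F1 -circle_intZ; last exact: continuous_integrable.
apply: le_circle_int => //; first exact: circle_integrable_norm.
exact/circle_integrableZ/continuous_integrable.
Qed.

Context (lambda : R) (alpha_lambda : alpha < lambda).
Let l0 : 0 < lambda := lt_trans a0 alpha_lambda.
Let theta := alpha / lambda.
Let theta01 : 0 <= theta < 1.
Proof. by rewrite divr_ge0 ?(ltW a0) ?(ltW l0)//= ltr_pdivrMr// mul1r. Qed.

(** The operator that governs the derivative of an eigenfunction. It loses a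
    factor alpha with respect to the transfer operator, which is why its
    resolvent series converges at 1 in the uniform norm. *)
Definition deriv_transfer f x := lambda^-1 * L (fun y => p y * f y) x.
Notation K := deriv_transfer.

Lemma deriv_transfer_majorant f C n :
  (forall y, `|f y| <= C * density n y) ->
  forall x, `|K f x| <= theta * C * density n.+1 x.
Proof.
move=> fC x; rewrite /K normrM ger0_norm ?invr_ge0 ?(ltW l0)//.
rewrite /theta -!mulrA mulrCA ler_wpM2l ?invr_ge0 ?(ltW l0)//.
apply: le_trans (norm_real_transfer E _ _) _.
rewrite mulrA -[density n.+1]/(L (density n)) -real_transferZ.
apply: (le_real_transfer E) => y; rewrite normrM -mulrA ler_pM//.
Qed.

Lemma deriv_transfer_iter g C : (forall y, `|g y| <= C) ->
  forall n x, `|iter n K g x| <= C * theta ^+ n * density n x.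
Proof.
move=> gC; elim=> [|n IH] x; first by rewrite /= !mulr1.
by rewrite iterS exprS mulrCA; exact: deriv_transfer_majorant.
Qed.

Lemma continuous_deriv_transfer f : continuous f -> continuous (K f).
Proof.
move=> cf; apply: continuousZR; apply: real_transfer_continuous E _ _.
by apply: continuousMR => //; exact: circleC1_continuous (lift_p E).
Qed.

Lemma periodic_deriv_transfer f : periodic f 1 -> periodic (K f) 1.
Proof.
move=> pf x; congr (_ * _); apply: (real_transfer_periodic E) => y.
by have [_ _ pp] := lift_p E; rewrite pp pf.
Qed.

Lemma deriv_transfer_C1 f f' : circleC1 f f' ->
  circleC1 (K f) (fun x => lambda^-1 * L (fun y => p y * (p1 y * f y + p y * f' y) + p1 y * (p y * f y)) x).
Proof.
by move=> cf; have H := real_transfer_C1 E (circleC1M (lift_p E) cf); exact: circleC1Z H.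
Qed.

(** The resolvent series of [K] solves h = K h + g, and gains one derivative
    whenever g has one. *)
Lemma deriv_transfer_resolvent g : continuous g -> periodic g 1 ->
  exists h : R -> R, [/\ continuous h, periodic h 1, forall x, h x = K h x + g x &
    (forall g', circleC1 g g' -> exists h', circleC1 h h')].
Proof.
move=> cg pg; have [C gC] := periodic_bounded cg pg.
have C0 : 0 <= C := le_trans (normr_ge0 _) (gC 0).
have [B [B0 HB]] := density_bound; have [P [P0 HP]] := p1_bound.
have /andP[t0 t1] := theta01.
have tn0 n : 0 <= theta ^+ n by rewrite exprn_ge0.
pose t n := iter n K g.
have ct n : continuous (t n) by elim: n => [//|n IH]; exact: continuous_deriv_transfer.
have pt n : periodic (t n) 1 by elim: n => [//|n IH]; exact: periodic_deriv_transfer.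
have tB n x : `|t n x| <= C * B * theta ^+ n.
  apply: le_trans (deriv_transfer_iter gC n x) _.
  have /andP[_ h] := HB n x; rewrite -!mulrA ler_wpM2l// mulrC ler_wpM2r//.
have [h hS] := geometric_series theta01 tB.
have r0 := geometric_tail_cvg (C * B) theta01.
pose S N x := \sum_(i < N) t i x.
have cS N : continuous (S N) by apply: continuous_sumR.
have ch : continuous h := uniform_limit_continuousR cS hS r0.
have Sh x : S ^~ x @ \oo --> h x by apply: cvg_by_bound r0 => N; exact: hS.
have pS N : periodic (S N) 1 by move=> x; apply: eq_bigr => i _; exact: pt.
have ph : periodic h 1.
  move=> x; have := Sh (x + 1); rewrite (_ : S ^~ _ = S ^~ x); last first.
    by apply/funext => N; exact: pS.
  by move=> /cvg_lim <- //; apply/cvg_lim => //; exact: Sh.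
exists h; split => //.
- move=> x; pose rho N := C * B / (1 - theta) * theta ^+ N.
  have SS N : S N.+1 x = K (S N) x + g x.
    rewrite /S big_ord_recl/= addrC; congr (_ + _).
    elim: N => [|N IH].
      rewrite big_ord0 /K (_ : L _ x = 0) ?mulr0//; apply: big1 => j _.
      by rewrite big_ord0 !mulr0.
    rewrite big_ord_recr/= IH /K -mulrDr -real_transferD; congr (_ * _).
    by apply: eq_real_transfer => y; rewrite big_ord_recr/= mulrDr.
  have H1 : (fun N => S N.+1 x) @ \oo --> h x by have := Sh x; rewrite -cvg_shiftS.
  suff H2 : (fun N => S N.+1 x) @ \oo --> K h x + g x.
    by move/cvg_lim : H1 => <- //; move/cvg_lim : H2 => ->.
  rewrite (_ : (fun N => _) = fun N => K (S N) x + g x); last exact/funext.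
  apply: cvgD; last exact: cvg_cst.
  apply: (cvg_by_bound (r := fun N => lambda^-1 * D%:R * rho N)) => [N|]; last first.
    by rewrite -(mulr0 (lambda^-1 * D%:R)); apply: cvgM => //; exact: cvg_cst.
  rewrite /K -mulrBr -real_transferB normrM ger0_norm ?invr_ge0 ?(ltW l0)//.
  rewrite -mulrA ler_wpM2l ?invr_ge0 ?(ltW l0)//.
  apply: (real_transfer_bound E) => y; rewrite -mulrBr normrM -[leRHS]mul1r ler_pM//.
    exact: le_trans (norm_p_le y) (ltW a1).
  exact: hS.
- move=> g' cg'; have [_ cong' _] := cg'.
  have [C1 g'C] := periodic_bounded cong' (circleC1_periodic cg').
  have C10 : 0 <= C1 := le_trans (normr_ge0 _) (g'C 0).
  have d0 : 0 < 1 - alpha by rewrite subr_gt0.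
  (* C' bounds g' and absorbs the source 2 P C that each step adds: alpha C' + 2 P C <= C'. *)
  pose C' := C1 + 2 * P * C / (1 - alpha).
  have C'0 : 0 <= C' by rewrite addr_ge0// divr_ge0 ?mulr_ge0// ltW.
  have C'E : alpha * C' + 2 * P * C <= C'.
    rewrite -subr_ge0 (_ : _ - _ = (1 - alpha) * C1); last by rewrite /C'; field; rewrite gt_eqF.
    by rewrite mulr_ge0// ltW.
  have Ht n : exists t', circleC1 (t n) t' /\ forall x, `|t' x| <= C' * theta ^+ n * density n x.
    elim: n => [|n [t' [ct' Ht']]].
      exists g'; split => // x; rewrite /= !mulr1; apply: le_trans (g'C x) _.
      by rewrite lerDl divr_ge0 ?mulr_ge0// ltW.
    eexists; split; first exact: deriv_transfer_C1 ct'.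
    move=> x; rewrite normrM ger0_norm ?invr_ge0 ?(ltW l0)//.
    apply: (@le_trans _ _ (lambda^-1 * (alpha * C' * theta ^+ n * density n.+1 x))); last first.
      rewrite exprS /theta le_eqVlt; apply/orP; left; apply/eqP.
      by field; rewrite gt_eqF.
    rewrite ler_wpM2l ?invr_ge0 ?(ltW l0)//; apply: le_trans (norm_real_transfer E _ _) _.
    rewrite -[density n.+1]/(L (density n)) -real_transferZ.
    apply: (le_real_transfer E) => y; have /andP[F0 _] := HB n y.
    have -> : p y * (p1 y * t n y + p y * t' y) + p1 y * (p y * t n y) =
        p y * (p y * t' y + 2 * p1 y * t n y) by ring.
    rewrite normrM -!mulrA ler_pM//; apply: le_trans (ler_normD _ _) _.
    apply: (@le_trans _ _ (alpha * (C' * theta ^+ n * density n y) +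
        2 * P * (C * theta ^+ n * density n y))).
      apply: lerD; first by rewrite normrM ler_pM.
      rewrite -!(mulrA 2) normrM (ger0_norm (ler0n _ 2)) ler_wpM2l// normrM ler_pM//.
      exact: deriv_transfer_iter.
    rewrite (_ : _ + _ = (alpha * C' + 2 * P * C) * (theta ^+ n * density n y)); last by ring.
    by rewrite ler_wpM2r// mulr_ge0.
  pose t' n := projT1 (cid (Ht n)).
  have ct' n : circleC1 (t n) (t' n) by rewrite /t'; case: cid => ? [].
  have t'B n x : `|t' n x| <= C' * B * theta ^+ n.
    rewrite /t'; case: cid => u [_ Hu] /=; apply: le_trans (Hu x) _.
    by have /andP[_ b] := HB n x; rewrite -!mulrA ler_wpM2l// mulrC ler_wpM2r.
  have [h' h'S] := geometric_series theta01 t'B.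
  have r0' := geometric_tail_cvg (C' * B) theta01.
  have cS' N : circleC1 (S N) (fun x => \sum_(i < N) t' i x) by exact: circleC1_sum.
  exists h'; split => //.
    apply: has_deriv_limit h'S r0' => //; [move=> N; first by case: (cS' N)..].
  by apply: uniform_limit_continuousR h'S r0' => N; case: (cS' N).
Qed.

End Regularity.

(** * Regularity of eigenfunctions *)

Section EigenRegularity.
Context {R : realType} {tau tau1 sigma p p1 p2 : R -> R} {D : nat} {eps alpha : R}.
Context (E : expanding_lift tau tau1 sigma p p1 p2 D eps alpha).
Context (lambda : R) (alpha_lambda : alpha < lambda).
Implicit Types f g h psi v w : R -> R.
Notation I := circle_int.
Notation intg := circle_integrable.
Notation mu := (@lebesgue_measure R).
Local Notation L := (@real_transfer R sigma p D eps).
Local Notation K := (@deriv_transfer R sigma p D eps lambda).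

Let a0 : 0 < alpha. Proof. by case/andP: (lift_alpha E). Qed.
Let a1 : alpha < 1. Proof. by case/andP: (lift_alpha E). Qed.
Let l0 : 0 < lambda := lt_trans a0 alpha_lambda.

(** The factor p = 1 / tau' cancels the tau' of the chain rule, so psi' is not
    amplified. *)
Lemma pulled_back_C1 psi psi' : circleC1 psi psi' ->
  circleC1 (fun x => p x * psi (tau x)) (fun x => p1 x * psi (tau x) + psi' (tau x)).
Proof.
move=> [Dpsi cpsi' ppsi]; have ct := tau_continuous E.
have C : circleC1 (fun x => psi (tau x)) (fun x => psi' (tau x) * tau1 x).
  split; first exact: has_deriv_comp Dpsi (lift_tau_deriv E).
    apply: continuousMR; last exact: lift_tau1_cont E.
    exact: continuous_compR.
  exact: (comp_tau_periodic E).
apply: eq_circleC1 (circleC1M (lift_p E) C) => x.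
by rewrite [p x * _]mulrC -mulrA (lift_tau1_p E) mulr1.
Qed.

(** A function that reproduces itself under the dual of a contraction vanishes:
    iterating the identity pulls back the test function and gains alpha / lambda. *)
Lemma dual_contraction_zero r : circleL1 r ->
  (forall psi psi', circleC1 psi psi' ->
     lambda * I (fun x => r x * psi x) = I (fun x => r x * (p x * psi (tau x)))) ->
  {ae mu, forall x, r x = 0}.
Proof.
move=> Lr H; pose N := I (fun x => `|r x|); pose theta := alpha / lambda.
have [_ _ ir] := Lr.
have N0 : 0 <= N by apply: circle_int_ge0 => x; exact: normr_ge0.
have iter_bound n : forall psi psi' (B : R), circleC1 psi psi' -> (forall x, `|psi x| <= B) ->
    `|I (fun x => r x * psi x)| <= theta ^+ n * B * N.
  elim: n => [|n IH] psi psi' B cpsi psiB.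
    rewrite expr0 mul1r; apply: norm_circle_intM => //.
    exact: continuous_measurableU (circleC1_continuous cpsi).
  have := IH _ _ (alpha * B) (pulled_back_C1 cpsi); rewrite -(H _ _ cpsi) normrM (gtr0_norm l0).
  move=> h; rewrite -(ler_pM2l l0); apply: le_trans (h _) _.
    by move=> x; rewrite normrM ler_pM// (norm_p_le E).
  by rewrite le_eqVlt; apply/orP; left; apply/eqP; rewrite exprS /theta; field; rewrite gt_eqF.
have theta01 : 0 <= theta < 1.
  by rewrite divr_ge0 ?(ltW a0) ?(ltW l0)//= ltr_pdivrMr// mul1r.
apply: circleL1_mode0 => // n a b; have cm := circleC1_mode n a b.
have [_ _ pm] := cm; have [B HB] := periodic_bounded (circleC1_continuous cm) pm.
apply: (eq_cvg0 (u := fun k => theta ^+ k * (B * N))) => [k|].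
  by rewrite subr0 mulrA; exact: iter_bound cm HB.
rewrite -(mul0r (B * N)); apply: cvgM; last exact: cvg_cst.
by apply: cvg_expr; case/andP: theta01 => t0 t1; rewrite ger0_norm.
Qed.

(** The derivative of the eigenvalue equation, in weak form: test functions are
    moved across L, pulled back by tau, and then across the derivative. *)
Lemma derivative_equation v w : continuous v -> periodic v 1 -> circleL1 w ->
  (forall psi psi', circleC1 psi psi' ->
     I (fun x => v x * psi' x) = - I (fun x => w x * psi x)) ->
  (forall x, L v x = lambda * v x) ->
  forall psi psi', circleC1 psi psi' -> lambda * I (fun x => w x * psi x) =
    I (fun x => w x * (p x * psi (tau x))) + I (fun x => L (fun y => p1 y * v y) x * psi x).
Proof.
move=> cv pv Lw vw ev psi psi' cpsi; have [_ cpsi' ppsi] := cpsi.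
have conpsi := circleC1_continuous cpsi.
have Lv := circleL1_continuous cv pv.
have cPsi := pulled_back_C1 cpsi.
have [_ _ pp1] := lift_p1 E; have cp1 := circleC1_continuous (lift_p1 E).
have e1 : lambda * I (fun x => v x * psi' x) = I (fun x => v x * psi' (tau x)).
  rewrite -(real_transfer_dual E cv pv cpsi' (circleC1_periodic cpsi)).
  rewrite -circle_intZ; last exact: circleL1_intM' Lv cpsi.
  by apply: eq_circle_int => x; rewrite ev mulrA.
have cp1v : continuous (fun y => p1 y * v y) by exact: continuousMR.
have pp1v : periodic (fun y : R => p1 y * v y) 1 by move=> y; rewrite pp1 pv.
rewrite (real_transfer_dual E cp1v pp1v conpsi ppsi).
have := vw _ _ cPsi.
have e2 : I (fun x => v x * (p1 x * psi (tau x) + psi' (tau x))) =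
    I (fun x => p1 x * v x * psi (tau x)) + I (fun x => v x * psi' (tau x)).
  rewrite -circle_intD.
  - by apply: eq_circle_int => x; ring.
  - apply: continuous_integrable; apply: continuousMR => //.
    by apply: continuous_compR => //; exact: tau_continuous E.
  - apply: continuous_integrable; apply: continuousMR => //.
    by apply: continuous_compR => //; exact: tau_continuous E.
rewrite e2 -e1 (vw _ _ cpsi); lra.
Qed.

(** The resolvent series provides a continuous solution h of the equation of
    [derivative_equation]. Uniqueness identifies it with w, so v is C1; the source
    term is then C1 as well, hence so is h. *)
Lemma eigenfunction_C2 v w : continuous v -> periodic v 1 -> circleL1 w ->
  (forall psi psi', circleC1 psi psi' ->
     I (fun x => v x * psi' x) = - I (fun x => w x * psi x)) ->
  (forall x, L v x = lambda * v x) ->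
  exists v1 v2 : R -> R, circleC1 v v1 /\ circleC1 v1 v2.
Proof.
move=> cv pv Lw vw ev; have deq := derivative_equation cv pv Lw vw ev.
have [_ _ pp1] := lift_p1 E; have cp1 := circleC1_continuous (lift_p1 E).
have cp := circleC1_continuous (lift_p E); have [_ _ pp] := lift_p E.
pose g x := lambda^-1 * L (fun y => p1 y * v y) x.
have cg : continuous g.
  by apply: continuousZR; apply: (real_transfer_continuous E); exact: continuousMR.
have pg : periodic g 1.
  by move=> x; congr (_ * _); apply: (real_transfer_periodic E) => y; rewrite pp1 pv.
have [h [ch ph hE hC1]] := deriv_transfer_resolvent E alpha_lambda cg pg.
have Lh := circleL1_continuous ch ph.
have ln0 : lambda != 0 by rewrite gt_eqF.
have heq psi psi' : circleC1 psi psi' -> lambda * I (fun x => h x * psi x) =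
    I (fun x => h x * (p x * psi (tau x))) + I (fun x => L (fun y => p1 y * v y) x * psi x).
  move=> cpsi; have [_ _ ppsi] := cpsi; have conpsi := circleC1_continuous cpsi.
  have cph : continuous (fun y => p y * h y) by exact: continuousMR.
  have pph : periodic (fun y : R => p y * h y) 1 by move=> y; rewrite pp ph.
  rewrite (_ : I (fun x => h x * (p x * psi (tau x))) = I (fun x => L (fun y => p y * h y) x * psi x)); last first.
    rewrite (real_transfer_dual E cph pph conpsi ppsi).
    by apply: eq_circle_int => x; ring.
  rewrite -circle_intZ; last exact: circleL1_intM Lh cpsi.
  rewrite -circle_intD; first last.
  - apply: continuous_integrable; apply: continuousMR => //.
    by apply: (real_transfer_continuous E); exact: continuousMR.
  - apply: continuous_integrable; apply: continuousMR => //.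
    exact: (real_transfer_continuous E).
  by apply: eq_circle_int => x; rewrite {1}hE /g /deriv_transfer; field.
have wh : {ae mu, forall x, w x = h x}.
  suff : {ae mu, forall x, w x - h x = 0}.
    by apply: ae_imply => x /eqP; rewrite subr_eq0 => /eqP.
  apply: dual_contraction_zero; first exact: circleL1B.
  move=> psi psi' cpsi; have cPsi := pulled_back_C1 cpsi.
  rewrite (_ : I (fun x => (w x - h x) * psi x) =
      I (fun x => w x * psi x) - I (fun x => h x * psi x)); last first.
    rewrite -circle_intB; [|exact: circleL1_intM Lw cpsi|exact: circleL1_intM Lh cpsi].
    by apply: eq_circle_int => x; rewrite mulrBl.
  rewrite (_ : I (fun x => (w x - h x) * (p x * psi (tau x))) =
      I (fun x => w x * (p x * psi (tau x))) - I (fun x => h x * (p x * psi (tau x)))); last first.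
    rewrite -circle_intB; [|exact: circleL1_intM Lw cPsi|exact: circleL1_intM Lh cPsi].
    by apply: eq_circle_int => x; rewrite mulrBl.
  by rewrite mulrBr (deq _ _ cpsi) (heq _ _ cpsi); ring.
have vh psi psi' : circleC1 psi psi' -> I (fun x => v x * psi' x) = - I (fun x => h x * psi x).
  move=> cpsi; rewrite (vw _ _ cpsi); congr (- _).
  have [_ mw _] := Lw.
  apply: circle_intM_ae => //; first exact: continuous_measurable.
  exact: continuous_measurable (circleC1_continuous cpsi).
have Ih : I h = 0.
  have := vh _ _ (circleC1_cst 1).
  rewrite (eq_circle_int (g := fun=> 0)) ?circle_int_cst; last by move=> x; rewrite mulr0.
  rewrite (eq_circle_int (f := fun x => h x * 1) (g := h)); last by move=> x; rewrite mulr1.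
  by move=> /eqP; rewrite eq_sym oppr_eq0 => /eqP.
have [V DV] := antiderivative ch.
have V1 : V 1 - V 0 = 0 by rewrite -(FTC_unit DV ch).
have pV : periodic V 1.
  move=> x.
  have D1 : has_deriv (fun x => V (x + 1)) h.
    by apply: eq_has_deriv (has_deriv_shift 1 DV) => y; rewrite ph.
  by have := eq_deriv_cst D1 DV x 0; rewrite add0r; lra.
have cV : circleC1 V h by [].
have LV := circleL1_continuous (has_deriv_continuous DV) pV.
have Lv := circleL1_continuous cv pv.
pose k := I (fun x => v x - V x).
have vV x : v x = V x + k.
  apply/eqP; rewrite addrC -subr_eq; apply/eqP; move: x.
  apply: continuous_ae_eq.
  - by apply: continuousBR => //; exact: has_deriv_continuous DV.
  - by move=> x; exact: cvg_cst.
  apply: zero_derivative_cst; first exact: circleL1B.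
  move=> psi tpsi; have cpsi := test_function_circleC1 tpsi.
  rewrite (_ : I _ = I (fun x => v x * derive1 psi x) - I (fun x => V x * derive1 psi x)).
    by rewrite (vh _ _ cpsi) (circle_int_by_parts cV cpsi) subrr.
  rewrite -circle_intB; first last.
  - exact: circleL1_intM' LV cpsi.
  - exact: circleL1_intM' Lv cpsi.
  by apply: eq_circle_int => x; rewrite mulrBl.
have cvh : circleC1 v h.
  rewrite (_ : v = fun x => V x + k); last exact/funext.
  by apply: eq_circleC1 (circleC1D cV (circleC1_cst k)) => x; rewrite addr0.
have [h' ch'] := hC1 _ (circleC1Z lambda^-1 (real_transfer_C1 E (circleC1M (lift_p1 E) cvh))).
by exists h, h'.
Qed.

End EigenRegularity.

(** * Inverse branches of an expanding circle map *)

Section LiftExists.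
Context {R : realType}.
Implicit Types tau f : R -> R.

Lemma has_deriv_inv f f' : has_deriv f f' -> (forall x, f x != 0) ->
  has_deriv (fun x => (f x)^-1) (fun x => - ((f x)^-1 * (f x)^-1 * f' x)).
Proof.
move=> Df f0 x; have := is_deriveV (f0 x) (Df x).
by rewrite /GRing.scale/= mulNr expr2 invfM.
Qed.

Lemma C_class_deriv k f j : C_class k f -> (j < k)%N ->
  has_deriv (derive1n j f) (derive1n j.+1 f).
Proof.
by move=> [d _] jk x; apply: DeriveDef; [exact: d|rewrite derive1nS derive1E].
Qed.

(** Surjectivity comes from the intermediate value theorem on [-a, a] with
    a = |y - T 0|, as T grows at least like the identity. *)
Lemma bijective_of_deriv (T T' : R -> R) : has_deriv T T' -> (forall x, 1 <= T' x) ->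
  (forall x y, x < y -> T x < T y) /\ (forall y, exists x, T x = y).
Proof.
move=> DT T1; have cT := has_deriv_continuous DT.
have grow x y : x <= y -> y - x <= T y - T x.
  move=> xy.
  have [z _ ->] := @MVT_segment R T T' x y xy (fun z _ => DT z) (continuous_subspaceT cT).
  by rewrite ler_peMl// subr_ge0.
split=> [x y xy|y]; first by have := grow x y (ltW xy); lra.
pose a := `|y - T 0|; have a0 : 0 <= a := normr_ge0 _.
have h1 : y - T 0 <= a := ler_norm _.
have h2 : - (y - T 0) <= a by rewrite /a -normrN ler_norm.
have Na0 : - a <= a by lra.
have g1 := grow 0 a a0; have g2 := grow (- a) 0.
have {}g2 : 0 - - a <= T 0 - T (- a) by apply: g2; lra.
have ya : Num.min (T (- a)) (T a) <= y <= Num.max (T (- a)) (T a).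
  rewrite ge_min le_max; apply/andP; split; apply/orP; first by left; lra.
  by right; lra.
have [c _ <-] := IVT Na0 (continuous_subspaceT cT) ya.
by exists c.
Qed.

(** tau' keeps a constant sign eps by the intermediate value theorem, and eps * tau
    is then an increasing bijection of the line. *)
Lemma expanding_lift_of_derivatives tau t1 t2 t3 (d : int) (alpha : R) :
  (forall x, tau (x + 1) = tau x + d%:~R) -> has_deriv tau t1 -> has_deriv t1 t2 ->
  has_deriv t2 t3 -> continuous t3 -> 0 < alpha < 1 ->
  (forall x, alpha^-1 <= `|t1 x|) ->
  exists sigma p p1 p2 D eps, expanding_lift tau t1 sigma p p1 p2 D eps alpha.
Proof.
move=> taud D0 D1 D2 ct3 alpha01 A1; have /andP[a0 a1] := alpha01.
have ct1 := has_deriv_continuous D1; have ct2 := has_deriv_continuous D2.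
have ai1 : 1 < alpha^-1 by rewrite invf_gt1.
have t1n0 x : t1 x != 0 by rewrite -normr_gt0; apply: lt_le_trans (A1 x); lra.
have pt1 : periodic t1 1.
  move=> x; have H := has_deriv_shift 1 D0.
  have H2 : has_deriv (fun x => tau (x + 1)) t1.
    rewrite (_ : (fun x => _) = fun x => tau x + d%:~R); last exact/funext.
    by apply: eq_has_deriv (has_derivD D0 (has_deriv_cst d%:~R)) => y; rewrite addr0.
  exact: (congr1 (@^~ x) (has_deriv_unique H H2)).
have c1t : circleC1 t1 t2 by [].
have c2t : circleC1 t2 t3 by split => //; exact: circleC1_periodic c1t.
pose eps := Num.sg (t1 0).
have eps1 : eps = 1 \/ eps = -1.
  rewrite /eps; have := t1n0 0; rewrite neq_lt => /orP[h|h].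
    by right; rewrite ltr0_sg.
  by left; rewrite gtr0_sg.
have ee : eps * eps = 1 by case: eps1 => ->; rewrite ?mulrNN mulr1.
have pos x : 0 < eps * t1 x.
  rewrite ltNge; apply/negP => le0.
  have pos0 : 0 < eps * t1 0 by rewrite /eps -normrEsg normr_gt0.
  have cet : continuous (fun x => eps * t1 x) by exact: continuousZR.
  have : exists c, eps * t1 c = 0.
    case/orP: (le_total 0 x) => x0.
      have mm : Num.min (eps * t1 0) (eps * t1 x) <= 0 <= Num.max (eps * t1 0) (eps * t1 x).
        by rewrite ge_min le_max le0 orbT (ltW pos0).
      by have [c _ h] := IVT x0 (continuous_subspaceT cet) mm; exists c.
    have mm : Num.min (eps * t1 x) (eps * t1 0) <= 0 <= Num.max (eps * t1 x) (eps * t1 0).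
      by rewrite ge_min le_max le0 (ltW pos0) orbT.
    by have [c _ h] := IVT x0 (continuous_subspaceT cet) mm; exists c.
  move=> [c /eqP]; rewrite mulf_eq0 (negPf (t1n0 c)) orbF => /eqP e0.
  by move: ee; rewrite e0 mulr0 => /esym/eqP; rewrite oner_eq0.
have epsn : `|eps| = 1 by case: eps1 => ->; rewrite ?normrN normr1.
have et1 x : eps * t1 x = `|t1 x| by rewrite -[LHS]gtr0_norm// normrM epsn mul1r.
pose T x := eps * tau x.
have DT : has_deriv T (fun x => eps * t1 x) by exact: has_derivZ.
have T1 x : 1 <= eps * t1 x by rewrite et1; apply: le_trans (A1 x); exact: ltW.
have [Tmono Tsurj] := bijective_of_deriv DT T1.
have Tinj x y : T x = T y -> x = y.
  move=> Txy; case: (ltgtP x y) => // h; have := Tmono _ _ h; rewrite Txy ltxx//.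
have tauinj x y : tau x = tau y -> x = y by move=> h; apply: Tinj; rewrite /T h.
pose sigma x := projT1 (cid (Tsurj (eps * x))).
have tauK x : tau (sigma x) = x.
  rewrite /sigma; case: cid => y /= h.
  by rewrite -[LHS]mul1r -[RHS]mul1r -ee -!mulrA -[eps * tau y]/(T y) h.
have sigK x : sigma (tau x) = x by apply: tauinj; rewrite tauK.
pose p x := (t1 x)^-1.
have cp : circleC1 p (fun x => -1 * (p x * p x * t2 x)).
  have cp0 : continuous p by move=> x; apply: cvgV => //; exact: ct1.
  split; last by move=> x; rewrite /p pt1.
    by apply: eq_has_deriv (has_deriv_inv D1 t1n0) => x; rewrite mulN1r.
  by apply: continuousZR; apply: continuousMR => //; exact: continuousMR.
pose D := `|d|%N.
have ed : eps * D%:R = d%:~R.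
  have Td : 0 < eps * d%:~R.
    have := Tmono 0 1 ltr01; have := taud 0; rewrite add0r /T => ->; rewrite mulrDr; lra.
  rewrite /D natr_absz intr_norm.
  by case: eps1 Td => ->; rewrite ?mul1r ?mulN1r => h; [rewrite gtr0_norm|rewrite ltr0_norm ?opprK//; lra].
have Dgt0 : (0 < D)%N.
  rewrite lt0n; apply/negP => /eqP D00.
  by have := Tmono 0 1 ltr01; have := taud 0; rewrite add0r /T => ->; rewrite -ed D00 mulr0 addr0 ltxx.
exists sigma, p, (fun x => -1 * (p x * p x * t2 x)).
have cpp := circleC1Z (-1) (circleC1M (circleC1M cp cp) c2t).
exists (fun x => -1 * ((-1 * (p x * p x * t2 x) * p x + p x * (-1 * (p x * p x * t2 x))) * t2 x + p x * p x * t3 x)).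
exists D, eps; split => //.
- by move=> x; rewrite /p divff.
- by move=> x; rewrite taud ed.
- move=> x; have near_can : {near sigma x, cancel tau sigma}.
    by near=> y; exact: sigK.
  have near_cont : {near sigma x, continuous tau}.
    by near=> y; exact: (has_deriv_continuous D0).
  have := is_derive_inverse near_can near_cont (D0 (sigma x)) (t1n0 _).
  by rewrite tauK.
- move=> x; apply: tauinj; rewrite tauK.
  case: eps1 ed => -> ed; first by rewrite taud tauK -ed mul1r.
  have := taud (sigma x - 1); rewrite subrK tauK -ed; lra.
- move=> x; rewrite (_ : eps * p x = `|t1 x|^-1); last first.
    rewrite -et1 invfM /p; congr (_ * _).
    by case: eps1 => ->; rewrite ?invrN invr1.
  by rewrite invr_gt0 normr_gt0 t1n0 invf_ple ?posrE ?normr_gt0// A1.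
Unshelve. all: by end_near. Qed.

Lemma expanding_lift_exists tau (alpha : R) : circle_lift tau -> C_class 4 tau ->
  0 < alpha < 1 -> (forall x, alpha^-1 <= `|derive1 tau x|) ->
  exists sigma p p1 p2 D eps, expanding_lift tau (derive1 tau) sigma p p1 p2 D eps alpha.
Proof.
move=> [d taud] Ctau alpha01 A1.
have D3 : has_deriv (derive1n 3 tau) (derive1n 4 tau) := C_class_deriv Ctau (isT : (3 < 4)%N).
apply: (expanding_lift_of_derivatives taud (C_class_deriv Ctau (isT : (0 < 4)%N))
  (C_class_deriv Ctau (isT : (1 < 4)%N)) (C_class_deriv Ctau (isT : (2 < 4)%N))) => //.
exact: has_deriv_continuous D3.
Qed.

End LiftExists.

(** * The complex transfer operator *)

Section ComplexTransfer.
Context {R : realType} {tau sigma p p1 p2 : R -> R} {D : nat} {eps alpha : R}.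
Context (E : expanding_lift tau (derive1 tau) sigma p p1 p2 D eps alpha).
Local Open Scope complex_scope.
Notation mu := (@lebesgue_measure R).
Local Notation L := (@real_transfer R sigma p D eps).

Lemma eps_intE : exists e : int, eps = e%:~R /\ (e * e = 1)%R.
Proof.
by have [->|->] := eps_cases E; [exists 1|exists (-1)]; rewrite ?mulrNN ?mulr1.
Qed.

Lemma lift_tau1_periodic : periodic (derive1 tau) 1.
Proof.
move=> y; have D1 := has_deriv_shift 1 (lift_tau_deriv E).
have D2 : has_deriv (fun x => tau (x + 1)) (derive1 tau).
  rewrite (_ : (fun x => _) = fun x => tau x + eps * D%:R); last first.
    by apply/funext => z; rewrite (lift_tau_shift E).
  by apply: eq_has_deriv (has_derivD (lift_tau_deriv E) (has_deriv_cst (eps * D%:R))) => z; rewrite addr0.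
exact: (congr1 (@^~ y) (has_deriv_unique D1 D2)).
Qed.

Lemma tau_int_shift (n : int) x : tau (x + n%:~R) = tau x + n%:~R * (eps * D%:R).
Proof.
have pn (m : nat) y : tau (y + m%:R) = tau y + m%:R * (eps * D%:R).
  elim: m y => [|m IH] y; first by rewrite addr0 mul0r addr0.
  by rewrite -natr1 addrA (lift_tau_shift E) IH mulrDl mul1r addrA.
case: n => n; first exact: pn.
by rewrite NegzE intrN mulNr -[in RHS](subrK (n.+1%:R) x) pn addrK.
Qed.

(** The fractional parts of the points sigma (x + j), for j < D, enumerate the
    preimages of x on the circle; the residue modulo D of the integer tau y - x
    tells the branch of a preimage y. *)
Lemma transferE (f : R -> R[i]) x : periodic f 1 ->
  transfer tau f x = \sum_(j < D) (eps * p (sigma (x + j%:R)))%:C * f (sigma (x + j%:R)).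
Proof.
move=> pf; rewrite /transfer.
pose fr (y : R) := y - (Num.floor y)%:~R.
pose F (y : R) := f y / (`|derive1 tau y|)%:C.
have [e [eE ee]] := eps_intE.
have D0 := lift_D E.
have bij : set_bij `I_D (circle_preimage tau x) (fun j => fr (sigma (x + j%:R))).
  split.
  - move=> j _; split; first by rewrite /= in_itv/=; exact: frac_unit.
    set s := sigma _; exists (j%:Z - Num.floor s * e * D%:Z).
    rewrite /fr -intrN tau_int_shift /s (lift_tauK E) eE -/s intrB !intrM intrN.
    by rewrite -[j%:Z%:~R]/(j%:R) -[D%:Z%:~R]/(D%:R); ring.
  - move=> j k; rewrite !inE /= => jD kD jk.
    set s := sigma (x + j%:R) in jk; set t := sigma (x + k%:R) in jk.
    have st : s = t + (Num.floor s - Num.floor t)%:~R.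
      by move: jk; rewrite /fr intrB; lra.
    have : tau s = tau t + (Num.floor s - Num.floor t)%:~R * (eps * D%:R).
      by rewrite {1}st tau_int_shift.
    rewrite /s /t !(lift_tauK E) -/s -/t eE; set m := Num.floor s - Num.floor t => h.
    have {}h : (j%:Z = k%:Z + m * e * D%:Z)%R.
      apply: (@intr_inj R); rewrite intrD !intrM -[j%:Z%:~R]/(j%:R) -[k%:Z%:~R]/(k%:R).
      by rewrite -[D%:Z%:~R]/(D%:R); move: h; lra.
    have : ((j%:Z %% D%:Z)%Z = (k%:Z %% D%:Z)%Z)%R by rewrite h addrC modzMDl.
    by rewrite !modz_nat => -[]; rewrite !modn_small.
  - move=> y [/= y01 [m tym]].
    have Dn0 : D%:Z != 0 by rewrite eqz_nat -lt0n.
    have mE := divz_eq m D%:Z; set q := (m %/ D%:Z)%Z in mE.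
    have : (0 <= (m %% D%:Z)%Z)%R by rewrite modz_ge0.
    have : ((m %% D%:Z)%Z < D%:Z)%R by rewrite ltz_pmod.
    case: (m %% D%:Z)%Z mE => // j mE jD _.
    exists j => //=.
    have sE : sigma (x + j%:R) = y + (- (q * e))%:~R.
      rewrite -[RHS](lift_sigmaK E) tau_int_shift tym mE; congr sigma.
      rewrite intrD intrN !intrM -[j%:Z%:~R]/(j%:R) -[D%:Z%:~R]/(D%:R) eE.
      have : e%:~R * e%:~R = 1 :> R by rewrite -intrM ee.
      by move=> h; rewrite mulNr mulrA -(mulrA q%:~R) h mulr1; ring.
    rewrite /fr sE floorDrz ?intr_int// intrKfloor intrD.
    rewrite (_ : Num.floor y = 0); first by ring.
    by apply/floor_def; move: y01; rewrite in_itv/= add0r.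
rewrite (reindex_fsbig _ _ _ _ bij) -fsbig_ord; apply: eq_bigr => j _.
set s := sigma _.
have frE (V : Type) (g : R -> V) : (forall x, g (x + 1) = g x) -> g (fr s) = g s.
  by move=> pg; rewrite /fr -(periodic_frac pg).
have tp := lift_tau1_periodic.
rewrite (frE _ _ pf) (frE _ _ tp) mulrC; congr (_ * _).
have /andP[ep0 _] := lift_p_bound E s.
have n1 : `|derive1 tau s| * (eps * p s) = 1.
  rewrite -(gtr0_norm ep0) -normrM mulrCA (lift_tau1_p E) mulr1.
  by have [->|->] := eps_cases E; rewrite ?normrN normr1.
have tn0 : `|derive1 tau s| != 0.
  by apply/eqP => h; move: n1; rewrite h mul0r => /esym/eqP; rewrite oner_eq0.
rewrite -[eps * p s](mulKf tn0) n1 mulr1.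
by rewrite -(rmorphV _)// unitfE.
Qed.

Lemma re_transfer (f : R -> R[i]) x : periodic f 1 -> re (transfer tau f) x = L (re f) x.
Proof.
move=> pf; rewrite /re (transferE _ pf) /L raddf_sum/=; apply: eq_bigr => j _.
by case: (f _) => a b /=; ring.
Qed.

Lemma im_transfer (f : R -> R[i]) x : periodic f 1 -> im (transfer tau f) x = L (im f) x.
Proof.
move=> pf; rewrite /im (transferE _ pf) /L raddf_sum/=; apply: eq_bigr => j _.
by case: (f _) => a b /=; ring.
Qed.

Lemma measurable_real_transfer (f : R -> R) : measurable_fun setT f -> measurable_fun setT (L f).
Proof.
move=> mf; apply: measurable_sum => j.
apply: measurable_funM; first exact: measurable_cst.
have cj := has_deriv_continuous (branch_deriv E j%:R).
apply: measurable_funM.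
  apply: continuous_measurable; apply: (continuous_compR _ cj).
  exact: circleC1_continuous (lift_p E).
exact: measurableT_comp mf (continuous_measurable cj).
Qed.

(** The inverse branches are nonsingular because tau is Lipschitz. *)
Lemma ae_real_transfer (f g : R -> R) : {ae mu, forall x, f x = g x} ->
  {ae mu, forall x, L f x = L g x}.
Proof.
move=> fg.
have [M HM] := periodic_bounded (lift_tau1_cont E) lift_tau1_periodic.
have M0 : 0 <= M := le_trans (normr_ge0 _) (HM 0).
have lip := deriv_bound_lip (lift_tau_deriv E) HM.
have H (j : nat) : {ae mu, forall x, f (sigma (x + j%:R)) = g (sigma (x + j%:R))}.
  apply: (ae_comp_lipschitz (tau := fun y => tau y - j%:R) (sigma := fun x => sigma (x + j%:R)) M0 _ _ fg).
    by move=> x y; rewrite (_ : _ - _ - _ = tau x - tau y) ?lip//; ring.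
  by move=> x; rewrite (lift_tauK E) addrK.
apply: ae_imply (ae_countable_all H) => x h.
by apply: eq_bigr => j _; rewrite h.
Qed.

Lemma transfer_measurable_periodic f : measurable_periodic f ->
  measurable_periodic (transfer tau f).
Proof.
move=> [pf mr mi].
have pr : periodic (re f) 1 by move=> x; rewrite /re pf.
have pi' : periodic (im f) 1 by move=> x; rewrite /im pf.
have er : re (transfer tau f) = L (re f) by apply/funext => x; exact: re_transfer.
have ei : im (transfer tau f) = L (im f) by apply/funext => x; exact: im_transfer.
split.
- move=> x; apply: complexP.
    by rewrite -!/(re _ _) er (real_transfer_periodic E).
  by rewrite -!/(im _ _) ei (real_transfer_periodic E).
- by rewrite er; exact: measurable_real_transfer.
- by rewrite ei; exact: measurable_real_transfer.
Qed.

Lemma ae_transfer f (a b : R -> R) : measurable_periodic f ->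
  ae_equal f (fun x => a x +i* b x) ->
  ae_equal (transfer tau f) (fun x => L a x +i* L b x).
Proof.
move=> [pf mr mi] fab; apply: ae_parts.
  have := ae_real_transfer (ae_re fab); apply: ae_imply => x.
  by rewrite re_transfer.
have := ae_real_transfer (ae_im fab); apply: ae_imply => x.
by rewrite im_transfer.
Qed.

End ComplexTransfer.

(** * Pairings of complex functions *)

Section Pairings.
Context {R : realType}.
Local Open Scope complex_scope.
Notation mu := (@lebesgue_measure R).
Notation I := circle_int.
Notation intg := circle_integrable.

(** A density that is almost everywhere real turns the sesquilinear pairing into
    two real integrals. *)
Lemma circle_cint_conj (f g : R -> R[i]) (a b : R -> R) : Lp_circle 1 f ->
  {ae mu, forall x, im f x = 0} -> measurable_periodic g ->
  continuous a -> periodic a 1 -> continuous b -> periodic b 1 ->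
  ae_equal g (fun x => a x +i* b x) ->
  circle_cint (fun x => f x * (g x)^*) =
    I (fun x => re f x * a x) -i* I (fun x => re f x * b x).
Proof.
move=> Lf f0 [pg mgr mgi] ca pa cb pb gab.
have [Lre Lim] := (Lp1_parts f).1 Lf.
have [_ mre _] := Lre; have [_ mim _] := Lim.
have ma := continuous_measurable ca; have mb := continuous_measurable cb.
have Ere x : complex.Re (f x * (g x)^*) = re f x * re g x + im f x * im g x.
  by rewrite /re /im; case: (f x) (g x) => [u1 u2] [w1 w2] /=; ring.
have Eim x : complex.Im (f x * (g x)^*) = im f x * re g x - re f x * im g x.
  by rewrite /re /im; case: (f x) (g x) => [u1 u2] [w1 w2] /=; ring.
have [_ _ irb] := circleL1M Lre cb pb.
rewrite /circle_cint (eq_circle_int Ere) (eq_circle_int Eim) -(circle_intN irb).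
congr (_ +i* _); apply: circle_int_ae.
- by apply: measurable_funU; apply: measurable_funD; exact: measurable_funM.
- by apply: measurable_funU; exact: measurable_funM.
- apply: ae_to_unit; apply: ae_imply2 f0 gab => x e1.
  by rewrite e1 mul0r addr0 /re => ->.
- by apply: measurable_funU; apply: measurable_funB; exact: measurable_funM.
- by apply: measurable_funU; apply: measurableT_comp => //; exact: measurable_funM.
- apply: ae_to_unit; apply: ae_imply2 f0 gab => x e1.
  by rewrite e1 mul0r sub0r /im => ->.
Qed.

Lemma measurable_periodic_cplx (a : R -> R) : periodic a 1 -> measurable_fun setT a ->
  measurable_periodic (cplx a).
Proof.
by move=> pa ma; split => //; [move=> x; rewrite /cplx pa|exact: measurable_cst].
Qed.

Lemma measurable_periodic_mul (f g : R -> R[i]) : measurable_periodic f ->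
  measurable_periodic g -> measurable_periodic (fun x => f x * g x).
Proof.
move=> [pf fr fi] [pg gr gi]; split.
- by move=> x; rewrite pf pg.
- rewrite (_ : re _ = fun x => re f x * re g x - im f x * im g x).
    by apply: measurable_funB; exact: measurable_funM.
  by apply/funext => x; rewrite /re /im; case: (f x) (g x) => [? ?] [? ?].
- rewrite (_ : im _ = fun x => re f x * im g x + im f x * re g x).
    by apply: measurable_funD; exact: measurable_funM.
  by apply/funext => x; rewrite /re /im; case: (f x) (g x) => [? ?] [? ?].
Qed.

Lemma measurable_periodicN (f : R -> R[i]) : measurable_periodic f ->
  measurable_periodic (fun x => - f x).
Proof.
move=> [pf fr fi]; split.
- by move=> x; rewrite pf.
- rewrite (_ : re _ = fun x => - re f x); first exact: measurableT_comp.
  by apply/funext => x; rewrite /re; case: (f x).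
- rewrite (_ : im _ = fun x => - im f x); first exact: measurableT_comp.
  by apply/funext => x; rewrite /im; case: (f x).
Qed.

Lemma measurable_periodicB (f g : R -> R[i]) : measurable_periodic f ->
  measurable_periodic g -> measurable_periodic (fun x => f x - g x).
Proof.
move=> [pf fr fi] [pg gr gi]; split.
- by move=> x; rewrite pf pg.
- rewrite (_ : re _ = fun x => re f x - re g x); first exact: measurable_funB.
  by apply/funext => x; rewrite /re; case: (f x) (g x) => [? ?] [? ?].
- rewrite (_ : im _ = fun x => im f x - im g x); first exact: measurable_funB.
  by apply/funext => x; rewrite /im; case: (f x) (g x) => [? ?] [? ?].
Qed.

Lemma continuous_periodic_Lp q (a b : R -> R) : continuous a -> periodic a 1 ->
  continuous b -> periodic b 1 -> Lp_circle q (fun x => a x +i* b x).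
Proof.
move=> ca pa cb pb; have [A HA] := periodic_bounded ca pa.
have [B HB] := periodic_bounded cb pb; apply: (@Lp_bounded _ _ _ (A + B)).
- by move=> x; rewrite pa pb.
- exact: continuous_measurable.
- exact: continuous_measurable.
- by move=> x; apply: le_trans (normc_le _) _; exact: lerD (HA x) (HB x).
Qed.

Lemma classical_weak_derivative a a' b b' : circleC1 a a' -> circleC1 b b' ->
  weak_derivative (fun x : R => a x +i* b x) (fun x => a' x +i* b' x).
Proof.
move=> ca cb; have [_ _ pa] := ca; have [_ _ pb] := cb.
apply: (weak_derivative_classical _ ca cb); last exact: ae_all.
split; first by move=> x; rewrite pa pb.
  exact: continuous_measurable (circleC1_continuous ca).
exact: continuous_measurable (circleC1_continuous cb).
Qed.

Lemma W11_norm_ae0 (f : R -> R[i]) : measurable_periodic f -> ae_equal f (fun=> 0) ->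
  W11_norm f = 0.
Proof.
move=> mf f0; have c0 := circleC1_cst (0 : R).
have [mpf mr mi] := mf.
have fE : ae_equal f (fun=> 0 +i* 0) by [].
have [wd wae] := wderivP (weak_derivative_classical mf c0 c0 fE).
have [_ Lw] := weak_derivative_Lp1 wd; have [_ wr wi] := measurable_periodic_Lp Lw.
have z h : measurable_fun setT (re h) -> measurable_fun setT (im h) -> ae_equal h (fun=> 0) ->
    circle_int (fun x => Normc.normc (h x)) = 0.
  move=> hr hi h0; rewrite -[RHS](circle_int_cst 0); apply: circle_int_ae => //.
    by apply: measurable_funU; exact: measurable_normc.
  by apply: ae_to_unit; apply: ae_imply h0 => x ->; rewrite Normc.normc0.
by rewrite /W11_norm !z// addr0.
Qed.

(** Boundedness makes a functional blind to null sets. *)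
Lemma W11_dual_ae (phi : (R -> R[i]) -> R[i]) (f g : R -> R[i]) : W11_dual phi ->
  Sobolev 1 1 f -> Sobolev 1 1 g -> ae_equal f g -> phi f = phi g.
Proof.
move=> [lin [C HC]] Sf Sg fg.
have [Lf [f' [wf _]]] := Sf; have [Lg [g' [wg _]]] := Sg.
have mf := measurable_periodic_Lp Lf; have mg := measurable_periodic_Lp Lg.
have md := measurable_periodicB mg mf.
have d0 : ae_equal (fun x => g x - f x) (fun=> 0).
  by apply: ae_imply fg => x ->; rewrite subrr.
have c0 := circleC1_cst (0 : R).
have Sd := Sobolev11 (weak_derivative_classical md c0 c0 (d0 : ae_equal _ (fun=> 0 +i* 0))).
have := lin (-1) f g Sf Sg; rewrite (_ : (fun x => _) = fun x => g x - f x); last first.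
  by apply/funext => x; rewrite mulN1r addrC.
move=> e; have := HC _ Sd; rewrite (W11_norm_ae0 md d0) mulr0 e => h.
have /Normc.eq0_normc : Normc.normc (- 1 * phi f + phi g) = 0.
  by apply/eqP; rewrite eq_le h normc_nonneg.
by rewrite mulN1r addrC => /eqP; rewrite subr_eq0 => /eqP.
Qed.

End Pairings.

(** * The eigenfunctional and the eigenfunction *)

Section Functional.
Context {R : realType}.
Local Open Scope complex_scope.
Notation mu := (@lebesgue_measure R).
Notation I := circle_int.
Context (phi : (R -> R[i]) -> R[i]) (phi0 : R -> R).
Context (phi_dual : W11_dual phi) (phi0_H1 : Sobolev 1 2 (cplx phi0)).
Context (phi_repr : forall f : R -> R, Sobolev 1 2 (cplx f) ->
     phi (cplx f) =
       circle_cint (fun x => (phi0 x)%:C * (cplx f x)^*) +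
       circle_cint (fun x => wderiv (cplx phi0) x * (wderiv (cplx f) x)^*)).

Definition dphi0 : R -> R := re (wderiv (cplx phi0)).

Lemma phi0_facts : [/\ Lp_circle 1 (cplx phi0), Lp_circle 1 (wderiv (cplx phi0)) &
  {ae mu, forall x, im (wderiv (cplx phi0)) x = 0}].
Proof.
have [_ [g [/wderivP[wd _] _]]] := phi0_H1; have [L1 L2] := weak_derivative_Lp1 wd.
split => //; have [_ wi] := (weak_derivative_parts _ _).1 wd.
have c0 := circleC1_cst (0 : R); have [_ c p] := c0.
have w0 : real_weak_derivative (im (cplx phi0)) (fun=> 0).
  apply: (real_weak_derivative_classical _ _ c0); last exact: ae_all.
    by move=> x.
  exact: measurable_cst.
exact: (real_weak_derivative_unique wi w0 (ae_all _)).
Qed.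

(** The pairing of phi with real C1 functions, in terms of its H1 density. *)
Definition pairing (a a' : R -> R) : R := I (fun x => phi0 x * a x) + I (fun x => dphi0 x * a' x).

Lemma phi_C1 (a a' : R -> R) : circleC1 a a' -> phi (cplx a) = (pairing a a')%:C.
Proof.
move=> ca; have c0 := circleC1_cst (0 : R); have [L1 L2 im0] := phi0_facts.
have [_ ca' pa] := ca; have cona := circleC1_continuous ca; have pa' := circleC1_periodic ca.
have con0 := circleC1_continuous c0; have [_ _ p0] := c0.
have wd := classical_weak_derivative ca c0.
have Sa : Sobolev 1 2 (cplx a).
  split; first exact: (continuous_periodic_Lp 2 cona pa con0 p0).
  exists (fun x => a' x +i* 0); split; first exact: wd.
  exact: (continuous_periodic_Lp 2 ca' pa' con0 p0).
rewrite (phi_repr Sa).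
have [wda aea] := wderivP wd; have [_ Lwa] := weak_derivative_Lp1 wda.
rewrite (@circle_cint_conj _ (cplx phi0) (cplx a) a (fun=> 0) L1 (ae_all _) _ cona pa con0 p0 (ae_all _))//; last first.
  by apply: measurable_periodic_cplx => //; exact: continuous_measurable.
rewrite (circle_cint_conj L2 im0 (measurable_periodic_Lp Lwa) ca' pa' con0 p0 aea).
have z (h : R -> R) : I (fun x => h x * 0) = 0.
  by rewrite -[RHS](circle_int_cst 0); apply: eq_circle_int => x; rewrite mulr0.
by rewrite !z; apply: complexP => //=; rewrite oppr0 addr0.
Qed.

Lemma phi_ae (f : R -> R[i]) (a a' : R -> R) : measurable_periodic f -> circleC1 a a' ->
  ae_equal f (cplx a) -> phi f = (pairing a a')%:C.
Proof.
move=> mf ca fa; rewrite -(phi_C1 ca); have c0 := circleC1_cst (0 : R).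
apply: W11_dual_ae => //.
  exact: Sobolev11 (weak_derivative_classical mf ca c0 fa).
exact: Sobolev11 (classical_weak_derivative ca c0).
Qed.

End Functional.

Section Eigenfunction.
Context {R : realType} {tau sigma p p1 p2 : R -> R} {D : nat} {eps alpha : R}.
Context (E : expanding_lift tau (derive1 tau) sigma p p1 p2 D eps alpha).
Local Open Scope complex_scope.
Notation mu := (@lebesgue_measure R).
Notation I := circle_int.
Local Notation L := (@real_transfer R sigma p D eps).

Lemma real_eigenfunction_C2 (lambda : R) (v w : R -> R) : alpha < lambda ->
  real_weak_derivative v w -> {ae mu, forall x, L v x = lambda * v x} ->
  exists u u1 u2 : R -> R, [/\ {ae mu, forall x, v x = u x}, circleC1 u u1 & circleC1 u1 u2].
Proof.
move=> al vw ev; have [F [cF pF vF FP]] := real_weak_derivative_primitive vw.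
have [_ Lw _] := vw.
have LF : forall x, L F x = lambda * F x.
  apply: continuous_ae_eq; first exact: real_transfer_continuous E _ cF.
    exact: continuousZR.
  have LvF : {ae mu, forall x, L F x = lambda * v x}.
    by apply: ae_imply2 ev (ae_real_transfer E vF) => x <-.
  by apply: ae_imply2 LvF vF => x -> ->.
have [u1 [u2 [cu cu1]]] := eigenfunction_C2 E al cF pF Lw FP LF.
by exists F, u1, u2.
Qed.

Lemma transfer_eigen_parts (lambda : R) (v : R -> R[i]) : periodic v 1 ->
  ae_equal (transfer tau v) (fun x => lambda%:C * v x) ->
  {ae mu, forall x, L (re v) x = lambda * re v x} /\
  {ae mu, forall x, L (im v) x = lambda * im v x}.
Proof.
move=> pv ev; split.
  apply: ae_imply (ae_re ev) => x; rewrite (re_transfer E)// => ->.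
  by rewrite /re; case: (v x) => a b /=; ring.
apply: ae_imply (ae_im ev) => x; rewrite (im_transfer E)// => ->.
by rewrite /im; case: (v x) => a b /=; ring.
Qed.

Lemma real_eigen_shift (lambda : R) (v : R -> R) : periodic v 1 ->
  {ae mu, forall x, L v x = lambda * v x} ->
  ae_equal (transfer_shift tau lambda%:C (cplx v)) (fun=> 0).
Proof.
move=> pv ev; have pc : periodic (cplx v) 1 by move=> x; rewrite /cplx pv.
apply: ae_imply ev => x e; rewrite /transfer_shift.
have -> : transfer tau (cplx v) x = (L v x)%:C.
  apply: complexP; first exact: (re_transfer E).
  rewrite -[LHS]/(im _ _) (im_transfer E)//= /im /cplx/=.
  by apply: big1 => j _; rewrite !mulr0.
by rewrite e /cplx rmorphM subrr.
Qed.

(** Simplicity makes the real and imaginary parts of v0 proportional, and phi is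
    real on real functions; the normalisation phi v0 = 1 then excludes an
    imaginary part. *)
Lemma eigenfunction_real_C2 (lambda : R) (phi : (R -> R[i]) -> R[i]) (phi0 : R -> R)
    (v0 : R -> R[i]) : alpha < lambda ->
  simple_eigenvalue tau lambda%:C -> W11_dual phi -> Sobolev 1 2 (cplx phi0) ->
  (forall f : R -> R, Sobolev 1 2 (cplx f) -> phi (cplx f) =
     circle_cint (fun x => (phi0 x)%:C * (cplx f x)^*) +
     circle_cint (fun x => wderiv (cplx phi0) x * (wderiv (cplx f) x)^*)) ->
  eigenfunction tau lambda%:C v0 -> phi v0 = 1 ->
  exists u u1 u2 : R -> R, [/\ ae_equal v0 (cplx u), circleC1 u u1 & circleC1 u1 u2].
Proof.
move=> al [f _ simple] dual H1 repr [Sv _ ev] phiv.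
have [Lv [g [wv _]]] := Sv; have [pv mr mi] := measurable_periodic_Lp Lv.
have [wr wi] := (weak_derivative_parts _ _).1 wv.
have [er ei] := transfer_eigen_parts pv ev.
have [r [r1 [r2 [aer cr cr1]]]] := real_eigenfunction_C2 al wr er.
have [s [s1 [s2 [aes cs cs1]]]] := real_eigenfunction_C2 al wi ei.
exists r, r1, r2; split => //.
suff im0 : {ae mu, forall x, im v0 x = 0} by exact: ae_parts.
have pr : periodic (re v0) 1 by move=> x; rewrite /re pv.
have pi' : periodic (im v0) 1 by move=> x; rewrite /im pv.
have c0 := circleC1_cst (0 : R).
have mpr : measurable_periodic (cplx (re v0)) by exact: measurable_periodic_cplx.
have mpi : measurable_periodic (cplx (im v0)) by exact: measurable_periodic_cplx.
have aer' : ae_equal (cplx (re v0)) (cplx r) by apply: ae_imply aer => x; rewrite /cplx => ->.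
have aes' : ae_equal (cplx (im v0)) (cplx s) by apply: ae_imply aes => x; rewrite /cplx => ->.
have Sr := Sobolev11 (weak_derivative_classical mpr cr c0 aer').
have Si := Sobolev11 (weak_derivative_classical mpi cs c0 aes').
have [a ha] := simple 1%N _ Sr (real_eigen_shift pr er).
have [b hb] := simple 1%N _ Si (real_eigen_shift pi' ei).
have phir := phi_ae dual H1 repr mpr cr aer'.
have phii := phi_ae dual H1 repr mpi cs aes'.
have [lin _] := dual.
have : phi v0 = 'i * phi (cplx (im v0)) + phi (cplx (re v0)).
  rewrite -(lin 'i _ _ Si Sr); congr phi; apply/funext => x.
  by apply: complexP; rewrite /cplx /re /im; case: (v0 x) => ? ? /=; ring.
rewrite phiv phir phii => e.
have pi0 : pairing phi0 s s1 = 0.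
  by have := congr1 (@complex.Im R) e; rewrite /=; lra.
have [b0|bn0] := eqVneq b 0.
  apply: ae_imply hb => x; rewrite b0 mul0r => /(congr1 (@complex.Re R)).
  by [].
(* Now re v0 is proportional to im v0, on which phi vanishes, against phi v0 = 1. *)
have reE : ae_equal (cplx (re v0)) (fun x => a / b * cplx (im v0) x).
  by apply: ae_imply2 ha hb => x -> ->; rewrite mulrA divfK.
have phi_0 : phi (fun=> 0) = 0.
  have m0 : measurable_periodic (fun=> (0 : R[i])) by split => //; exact: measurable_cst.
  rewrite (phi_ae dual H1 repr m0 c0 (ae_all _))//.
  rewrite /pairing !(eq_circle_int (g := fun=> 0)) ?circle_int_cst ?addr0// => x; exact: mulr0.
have S0 : Sobolev 1 1 (fun=> (0 : R[i])).
  have m0 : measurable_periodic (fun=> (0 : R[i])) by split => //; exact: measurable_cst.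
  exact: Sobolev11 (weak_derivative_classical m0 c0 c0 (ae_all _)).
have reE' : phi (cplx (re v0)) = a / b * phi (cplx (im v0)).
  have := lin (a / b) _ _ Si S0; rewrite phi_0 addr0 => <-.
  apply: W11_dual_ae => //; last by apply: ae_imply reE => x ->; rewrite addr0.
  have mab : measurable_periodic (fun x => a / b * cplx (im v0) x + 0).
    rewrite (_ : (fun x => _) = fun x => (a / b) * cplx (im v0) x); last first.
      by apply/funext => x; rewrite addr0.
    by apply: measurable_periodic_mul => //; split => //; exact: measurable_cst.
  apply: (Sobolev11 (weak_derivative_classical mab cr c0 _)).
  by apply: ae_imply2 reE aer' => x e1 e2; rewrite addr0 -e1 e2.
move: reE'; rewrite phir phii pi0 mulr0 => /(congr1 (@complex.Re R)) /= r0.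
have := congr1 (@complex.Re R) e; rewrite pi0 r0 /= => /eqP.
by rewrite !mulr0 subrr addr0 oner_eq0.
Qed.

End Eigenfunction.

(** * The linear response as a functional of the perturbation *)

Section ResponseFunctional.
Context {R : realType} {tau sigma p p1 p2 : R -> R} {D : nat} {eps alpha : R}.
Context (E : expanding_lift tau (derive1 tau) sigma p p1 p2 D eps alpha).
Local Open Scope complex_scope.
Notation mu := (@lebesgue_measure R).
Notation I := circle_int.
Notation intg := circle_integrable.
Local Notation L := (@real_transfer R sigma p D eps).
Context (phi : (R -> R[i]) -> R[i]) (phi0 : R -> R).
Context (phi_dual : W11_dual phi) (phi0_H1 : Sobolev 1 2 (cplx phi0)).
Context (phi_repr : forall f : R -> R, Sobolev 1 2 (cplx f) ->
     phi (cplx f) =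
       circle_cint (fun x => (phi0 x)%:C * (cplx f x)^*) +
       circle_cint (fun x => wderiv (cplx phi0) x * (wderiv (cplx f) x)^*)).
Context (v0 : R -> R[i]) (v v1 v2 : R -> R).
Context (v0_meas : measurable_periodic v0) (v0E : ae_equal v0 (cplx v)).
Context (cv : circleC1 v v1) (cv1 : circleC1 v1 v2).

Let b0 x := v x * p x.
Let b1 x := v1 x * p x + v x * p1 x.
Let b2 x := (v2 x * p x + v1 x * p1 x) + (v1 x * p1 x + v x * p2 x).

Let cb0 : circleC1 b0 b1. Proof. exact: circleC1M cv (lift_p E). Qed.
Let cb1 : circleC1 b1 b2.
Proof.
by apply: circleC1D; [exact: circleC1M cv1 (lift_p E)|exact: circleC1M cv (lift_p1 E)].
Qed.

Let k1 (s s1 : R -> R) x := s1 x * b0 x + s x * b1 x.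
Let k2 (s s1 s2 : R -> R) x := (s2 x * b0 x + s1 x * b1 x) + (s1 x * b1 x + s x * b2 x).

Let ck0 s s1 : circleC1 s s1 -> circleC1 (fun x => s x * b0 x) (k1 s s1).
Proof. by move=> cs; exact: circleC1M cs cb0. Qed.

Let ck1 s s1 s2 : circleC1 s s1 -> circleC1 s1 s2 -> circleC1 (k1 s s1) (k2 s s1 s2).
Proof. by move=> cs cs1; apply: circleC1D; [exact: circleC1M cs1 cb0|exact: circleC1M cs cb1]. Qed.

Let u1 s s1 s2 := L (fun y => p y * k2 s s1 s2 y + p1 y * k1 s s1 y).

Let cu s s1 s2 : circleC1 s s1 -> circleC1 s1 s2 -> circleC1 (L (k1 s s1)) (u1 s s1 s2).
Proof. by move=> cs cs1; have H := real_transfer_C1 E (ck1 cs cs1); exact: H. Qed.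

(** Here k1 s s1 is the derivative of s v / tau', the transfer operator sends it
    to the function that phi is applied to, and u1 is the derivative of the
    latter. Thus only two derivatives of s enter. *)
Definition response (s s1 s2 : R -> R) : R := - pairing phi0 (L (k1 s s1)) (u1 s s1 s2).
Notation J := response.

Let invtau y : ((derive1 tau y)%:C)^-1 = (p y)%:C.
Proof.
have h := lift_tau1_p E y.
have tn0 : derive1 tau y != 0.
  by apply/eqP => z; move: h; rewrite z mul0r => /esym/eqP; rewrite oner_eq0.
by rewrite -[p y](mulKf tn0) h mulr1 -(rmorphV _)// unitfE.
Qed.

Let meas_p : measurable_periodic (cplx p).
Proof.
have [_ _ pp] := lift_p E; apply: measurable_periodic_cplx => //.
exact: continuous_measurable (circleC1_continuous (lift_p E)).
Qed.

Lemma transfer_derivative (h : R -> R[i]) (a a1 a2 b c1 c2 : R -> R) :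
  measurable_periodic h -> circleC1 a a1 -> circleC1 a1 a2 -> circleC1 b c1 -> circleC1 c1 c2 ->
  ae_equal h (fun x => a x +i* b x) ->
  let u := transfer tau (wderiv (fun y => h y * v0 y / (derive1 tau y)%:C)) in
  measurable_periodic u /\ ae_equal u (fun x => L (k1 a a1) x +i* L (k1 b c1) x).
Proof.
move=> mh ca ca1 cb cc hab u.
have mhv : measurable_periodic (fun y => h y * v0 y / (derive1 tau y)%:C).
  rewrite (_ : (fun y => _) = fun y => h y * v0 y * cplx p y); last first.
    by apply/funext => y; rewrite invtau.
  by apply: measurable_periodic_mul => //; exact: measurable_periodic_mul.
have e : ae_equal (fun y => h y * v0 y / (derive1 tau y)%:C) (fun x => (a x * b0 x) +i* (b x * b0 x)).
  apply: ae_imply2 hab v0E => x -> ->; rewrite invtau /cplx /b0.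
  by apply: complexP => /=; ring.
have [wd wae] := wderivP (weak_derivative_classical mhv (ck0 ca) (ck0 cb) e).
have [_ Lw] := weak_derivative_Lp1 wd; have mw := measurable_periodic_Lp Lw.
split; first exact: (transfer_measurable_periodic E mw).
exact: (ae_transfer E mw wae).
Qed.

Lemma response_formulaE (h : R -> R[i]) (a a1 a2 b c1 c2 : R -> R) :
  measurable_periodic h -> circleC1 a a1 -> circleC1 a1 a2 -> circleC1 b c1 -> circleC1 c1 c2 ->
  ae_equal h (fun x => a x +i* b x) ->
  response_formula tau v0 phi0 h = J a a1 a2 -i* J b c1 c2.
Proof.
move=> mh ca ca1 cb cc hab; rewrite /response_formula.
have [mu' uae] := transfer_derivative mh ca ca1 cb cc hab.
set u := transfer tau _ in mu' uae *.
have cua := cu ca ca1; have cub := cu cb cc.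
have [wd wae] := wderivP (weak_derivative_classical mu' cua cub uae).
have [_ Lw] := weak_derivative_Lp1 wd; have mw := measurable_periodic_Lp Lw.
have [L1 L2 im0] := phi0_facts phi0_H1.
have [_ cua' pua] := cua; have [_ cub' pub] := cub.
rewrite (circle_cint_conj L1 (ae_all _) mu' (circleC1_continuous cua) pua (circleC1_continuous cub) pub uae)//.
rewrite (circle_cint_conj L2 im0 mw cua' (circleC1_periodic cua) cub' (circleC1_periodic cub) wae).
by apply: complexP; rewrite /J /pairing /dphi0 /=; ring.
Qed.

Lemma dot_lambdaE (S s s1 s2 : R -> R) : periodic S 1 -> measurable_fun setT S ->
  circleC1 s s1 -> circleC1 s1 s2 -> {ae mu, forall x, S x = s x} ->
  dot_lambda tau phi v0 S = (J s s1 s2)%:C.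
Proof.
move=> pS mS cs cs1 Ss; have c0 := circleC1_cst (0 : R).
have mSc := measurable_periodic_cplx pS mS.
have Sae : ae_equal (cplx S) (fun x => s x +i* 0) by apply: ae_imply Ss => x; rewrite /cplx => ->.
have [mu' uae] := transfer_derivative mSc cs cs1 c0 c0 Sae.
rewrite /dot_lambda /dot_transfer.
rewrite (_ : (fun y => v0 y * (S y)%:C / _) = fun y => cplx S y * v0 y / (derive1 tau y)%:C); last first.
  by apply/funext => y; rewrite [v0 y * _]mulrC.
set u := transfer tau _ in mu' uae *.
have cua := cu cs cs1.
have := circleC1Z (-1) cua => cNu.
rewrite (phi_ae phi_dual phi0_H1 phi_repr (measurable_periodicN mu') cNu); last first.
  apply: ae_imply uae => x ->; rewrite (_ : L (k1 (fun=> 0) (fun=> 0)) x = 0).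
    by apply: complexP => /=; ring.
  by apply: big1 => j _; rewrite /k1; ring.
have [L1 L2 _] := phi0_facts phi0_H1.
have [Lp _] := (Lp1_parts _).1 L1; have [Lq _] := (Lp1_parts _).1 L2.
rewrite /J /pairing opprD; congr (_ %:C).
have [_ cua' pua] := cua.
have [_ _ i1] := circleL1M Lp (circleC1_continuous cua) pua.
have [_ _ i2] := circleL1M Lq cua' (circleC1_periodic cua).
rewrite -(circle_intN i1) -(circle_intN i2).
by congr (_ + _); apply: eq_circle_int => x; rewrite mulN1r mulrN.
Qed.

Lemma response_lin (x y : R) s s1 s2 t t1 t2 : circleC1 s s1 -> circleC1 s1 s2 ->
  circleC1 t t1 -> circleC1 t1 t2 ->
  J (fun z => x * s z + y * t z) (fun z => x * s1 z + y * t1 z) (fun z => x * s2 z + y * t2 z) =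
  x * J s s1 s2 + y * J t t1 t2.
Proof.
move=> cs cs1 ct ct1; have [L1 L2 _] := phi0_facts phi0_H1.
have [Lp _] := (Lp1_parts _).1 L1; have [Lq _] := (Lp1_parts _).1 L2.
have cua := cu cs cs1; have cub := cu ct ct1.
have [_ cua' pua] := cua; have [_ cub' pub] := cub.
have [_ _ i1] := circleL1M Lp (circleC1_continuous cua) pua.
have [_ _ i2] := circleL1M Lq cua' (circleC1_periodic cua).
have [_ _ i3] := circleL1M Lp (circleC1_continuous cub) pub.
have [_ _ i4] := circleL1M Lq cub' (circleC1_periodic cub).
rewrite /J /pairing.
have -> : I (fun z => phi0 z * L (k1 (fun z => x * s z + y * t z) (fun z => x * s1 z + y * t1 z)) z) =
    x * I (fun z => phi0 z * L (k1 s s1) z) + y * I (fun z => phi0 z * L (k1 t t1) z).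
  rewrite -!circle_intZ// -circle_intD; [|exact: circle_integrableZ..].
  apply: eq_circle_int => z; rewrite mulrCA [y * _]mulrCA -mulrDr; congr (_ * _).
  rewrite -!real_transferZ -real_transferD; apply: eq_real_transfer => w.
  by rewrite /k1; ring.
have -> : I (fun z => dphi0 phi0 z * u1 (fun z => x * s z + y * t z) (fun z => x * s1 z + y * t1 z)
      (fun z => x * s2 z + y * t2 z) z) =
    x * I (fun z => dphi0 phi0 z * u1 s s1 s2 z) + y * I (fun z => dphi0 phi0 z * u1 t t1 t2 z).
  rewrite -!circle_intZ// -circle_intD; [|exact: circle_integrableZ..].
  apply: eq_circle_int => z; rewrite mulrCA [y * _]mulrCA -mulrDr; congr (_ * _).
  rewrite /u1 -!real_transferZ -real_transferD; apply: eq_real_transfer => w.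
  by rewrite /k1 /k2; ring.
ring.
Qed.

Lemma response_bound : exists C : R, 0 <= C /\ forall s s1 s2 (B : R),
  circleC1 s s1 -> circleC1 s1 s2 -> (forall x, `|s x| <= B) -> (forall x, `|s1 x| <= B) ->
  (forall x, `|s2 x| <= B) -> `|J s s1 s2| <= C * B.
Proof.
have [L1 L2 _] := phi0_facts phi0_H1.
have [Lp _] := (Lp1_parts _).1 L1; have [Lq _] := (Lp1_parts _).1 L2.
have bd f f' : circleC1 f f' -> exists M : R, forall x, `|f x| <= M.
  by move=> cf; have [_ _ pf] := cf; exact: periodic_bounded (circleC1_continuous cf) pf.
have [M0 H0] := bd _ _ cb0; have [M1 H1] := bd _ _ cb1.
have [M2 H2] : exists M : R, forall x, `|b2 x| <= M.
  by have [_ c _] := cb1; exact: periodic_bounded c (circleC1_periodic cb1).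
have [P0 HP0] := bd _ _ (lift_p E); have [P1 HP1] := bd _ _ (lift_p1 E).
have nn (f : R -> R) M : (forall x, `|f x| <= M) -> 0 <= M by move=> /(_ 0); apply: le_trans.
have M00 := nn _ _ H0; have M10 := nn _ _ H1; have M20 := nn _ _ H2.
have P00 := nn _ _ HP0; have P10 := nn _ _ HP1.
pose A := I (fun x => `|phi0 x|); pose A' := I (fun x => `|dphi0 phi0 x|).
have A0 : 0 <= A by apply: circle_int_ge0 => x; exact: normr_ge0.
have A'0 : 0 <= A' by apply: circle_int_ge0 => x; exact: normr_ge0.
pose N1 := M0 + M1; pose N2 := M0 + M1 + (M1 + M2).
exists (D%:R * N1 * A + D%:R * (P0 * N2 + P1 * N1) * A'); split.
  by rewrite addr_ge0// !mulr_ge0// ?addr_ge0// ?mulr_ge0// ?addr_ge0.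
move=> s s1 s2 B cs cs1 sB s1B s2B; have B0 := nn _ _ sB.
have ml f g (x : R) K M : `|f x| <= K -> `|g x| <= M -> `|f x * g x| <= M * K.
  by move=> h1 h2; rewrite normrM mulrC ler_pM.
have k1B y : `|k1 s s1 y| <= N1 * B.
  apply: le_trans (ler_normD _ _) _; rewrite mulrDl; apply: lerD; exact: ml.
have k2B y : `|k2 s s1 s2 y| <= N2 * B.
  apply: le_trans (ler_normD _ _) _; rewrite mulrDl; apply: lerD.
    apply: le_trans (ler_normD _ _) _; rewrite mulrDl; apply: lerD; exact: ml.
  apply: le_trans (ler_normD _ _) _; rewrite mulrDl; apply: lerD; exact: ml.
have cua := cu cs cs1; have [_ cua' pua] := cua.
have u0B x : `|L (k1 s s1) x| <= D%:R * (N1 * B) := real_transfer_bound E x k1B.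
have u1B x : `|u1 s s1 s2 x| <= D%:R * (P0 * (N2 * B) + P1 * (N1 * B)).
  apply: (real_transfer_bound E) => y; apply: le_trans (ler_normD _ _) _.
  by rewrite !normrM lerD// ler_pM.
have [_ _ ip] := Lp; have [_ _ iq] := Lq.
rewrite /J normrN /pairing; apply: le_trans (ler_normD _ _) _.
have h1 := norm_circle_intM ip (continuous_measurableU (circleC1_continuous cua)) (fun x _ => u0B x).
have h2 := norm_circle_intM iq (continuous_measurableU cua') (fun x _ => u1B x).
apply: le_trans (lerD h1 h2) _.
rewrite le_eqVlt; apply/orP; left; apply/eqP; rewrite /A /A'; rewrite -/(dphi0 phi0); ring.
Qed.

End ResponseFunctional.

(** * Trigonometric series *)

Section ModeSeries.
Context {R : realType}.
Implicit Types f g : R -> R.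
Notation mu := (@lebesgue_measure R).
Notation I := circle_int.
Notation intg := circle_integrable.

(** The action of the derivative on the coefficients of a mode of frequency w. *)
Definition rotc (w : R) (c : R * R) : R * R := (w * c.2, - (w * c.1)).
Definition norm1 (c : R * R) : R := `|c.1| + `|c.2|.

(** The j-th derivative of the mode with coefficients c. *)
Definition dmode (j n : nat) (c : R * R) : R -> R :=
  let c' := iter j (rotc (freq n)) c in mode n c'.1 c'.2.

Lemma freq_ge n : n%:R <= freq n :> R.
Proof.
rewrite /freq -[leLHS]mul1r ler_wpM2r//.
have := @pi_ge2 R; lra.
Qed.

Lemma freq_ge0 n : 0 <= freq n :> R. Proof. exact: le_trans (ler0n _ n) (freq_ge n). Qed.

Lemma norm1_ge0 c : 0 <= norm1 c. Proof. by rewrite addr_ge0. Qed.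

Lemma norm1_rotc n c : norm1 (rotc (freq n) c) = freq n * norm1 c.
Proof. by rewrite /norm1 /= normrN !(normrM (freq n)) (ger0_norm (freq_ge0 n)); ring. Qed.

Lemma norm_dmode j n c x : `|dmode j n c x| <= freq n ^+ j * norm1 c.
Proof.
have -> : freq n ^+ j * norm1 c = norm1 (iter j (rotc (freq n)) c).
  elim: j => [|j IH]; first by rewrite expr0 mul1r.
  by rewrite iterS norm1_rotc -IH exprS mulrA.
apply: le_trans (ler_normD _ _) _; rewrite !normrM lerD//.
  by rewrite ler_piMr// norm_cosn.
by rewrite ler_piMr// norm_sinn.
Qed.

Lemma circleC1_dmode j n c : circleC1 (dmode j n c) (dmode j.+1 n c).
Proof. by rewrite /dmode iterS; exact: circleC1_mode. Qed.

Lemma dmode_continuous j n c : continuous (dmode j n c).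
Proof. exact: circleC1_continuous (circleC1_dmode j n c). Qed.

Lemma dmode_scale j n (k : R) c x : dmode j n (k * c.1, k * c.2) x = k * dmode j n c x.
Proof.
rewrite /dmode; have -> : iter j (rotc (freq n)) (k * c.1, k * c.2) =
    (k * (iter j (rotc (freq n)) c).1, k * (iter j (rotc (freq n)) c).2).
  by elim: j => //= j ->; rewrite /rotc /=; congr (_, _); ring.
by rewrite /mode /=; ring.
Qed.

(** Moving j derivatives from the function to the mode and j more onto it costs
    the factor freq ^ (2 j). *)
Lemma weak_derivative_dmode (f : nat -> R -> R) k :
  (forall j, (j < k)%N -> real_weak_derivative (f j) (f j.+1)) ->
  forall j, (j <= k)%N -> forall n c,
  I (fun x => f j x * dmode j n c x) = (freq n ^+ 2) ^+ j * I (fun x => f 0%N x * dmode 0 n c x).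
Proof.
move=> fw; elim=> [|j IH] jk n c; first by rewrite expr0 mul1r.
have [Lf _ H] := fw j jk.
have e a b : I (fun x => f j.+1 x * mode n a b x) = - I (fun x => f j x * mode n (freq n * b) (- (freq n * a)) x).
  by rewrite -mode_deriv (H _ (mode_test n a b)) opprK.
have -> : I (fun x => f j.+1 x * dmode j.+1 n c x) = - I (fun x => f j x *
    mode n (freq n * (iter j.+1 (rotc (freq n)) c).2) (- (freq n * (iter j.+1 (rotc (freq n)) c).1)) x).
  exact: e.
rewrite (exprS (freq n ^+ 2) j) -(mulrA (freq n ^+ 2)) -(IH (ltnW jk) n c).
have cm := circleC1_dmode j n c.
rewrite -circle_intZ; last exact: circleL1_intM Lf cm.
rewrite -circle_intN; last first.
  set a := freq n * _; set b := - _.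
  exact: circleL1_intM Lf (circleC1_mode n a b).
by apply: eq_circle_int => x; rewrite iterS /dmode /mode /=; ring.
Qed.

(** All four derivatives are moved to the mode, which returns to itself. *)
Lemma weak_derivative_mode4 (f : nat -> R -> R) :
  (forall j, (j < 4)%N -> real_weak_derivative (f j) (f j.+1)) ->
  forall n c, I (fun x => f 4%N x * dmode 0 n c x) = freq n ^+ 4 * I (fun x => f 0%N x * dmode 0 n c x).
Proof.
move=> fw n c.
have e j a b : (j < 4)%N -> I (fun x => f j.+1 x * mode n a b x) = - I (fun x => f j x * mode n (freq n * b) (- (freq n * a)) x).
  by move=> /fw[_ _ H]; rewrite -mode_deriv (H _ (mode_test n a b)) opprK.
rewrite /dmode /= !e// !opprK.
have [L0 _ _] := fw 0%N isT.
rewrite -circle_intZ; last exact: circleL1_intM L0 (circleC1_mode n _ _).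
by apply: eq_circle_int => x; rewrite /mode; ring.
Qed.

(** The squared L2 norms of the modes are 1 / mult n. *)
Definition mult (n : nat) : R := if n is 0%N then 1 else 2.

Lemma mult_gt0 n : 0 < mult n. Proof. by case: n. Qed.

Lemma classical_real_weak_derivative (a a' : R -> R) : circleC1 a a' -> real_weak_derivative a a'.
Proof.
move=> ca; have [_ _ pa] := ca.
apply: (real_weak_derivative_classical pa _ ca); last exact: ae_all.
exact: continuous_measurable (circleC1_continuous ca).
Qed.

(** Modes are eigenvectors of the second derivative for distinct eigenvalues. *)
Lemma dmode_orthogonal n m c d : n != m -> I (fun x => dmode 0 n c x * dmode 0 m d x) = 0.
Proof.
move=> nm.
have e k l c' d' : I (fun x => dmode 1 k c' x * dmode 1 l d' x) =
    freq l ^+ 2 * I (fun x => dmode 0 k c' x * dmode 0 l d' x).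
  rewrite -[freq l ^+ 2]expr1.
  apply: (@weak_derivative_dmode (fun j => dmode j k c') 1 _ 1%N) => // j _.
  exact: classical_real_weak_derivative (circleC1_dmode j k c').
have h := e n m c d; have h' := e m n d c.
have sw j k : I (fun x => dmode j m d x * dmode k n c x) = I (fun x => dmode k n c x * dmode j m d x).
  by apply: eq_circle_int => x; rewrite mulrC.
move: h'; rewrite !sw h => /eqP; rewrite -subr_eq0 -mulrBl mulf_eq0 => /orP[|/eqP//].
rewrite subr_eq0 (@eqrXn2 _ 2)// ?freq_ge0// => /eqP.
have tp : 2 * pi != 0 :> R by rewrite mulf_neq0// gt_eqF// pi_gt0.
by rewrite /freq => /(mulfI tp)/eqP; rewrite eqr_nat eq_sym (negPf nm).
Qed.

(** Integration by parts exchanges the squares of sine and cosine, whose sum is 1. *)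
Lemma dmode_norm n c d : mult n * I (fun x => dmode 0 n c x * dmode 0 n d x) =
  if n is 0%N then c.1 * d.1 else c.1 * d.1 + c.2 * d.2.
Proof.
have ic : intg (fun x : R => cosn n x * cosn n x).
  by apply: continuous_integrable; apply: continuousMR; exact: continuous_cosn.
have is' : intg (fun x : R => sinn n x * sinn n x).
  by apply: continuous_integrable; apply: continuousMR; exact: continuous_sinn.
have ics : intg (fun x : R => cosn n x * sinn n x).
  by apply: continuous_integrable; apply: continuousMR; [exact: continuous_cosn|exact: continuous_sinn].
have E : I (fun x => dmode 0 n c x * dmode 0 n d x) = c.1 * d.1 * I (fun x => cosn n x * cosn n x) +
    c.2 * d.2 * I (fun x => sinn n x * sinn n x) + (c.1 * d.2 + c.2 * d.1) * I (fun x => cosn n x * sinn n x).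
  rewrite -!circle_intZ// -!circle_intD//; last first.
  - exact: circle_integrableZ.
  - exact: circle_integrableZ.
  - exact: circle_integrableZ.
  - by apply: circle_integrableD; exact: circle_integrableZ.
  by apply: eq_circle_int => x; rewrite /dmode /mode /=; ring.
case: n ic is' ics E => [|n] ic is' ics ->.
  rewrite (eq_circle_int (f := fun x => cosn 0 x * cosn 0 x) (g := fun=> 1)); last by move=> x; rewrite cosn0 mulr1.
  rewrite (eq_circle_int (f := fun x => sinn 0 x * sinn 0 x) (g := fun=> 0)); last by move=> x; rewrite sinn0 mulr0.
  rewrite (eq_circle_int (f := fun x => cosn 0 x * sinn 0 x) (g := fun=> 0)); last by move=> x; rewrite sinn0 mulr0.
  by rewrite !circle_int_cst /mult; ring.
have f0 : freq n.+1 != 0 :> R by rewrite gt_eqF//; apply: lt_le_trans (freq_ge _).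
pose w : R := freq n.+1.
have cC : circleC1 (cosn n.+1) (fun x => - w * sinn n.+1 x).
  split; [exact: has_deriv_cosn|by apply: continuousZR; exact: continuous_sinn|exact: periodic_cosn].
have cS : circleC1 (sinn n.+1) (fun x => w * cosn n.+1 x).
  split; [exact: has_deriv_sinn|by apply: continuousZR; exact: continuous_cosn|exact: periodic_sinn].
have z : I (fun x : R => cosn n.+1 x * sinn n.+1 x) = 0.
  have := circle_int_deriv (circleC1M cS cS).
  rewrite (eq_circle_int (g := fun x => (2 * w) * (cosn n.+1 x * sinn n.+1 x))); last by move=> x; ring.
  by rewrite circle_intZ// => /eqP; rewrite mulf_eq0 mulf_eq0 pnatr_eq0 (negPf f0)/= => /eqP.
have s1 : I (fun x : R => cosn n.+1 x * cosn n.+1 x) = I (fun x : R => sinn n.+1 x * sinn n.+1 x).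
  have := circle_int_by_parts cC cS.
  rewrite (eq_circle_int (g := fun x => w * (cosn n.+1 x * cosn n.+1 x))); last by move=> x; ring.
  rewrite (eq_circle_int (f := fun x => _ * sinn n.+1 x) (g := fun x => - w * (sinn n.+1 x * sinn n.+1 x))); last by move=> x; ring.
  by rewrite !circle_intZ// -mulNr opprK => /(mulfI f0).
have s2 : I (fun x : R => cosn n.+1 x * cosn n.+1 x) + I (fun x : R => sinn n.+1 x * sinn n.+1 x) = 1.
  rewrite -circle_intD// -[RHS](circle_int_cst 1); apply: eq_circle_int => x.
  by rewrite -!expr2 /cosn /sinn cos2Dsin2.
rewrite z mulr0 addr0 /mult -s1; move: s2; rewrite -s1 => s2.
have -> : I (fun x : R => cosn n.+1 x * cosn n.+1 x) = 2^-1 by lra.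
by field.
Qed.

(** Majorant for all series of modes below: coefficients that are O(1/n^2) give
    a series with explicit tails O(1/N). *)
Lemma mode_series j (c : nat -> R * R) (M : R) :
  (forall n, freq n ^+ j * norm1 (c n) * (1 + freq n ^+ 2) <= M) ->
  exists F : R -> R, forall N x, `|(\sum_(n < N) dmode j n (c n) x) - F x| <= 6 * M / N.+1%:R.
Proof.
move=> cM; have M0 : 0 <= M.
  apply: le_trans (cM 0%N); rewrite mulr_ge0 ?mulr_ge0 ?exprn_ge0 ?freq_ge0 ?norm1_ge0//.
  by rewrite addr_ge0 ?sqr_ge0.
have tail n x : `|dmode j n (c n) x| <= 6 * M / n.+1%:R - 6 * M / n.+2%:R.
  apply: le_trans (norm_dmode _ _ _ _) _; have := cM n.
  have : 0 <= freq n ^+ j * norm1 (c n) by rewrite mulr_ge0 ?exprn_ge0 ?freq_ge0 ?norm1_ge0.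
  move: (_ * norm1 _) => A A0 h.
  have -> : 6 * M / n.+1%:R - 6 * M / n.+2%:R = 6 * M / (n.+1%:R * n.+2%:R) :> R.
    rewrite -[n.+2%:R]natr1; have : 0 < n.+1%:R :> R by [].
    by move: n.+1%:R => a a0; field; apply/andP; split; rewrite gt_eqF//; lra.
  rewrite ler_pdivlMr ?mulr_gt0//.
  apply: (@le_trans _ _ (6 * (A * (1 + freq n ^+ 2)))); last by rewrite ler_wpM2l.
  rewrite [leRHS]mulrCA; apply: (ler_wpM2l A0).
  (* This is (n + 1) (n + 2) <= 6 (1 + n^2), the origin of the constant 6; the
     difference is a quadratic in n with vertex 3 / 10. *)
  have fn : n%:R ^+ 2 <= freq n ^+ 2 :> R by rewrite lerXn2r ?nnegrE ?freq_ge0// freq_ge.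
  rewrite -[n.+2%:R]natr1 -[n.+1%:R]natr1.
  by have := sqr_ge0 (n%:R - 3 / 10 : R); nra.
have r0 : (fun N => 6 * M / N.+1%:R : R) @ \oo --> (0 : R).
  by rewrite -(mulr0 (6 * M)); apply: cvgM; [exact: cvg_cst|exact: cvg_harmonic].
have H x : exists s, forall N, `|(\sum_(n < N) dmode j n (c n) x) - s| <= 6 * M / N.+1%:R.
  exact: (telescope_series (t := fun n => dmode j n (c n) x) (fun n => tail n x) r0).
by exists (fun x => projT1 (cid (H x))) => N x; case: cid => s /= ->.
Qed.

Lemma harmonic_bound_cvg (M : R) : (fun N => 6 * M / N.+1%:R : R) @ \oo --> (0 : R).
Proof.
by rewrite -(mulr0 (6 * M)); apply: cvgM; [exact: cvg_cst|exact: cvg_harmonic].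
Qed.

Lemma partial_sum_C1 j (c : nat -> R * R) N :
  circleC1 (fun x => \sum_(n < N) dmode j n (c n) x) (fun x => \sum_(n < N) dmode j.+1 n (c n) x).
Proof.
by apply: (@circleC1_sum _ N (fun n => dmode j n (c n)) (fun n => dmode j.+1 n (c n))) => n; exact: circleC1_dmode.
Qed.

Lemma mode_series_continuous j (c : nat -> R * R) (M : R) F :
  (forall N x, `|(\sum_(n < N) dmode j n (c n) x) - F x| <= 6 * M / N.+1%:R) ->
  continuous F /\ periodic F 1.
Proof.
move=> H; have r0 := harmonic_bound_cvg M; split.
  apply: uniform_limit_continuousR H r0 => N; exact: circleC1_continuous (partial_sum_C1 j c N).
move=> x; have h y := cvg_by_bound (fun N => H N y) r0.
have := h (x + 1); rewrite (_ : (fun N => _) = fun N => \sum_(n < N) dmode j n (c n) x); last first.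
  by apply/funext => N; have [_ _] := partial_sum_C1 j c N; apply.
by move=> /cvg_lim <- //; apply/cvg_lim => //; exact: h.
Qed.

Lemma mode_series_C1 j (c : nat -> R * R) (M M' : R) F F' :
  (forall N x, `|(\sum_(n < N) dmode j n (c n) x) - F x| <= 6 * M / N.+1%:R) ->
  (forall N x, `|(\sum_(n < N) dmode j.+1 n (c n) x) - F' x| <= 6 * M' / N.+1%:R) ->
  circleC1 F F'.
Proof.
move=> H H'; have [cF pF] := mode_series_continuous H.
have [cF' pF'] := mode_series_continuous H'; split => //.
have r0 := harmonic_bound_cvg M; have r0' := harmonic_bound_cvg M'.
apply: (has_deriv_limit (F := fun N x => \sum_(n < N) dmode j n (c n) x) _ _ _ H' r0').
- by move=> N; have [] := partial_sum_C1 j c N.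
- by move=> N; have [_ ? _] := partial_sum_C1 j c N.
- by move=> x; exact: (cvg_by_bound (fun N => H N x) r0).
Qed.

(** The tails are uniformly O(1/N), so their integrals against f are O(1/N) times
    its L1 norm. *)
Lemma mode_series_int j (c : nat -> R * R) (M : R) F f : circleL1 f ->
  (forall N x, `|(\sum_(n < N) dmode j n (c n) x) - F x| <= 6 * M / N.+1%:R) ->
  (fun N => \sum_(n < N) I (fun x => f x * dmode j n (c n) x)) @ \oo --> I (fun x => f x * F x).
Proof.
move=> Lf H; have [cF pF] := mode_series_continuous H.
have [_ _ iF] := Lf.
have [_ _ ifF] := circleL1M Lf cF pF.
have im n : intg (fun x => f x * dmode j n (c n) x) := circleL1_intM Lf (circleC1_dmode j n (c n)).
pose K := I (fun x => `|f x|).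
apply: (cvg_by_bound (r := fun N => 6 * M / N.+1%:R * K)) => [N|]; last first.
  by rewrite -(mul0r K); apply: cvgM; [exact: harmonic_bound_cvg|exact: cvg_cst].
have [e i] := circle_int_sum N im; rewrite -e -circle_intB//.
rewrite (_ : I _ = I (fun x => f x * ((\sum_(n < N) dmode j n (c n) x) - F x))); last first.
  by apply: eq_circle_int => x; rewrite mulrBr big_distrr.
apply: norm_circle_intM => //; apply: continuous_measurableU; apply: continuousBR => //.
exact: circleC1_continuous (partial_sum_C1 j c N).
Qed.

End ModeSeries.

(** * Fourier series of functions with four weak derivatives *)

Section FourierRegularity.
Context {R : realType}.
Implicit Types f g : nat -> R -> R.
Notation mu := (@lebesgue_measure R).
Notation I := circle_int.
Notation intg := circle_integrable.

Definition fourier_coef (h : R -> R) n : R * R :=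
  (mult n * I (fun x => h x * cosn n x), mult n * I (fun x => h x * sinn n x)).

Lemma dmode_lin j n c x :
  dmode j n c x = c.1 * dmode j n (1, 0) x + c.2 * dmode j n (0, 1) x :> R.
Proof.
rewrite /dmode; suff -> : iter j (rotc (freq n)) c =
    (c.1 * (iter j (rotc (freq n)) (1, 0)).1 + c.2 * (iter j (rotc (freq n)) (0, 1)).1,
     c.1 * (iter j (rotc (freq n)) (1, 0)).2 + c.2 * (iter j (rotc (freq n)) (0, 1)).2).
  by rewrite /mode /=; ring.
elim: j => [|j IH].
  by case: c => a b /=; rewrite !mulr1 !mulr0 addr0 add0r.
by rewrite iterS IH /rotc !iterS /=; congr (_, _); ring.
Qed.

Lemma pow_le_1sq (w : R) j : 0 <= w -> (j <= 2)%N -> w ^+ j <= 1 + w ^+ 2.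
Proof.
move=> w0; case: j => [|[|[|//]]] _; rewrite ?expr0 ?expr1 ?lerDl ?sqr_ge0 ?lerDr//.
by have := sqr_ge0 (w - 1); nra.
Qed.

Lemma pow_le_1fourth (w : R) j : 0 <= w -> (j <= 4)%N -> w ^+ j <= 1 + w ^+ 4.
Proof.
move=> w0 j4; have [w1|w1] := leP w 1.
  apply: (@le_trans _ _ 1); last by rewrite lerDl exprn_ge0.
  exact: exprn_ile1.
apply: (@le_trans _ _ (w ^+ 4)); last by rewrite lerDr.
by apply: ler_weXn2l => //; exact: ltW.
Qed.

(** Four weak derivatives make the Fourier coefficients O(1/n^4): such a function
    is almost everywhere equal to a C2 function, and its Fourier series converges
    to it together with two derivatives. *)
Lemma fourier_C2 f : (forall j, (j < 4)%N -> real_weak_derivative (f j) (f j.+1)) ->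
  exists (s : nat -> R -> R) (M : R), [/\ {ae mu, forall x, f 0%N x = s 0%N x},
    circleC1 (s 0%N) (s 1%N), circleC1 (s 1%N) (s 2%N) &
    forall j, (j <= 2)%N -> forall N x,
      `|(\sum_(n < N) dmode j n (fourier_coef (f 0%N) n) x) - s j x| <= 6 * M / N.+1%:R].
Proof.
move=> fw; have [L0 _ _] := fw 0%N isT; have [_ L4 _] := fw 3%N isT.
set c := fourier_coef (f 0%N).
pose K (h : R -> R) : R := I (fun x => `|h x|).
have [_ _ i0] := L0; have [_ _ i4] := L4.
have mB (h : R -> R) n (a : R * R) : circleL1 h -> norm1 a <= 1 -> `|I (fun x => h x * dmode 0 n a x)| <= K h.
  move=> [_ _ ih] a1; rewrite -[K h]mul1r; apply: norm_circle_intM => //.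
    by apply: continuous_measurableU; exact: dmode_continuous.
  by move=> x _; apply: le_trans (norm_dmode _ _ _ _) _; rewrite expr0 mul1r.
have n10 : norm1 ((1, 0) : R * R) <= 1 by rewrite /norm1 /= normr1 normr0 addr0.
have n01 : norm1 ((0, 1) : R * R) <= 1 by rewrite /norm1 /= normr1 normr0 add0r.
have coef_eq n : norm1 (c n) = mult n * (`|I (fun x => f 0%N x * dmode 0 n (1, 0) x)| +
    `|I (fun x => f 0%N x * dmode 0 n (0, 1) x)|).
  have e1 : I (fun x => f 0%N x * dmode 0 n (1, 0) x) = I (fun x => f 0%N x * cosn n x).
    by apply: eq_circle_int => x; rewrite /dmode /= mode_cos.
  have e2 : I (fun x => f 0%N x * dmode 0 n (0, 1) x) = I (fun x => f 0%N x * sinn n x).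
    by apply: eq_circle_int => x; rewrite /dmode /= mode_sin.
  by rewrite e1 e2 /norm1 /c /fourier_coef /= !(normrM (mult n)) (gtr0_norm (mult_gt0 n)) mulrDr.
have mult2 n : mult n <= 2 :> R by case: n => //=; rewrite ler1n.
have cB n : norm1 (c n) * (1 + freq n ^+ 4) <= 4 * (K (f 0%N) + K (f 4%N)).
  rewrite coef_eq mulrDr mulr1.
  set X := `|_|; set Y := `|_|.
  have X0 : X <= K (f 0%N) by exact: mB.
  have Y0 : Y <= K (f 0%N) by exact: mB.
  have w4 : 0 <= freq n ^+ 4 :> R by rewrite exprn_ge0// freq_ge0.
  have X4 : X * freq n ^+ 4 <= K (f 4%N).
    by rewrite mulrC -[freq n ^+ 4]ger0_norm// -normrM -(weak_derivative_mode4 fw); exact: mB.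
  have Y4 : Y * freq n ^+ 4 <= K (f 4%N).
    by rewrite mulrC -[freq n ^+ 4]ger0_norm// -normrM -(weak_derivative_mode4 fw); exact: mB.
  rewrite -mulrA -mulrDr mulrDl; have := mult2 n; have := mult_gt0 n => m0 m2.
  have XY : 0 <= X + Y + (X * freq n ^+ 4 + Y * freq n ^+ 4).
    have xx : 0 <= X := normr_ge0 _; have yy : 0 <= Y := normr_ge0 _.
    exact: (addr_ge0 (addr_ge0 xx yy) (addr_ge0 (mulr_ge0 xx w4) (mulr_ge0 yy w4))).
  apply: (le_trans (ler_wpM2r XY m2)); lra.
pose M := 8 * (K (f 0%N) + K (f 4%N)).
have bound j : (j <= 2)%N -> forall n, freq n ^+ j * norm1 (c n) * (1 + freq n ^+ 2) <= M.
  move=> j2 n; have w0 : 0 <= freq n :> R := freq_ge0 n; have := cB n; have := norm1_ge0 (c n).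
  have := pow_le_1sq w0 j2; move: (freq n) w0 (norm1 _) => w w0 a wj a0 h.
  apply: (@le_trans _ _ ((1 + w ^+ 2) * a * (1 + w ^+ 2))).
    by rewrite ler_wpM2r ?addr_ge0 ?sqr_ge0// ler_wpM2r.
  apply: (@le_trans _ _ (2 * (a * (1 + w ^+ 4)))); last by rewrite /M; lra.
  rewrite (_ : _ * _ * _ = (1 + w ^+ 2) ^+ 2 * a); last by ring.
  rewrite mulrA [leRHS]mulrAC ler_wpM2r//.
  rewrite (_ : w ^+ 4 = (w ^+ 2) ^+ 2); last by ring.
  by have := sqr_ge0 (w ^+ 2 - 1); move: (w ^+ 2) => z; nra.
have H j : exists F : R -> R, (j <= 2)%N -> forall N x,
    `|(\sum_(n < N) dmode j n (c n) x) - F x| <= 6 * M / N.+1%:R.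
  have [j2|j2] := boolP (j <= 2)%N; last by exists (fun=> 0).
  by have [F HF] := mode_series (bound j j2); exists F.
pose s j := projT1 (cid (H j)).
have sP j : (j <= 2)%N -> forall N x,
    `|(\sum_(n < N) dmode j n (c n) x) - s j x| <= 6 * M / N.+1%:R.
  by rewrite /s; case: cid.
exists s, M; split => //; last 2 first.
- exact: mode_series_C1 (sP 0%N isT) (sP 1%N isT).
- exact: mode_series_C1 (sP 1%N isT) (sP 2%N isT).
have [cs ps] := mode_series_continuous (sP 0%N isT).
have Ls := circleL1_continuous cs ps.
suff : {ae mu, forall x, f 0%N x - s 0%N x = 0}.
  by apply: ae_imply => x /eqP; rewrite subr_eq0 => /eqP.
apply: circleL1_mode0; first exact: circleL1B.
move=> m a b; have cm := circleC1_mode m a b; have [_ _ pm] := cm.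
have Lm := circleL1_continuous (circleC1_continuous cm) pm.
rewrite (_ : I _ = I (fun x => f 0%N x * mode m a b x) - I (fun x => mode m a b x * s 0%N x)); last first.
  rewrite -circle_intB; [|exact: circleL1_intM L0 cm|]; last first.
    apply: eq_circle_integrable (circleL1_intM Ls cm) => x; exact: mulrC.
  by apply: eq_circle_int => x; ring.
apply/eqP; rewrite subr_eq0 eq_sym; apply/eqP.
have lim1 := mode_series_int Lm (sP 0%N isT).
have term n : I (fun x => mode m a b x * dmode 0 n (c n) x) =
    if n == m then I (fun x => f 0%N x * mode m a b x) else 0.
  case: (eqVneq n m) => [->|nm]; last first.
    by apply: (@dmode_orthogonal _ m n (a, b)); rewrite eq_sym.
  have := dmode_norm m (a, b) (c m) => e.
  apply: (mulfI (lt0r_neq0 (mult_gt0 m))); rewrite -[LHS]/(mult m * I (fun x => dmode 0 m (a, b) x * dmode 0 m (c m) x)) e.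
  have -> : I (fun x => f 0%N x * mode m a b x) = a * I (fun x => f 0%N x * cosn m x) + b * I (fun x => f 0%N x * sinn m x).
    have ic : intg (fun x => f 0%N x * cosn m x).
      by have [] := circleL1M L0 (@continuous_cosn R m) (@periodic_cosn R m).
    have is' : intg (fun x => f 0%N x * sinn m x).
      by have [] := circleL1M L0 (@continuous_sinn R m) (@periodic_sinn R m).
    rewrite -!circle_intZ// -circle_intD; [|exact: circle_integrableZ..].
    by apply: eq_circle_int => x; rewrite /mode; ring.
  case: (m) => [|k] /=; last by rewrite /c /fourier_coef /=; ring.
  rewrite /c /fourier_coef /= [X in b * X](_ : _ = 0); first by ring.
  by rewrite -[RHS](circle_int_cst 0); apply: eq_circle_int => x; rewrite sinn0 mulr0.
have lim2 : (fun N => \sum_(n < N) I (fun x => mode m a b x * dmode 0 n (c n) x)) @ \oo -->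
    I (fun x => f 0%N x * mode m a b x).
  apply: cvg_near_cst; near=> N; have mN : (m < N)%N by near: N; exists m.+1.
  rewrite (eq_bigr (fun n : 'I_N => if n == Ordinal mN then I (fun x => f 0%N x * mode m a b x) else 0)).
    by rewrite -big_mkcond/= big_pred1_eq.
  by move=> n _; exact: term.
by have /cvg_lim <- := lim1; [have /cvg_lim <- := lim2|].
Unshelve. all: by end_near. Qed.
End FourierRegularity.

(** * The Riesz representative of the response *)

Lemma cvg_finite_sum {R : realType} (k : nat) (u : nat -> nat -> R) (l : nat -> R) :
  (forall j, (j < k)%N -> u j @ \oo --> l j) ->
  (fun N => \sum_(j < k) u j N) @ \oo --> \sum_(j < k) l j.
Proof.
elim: k => [|k IH] H.
  rewrite big_ord0 (_ : (fun N => _) = fun=> 0); first exact: cvg_cst.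
  by apply/funext => N; rewrite big_ord0.
rewrite big_ord_recr/= (_ : (fun N => _) = fun N => \sum_(j < k) u j N + u k N); last first.
  by apply/funext => N; rewrite big_ord_recr.
by apply: cvgD; [apply: IH => j jk; apply: H; exact: ltnW|exact: H].
Qed.

Section OptimalSeries.
Context {R : realType}.
Notation mu := (@lebesgue_measure R).
Notation I := circle_int.
Notation intg := circle_integrable.
Context (J : (R -> R) -> (R -> R) -> (R -> R) -> R).
Context (J_lin : forall (x y : R) s s1 s2 t t1 t2, circleC1 s s1 -> circleC1 s1 s2 ->
  circleC1 t t1 -> circleC1 t1 t2 ->
  J (fun z => x * s z + y * t z) (fun z => x * s1 z + y * t1 z) (fun z => x * s2 z + y * t2 z) =
  x * J s s1 s2 + y * J t t1 t2).
Context (J_bound : exists C : R, 0 <= C /\ forall s s1 s2 (B : R),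
  circleC1 s s1 -> circleC1 s1 s2 -> (forall x, `|s x| <= B) -> (forall x, `|s1 x| <= B) ->
  (forall x, `|s2 x| <= B) -> `|J s s1 s2| <= C * B).

Definition on_mode n (c : R * R) : R := J (dmode 0 n c) (dmode 1 n c) (dmode 2 n c).
Definition cos_response n := on_mode n (1, 0).
Definition sin_response n := on_mode n (0, 1).
Notation A := cos_response.
Notation B := sin_response.

Lemma on_modeE n c : on_mode n c = c.1 * A n + c.2 * B n.
Proof.
rewrite /A /B /on_mode -J_lin; try exact: circleC1_dmode.
by congr J; apply/funext => x; exact: dmode_lin.
Qed.

Let S (c : nat -> R * R) N j x := \sum_(n < N) dmode j n (c n) x.

Lemma response_partial_sum c N :
  J (S c N 0%N) (S c N 1%N) (S c N 2%N) = \sum_(n < N) ((c n).1 * A n + (c n).2 * B n).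
Proof.
elim: N => [|N IH].
  have z := circleC1_cst (0 : R).
  have := J_lin 0 0 z z z z; rewrite !mul0r addr0 big_ord0 => <-.
  by congr J; apply/funext => x; rewrite /S big_ord0; ring.
rewrite big_ord_recr/= -IH -on_modeE -[X in X + _]mul1r -[X in _ + X]mul1r -J_lin.
- by congr J; apply/funext => x; rewrite /S big_ord_recr/= !mul1r.
- exact: partial_sum_C1.
- exact: partial_sum_C1.
- exact: circleC1_dmode.
- exact: circleC1_dmode.
Qed.

Lemma response_series (c : nat -> R * R) (M : R) (F : nat -> R -> R) :
  circleC1 (F 0%N) (F 1%N) -> circleC1 (F 1%N) (F 2%N) ->
  (forall j, (j <= 2)%N -> forall N x, `|S c N j x - F j x| <= 6 * M / N.+1%:R) ->
  (fun N => \sum_(n < N) ((c n).1 * A n + (c n).2 * B n)) @ \oo --> J (F 0%N) (F 1%N) (F 2%N).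
Proof.
move=> F01 F12 H; have [C [C0 HC]] := J_bound.
apply: (cvg_by_bound (r := fun N => C * (6 * M / N.+1%:R))) => [N|]; last first.
  by rewrite -(mulr0 C); apply: cvgM; [exact: cvg_cst|exact: harmonic_bound_cvg].
rewrite -response_partial_sum; have s01 := partial_sum_C1 0 c N; have s12 := partial_sum_C1 1 c N.
have -> : J (S c N 0%N) (S c N 1%N) (S c N 2%N) - J (F 0%N) (F 1%N) (F 2%N) =
    1 * J (S c N 0%N) (S c N 1%N) (S c N 2%N) + (-1) * J (F 0%N) (F 1%N) (F 2%N) by ring.
rewrite -J_lin//.
have e j x : (j <= 2)%N -> `|1 * S c N j x + -1 * F j x| <= 6 * M / N.+1%:R.
  by move=> j2; rewrite mul1r mulN1r; exact: H.
apply: HC => [|||x|x]; try (by move=> *; exact: e).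
- exact: circleC1D (circleC1Z 1 s01) (circleC1Z (-1) F01).
- exact: circleC1D (circleC1Z 1 s12) (circleC1Z (-1) F12).
Qed.

(** The squared H4 norm of the n-th mode, up to the factor 1 / mult n. *)
Definition weight n : R := \sum_(k < 5) (freq n ^+ 2) ^+ k.

Lemma weight_ge n : 1 + freq n ^+ 8 <= weight n.
Proof.
have w0 : 0 <= freq n :> R := freq_ge0 n.
rewrite /weight !big_ord_recl big_ord0 /= expr0 -!exprM /= !addrA addr0.
have h2 : 0 <= freq n ^+ 2 :> R by rewrite exprn_ge0.
have h4 : 0 <= freq n ^+ 4 :> R by rewrite exprn_ge0.
have h6 : 0 <= freq n ^+ 6 :> R by rewrite exprn_ge0.
rewrite /bump /= !mulnE /=; lra.
Qed.

Lemma weight_gt0 n : 0 < weight n.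
Proof.
apply: lt_le_trans (weight_ge n).
by rewrite ltr_wpDr// exprn_ge0// freq_ge0.
Qed.

Lemma mult_le2 n : mult n <= 2 :> R. Proof. by case: n => //=; rewrite ler1n. Qed.

Definition optimal_coef n : R * R := (mult n * A n / weight n, mult n * B n / weight n).
Notation tc := optimal_coef.

(** J sees two derivatives of its argument, each of which costs one frequency. *)
Lemma mode_response_bound : exists C : R, 0 <= C /\
  forall n, `|A n| + `|B n| <= C * (1 + freq n ^+ 2).
Proof.
have [C [C0 HC]] := J_bound; exists (2 * C); split; first by rewrite mulr_ge0.
have h n c : norm1 c <= 1 -> `|on_mode n c| <= C * (1 + freq n ^+ 2).
  move=> c1; have w0 : 0 <= freq n :> R := freq_ge0 n.
  have e j x : (j <= 2)%N -> `|dmode j n c x| <= 1 + freq n ^+ 2.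
    move=> j2; apply: le_trans (norm_dmode _ _ _ _) _.
    apply: le_trans (pow_le_1sq w0 j2); rewrite ler_piMr// exprn_ge0//.
  by apply: HC; try exact: circleC1_dmode; move=> x; exact: e.
move=> n; have h1 := h n (1, 0); have h2 := h n (0, 1).
rewrite [leRHS](_ : _ = C * (1 + freq n ^+ 2) + C * (1 + freq n ^+ 2)); last by ring.
apply: lerD; [apply: h1|apply: h2]; by rewrite /norm1 /= normr1 normr0 ?addr0 ?add0r.
Qed.

(** The weight is of order n^8; two powers of n go to the response, four to the
    derivatives of the series and two to its convergence. *)
Lemma optimal_coef_bound : exists M : R, forall j, (j <= 4)%N -> forall n,
  freq n ^+ j * norm1 (tc n) * (1 + freq n ^+ 2) <= M.
Proof.
have [C [C0 HC]] := mode_response_bound; exists (2 * C * 4) => j j4 n.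
have w0 : 0 <= freq n :> R := freq_ge0 n; have wj := pow_le_1fourth w0 j4.
have W := weight_ge n; have W0 := weight_gt0 n.
have -> : norm1 (tc n) = mult n * (`|A n| + `|B n|) / weight n.
  rewrite /norm1 /tc /= !normrM normfV (gtr0_norm W0) (gtr0_norm (mult_gt0 n)); ring.
have ab0 : 0 <= `|A n| + `|B n| by rewrite addr_ge0.
have := HC n; have := @mult_le2 n; have := @mult_gt0 R n.
move: (`|A n| + _) ab0 => a a0; move: (mult n) => m m0 m2 ha.
move: (weight n) W W0 => W Wge W0; move: (freq n) w0 wj ha Wge => w w0 wj ha Wge.
rewrite (_ : _ * _ * _ = (w ^+ j * (m * a) * (1 + w ^+ 2)) / W); last by ring.
rewrite ler_pdivrMr//.
have s2 : 0 <= 1 + w ^+ 2 by rewrite addr_ge0 ?sqr_ge0.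
have ma : m * a <= 2 * (C * (1 + w ^+ 2)) by rewrite ler_pM// ltW.
apply: (@le_trans _ _ ((1 + w ^+ 4) * (2 * (C * (1 + w ^+ 2))) * (1 + w ^+ 2))).
  by rewrite ler_wpM2r// ler_pM// ?exprn_ge0// mulr_ge0// ltW.
apply: (@le_trans _ _ (2 * C * 4 * (1 + w ^+ 8))); last by rewrite ler_wpM2l// !mulr_ge0.
rewrite (_ : _ * _ * _ = 2 * C * ((1 + w ^+ 4) * (1 + w ^+ 2) ^+ 2)); last by ring.
rewrite -[leRHS](mulrA (2 * C)); apply: ler_wpM2l; first exact: mulr_ge0.
have e8 : w ^+ 8 = (w ^+ 4) ^+ 2 by rewrite -exprM.
have e4 : w ^+ 4 = (w ^+ 2) ^+ 2 by rewrite -exprM.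
have q2 : (1 + w ^+ 2) ^+ 2 <= 2 * (1 + w ^+ 4).
  by rewrite e4; have := sqr_ge0 (w ^+ 2 - 1); move: (w ^+ 2) => z; nra.
have q4 : (1 + w ^+ 4) ^+ 2 <= 2 * (1 + w ^+ 8).
  by rewrite e8; have := sqr_ge0 (w ^+ 4 - 1); move: (w ^+ 4) => z; nra.
have p4 : 0 <= 1 + w ^+ 4 by rewrite addr_ge0 ?exprn_ge0.
apply: le_trans (ler_wpM2l p4 q2) _.
rewrite [leLHS](_ : _ = 2 * (1 + w ^+ 4) ^+ 2); last by ring.
lra.
Qed.

(** The series with coefficients [optimal_coef] is the Riesz representative of
    the functional J for the H4 inner product: on each mode this is the
    definition of the coefficients, and both sides are continuous along the
    Fourier series of an H4 function. *)
Lemma riesz_representative : exists T : nat -> R -> R,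
 [/\ forall j, (j < 4)%N -> circleC1 (T j) (T j.+1),
   exists M : R, forall j, (j <= 4)%N -> forall N x, `|S tc N j x - T j x| <= 6 * M / N.+1%:R,
   (fun N => \sum_(n < N) mult n * (A n ^+ 2 + B n ^+ 2) / weight n) @ \oo -->
      J (T 0%N) (T 1%N) (T 2%N)
   & forall f : nat -> R -> R, (forall j, (j < 4)%N -> real_weak_derivative (f j) (f j.+1)) ->
     exists s s1 s2 : R -> R, [/\ {ae mu, forall x, f 0%N x = s x}, circleC1 s s1, circleC1 s1 s2,
       J s s1 s2 = \sum_(j < 5) I (fun x => f j x * T j x) &
       (fun N => \sum_(n < N) ((fourier_coef (f 0%N) n).1 * A n + (fourier_coef (f 0%N) n).2 * B n))
         @ \oo --> J s s1 s2]].
Proof.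
have [M HM] := optimal_coef_bound.
have H j : exists F : R -> R, (j <= 4)%N -> forall N x, `|S tc N j x - F x| <= 6 * M / N.+1%:R.
  have [j4|j4] := boolP (j <= 4)%N; last by exists (fun=> 0).
  by have [F HF] := mode_series (HM j j4); exists F.
pose T j := projT1 (cid (H j)).
have TP j : (j <= 4)%N -> forall N x, `|S tc N j x - T j x| <= 6 * M / N.+1%:R.
  by rewrite /T; case: cid.
have TC j : (j < 4)%N -> circleC1 (T j) (T j.+1).
  by move=> j4; exact: mode_series_C1 (TP j (ltnW j4)) (TP j.+1 j4).
exists T; split => //; first by exists M.
  have TP2 j : (j <= 2)%N -> forall N x, `|S tc N j x - T j x| <= 6 * M / N.+1%:R.
    by move=> j2; apply: TP; exact: leq_trans j2 _.
  have := response_series (TC 0%N isT) (TC 1%N isT) TP2.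
  rewrite (_ : (fun N => _) = fun N => \sum_(n < N) mult n * (A n ^+ 2 + B n ^+ 2) / weight n)//.
  by apply/funext => N; apply: eq_bigr => n _; rewrite /tc /=; ring.
move=> f fw; have [s [K [fs s01 s12 sK]]] := fourier_C2 fw.
exists (s 0%N), (s 1%N), (s 2%N).
have lim1 := response_series s01 s12 sK.
split => //.
have Lf j : (j <= 4)%N -> circleL1 (f j).
  by case: j => [_|j j4]; [have [] := fw 0%N isT|have [] := fw j j4].
have lim2 : (fun N => \sum_(j < 5) \sum_(n < N) I (fun x => f j x * dmode j n (tc n) x)) @ \oo -->
    \sum_(j < 5) I (fun x => f j x * T j x).
  apply: (cvg_finite_sum (k := 5) (u := fun j N => \sum_(n < N) I (fun x => f j x * dmode j n (tc n) x))
    (l := fun j => I (fun x => f j x * T j x))) => j j4.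
  exact: (mode_series_int (Lf j j4) (TP j j4)).
move: lim1; rewrite (_ : (fun N => _) = fun N => \sum_(j < 5) \sum_(n < N) I (fun x => f j x * dmode j n (tc n) x)).
  by move=> /cvg_lim <- //; move/cvg_lim : lim2 => <-.
apply/funext => N; rewrite exchange_big/=; apply: eq_bigr => n _.
rewrite (eq_bigr (fun j : 'I_5 => (freq n ^+ 2) ^+ j * I (fun x => f 0%N x * dmode 0 n (tc n) x))); last first.
  by move=> j _; rewrite (weak_derivative_dmode fw)// -ltnS.
rewrite -big_distrl/= -/(weight n).
have -> : I (fun x => f 0%N x * dmode 0 n (tc n) x) =
    (tc n).1 * I (fun x => f 0%N x * cosn n x) + (tc n).2 * I (fun x => f 0%N x * sinn n x).
  have L0 := Lf 0%N isT.
  have ic : intg (fun x => f 0%N x * cosn n x).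
    by have [] := circleL1M L0 (@continuous_cosn R n) (@periodic_cosn R n).
  have is' : intg (fun x => f 0%N x * sinn n x).
    by have [] := circleL1M L0 (@continuous_sinn R n) (@periodic_sinn R n).
  rewrite -!circle_intZ// -circle_intD; [|exact: circle_integrableZ..].
  by apply: eq_circle_int => x; rewrite /dmode /mode /=; ring.
rewrite /tc /fourier_coef /=; have W0 := lt0r_neq0 (weight_gt0 n).
by field.
Qed.

End OptimalSeries.

(** * The H4 norm through chains of derivatives *)

Section HNorm.
Context {R : realType}.
Local Open Scope complex_scope.
Notation mu := (@lebesgue_measure R).
Notation I := circle_int.
Notation intg := circle_integrable.

Lemma weak_derivative_ae (f f' g : R -> R[i]) : weak_derivative f g -> Lp_circle 1 f' ->
  ae_equal f f' -> weak_derivative f' g.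
Proof.
move=> /weak_derivative_parts[[[_ mr _] Lr Hr] [[_ mi _] Li Hi]] /Lp1_parts[Lr' Li'] ff'.
have [_ mr' _] := Lr'; have [_ mi' _] := Li'.
apply/weak_derivative_parts; split; split => // psi tpsi.
  rewrite -(Hr _ tpsi); apply: circle_intM_ae => //.
    by have [_ c _] := test_function_circleC1 tpsi; exact: continuous_measurable.
  by apply: ae_imply (ae_re ff') => x ->.
rewrite -(Hi _ tpsi); apply: circle_intM_ae => //.
  by have [_ c _] := test_function_circleC1 tpsi; exact: continuous_measurable.
by apply: ae_imply (ae_im ff') => x ->.
Qed.

Lemma iter_wderiv (g : nat -> R -> R[i]) k :
  (forall j, (j < k)%N -> weak_derivative (g j) (g j.+1)) -> Lp_circle 1 (g 0%N) ->
  forall j, (j <= k)%N -> Lp_circle 1 (iter j wderiv (g 0%N)) /\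
    ae_equal (iter j wderiv (g 0%N)) (g j).
Proof.
move=> gw L0; elim=> [|j IH] jk; first by split => //; exact: ae_all.
have [Lj ej] := IH (ltnW jk).
have ej' : ae_equal (g j) (iter j wderiv (g 0%N)) by apply: ae_imply ej => x ->.
have [w e] := wderivP (weak_derivative_ae (gw j jk) Lj ej').
by have [_ L] := weak_derivative_Lp1 w.
Qed.

(** Any chain of weak derivatives computes the norm, whatever representatives
    [wderiv] chooses. *)
Lemma H_normE (g : nat -> R -> R[i]) :
  (forall j, (j < 4)%N -> weak_derivative (g j) (g j.+1)) ->
  H_norm 4 (g 0%N) = Num.sqrt (\sum_(j < 5) I (fun x => Normc.normc (g j x) ^+ 2)).
Proof.
move=> gw; have [L0 _] := weak_derivative_Lp1 (gw 0%N isT).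
rewrite /H_norm; congr Num.sqrt; apply: eq_bigr => j _.
have j4 : (j <= 4)%N by rewrite -ltnS.
have [L e] := iter_wderiv gw L0 j4.
have [_ mr mi] := measurable_periodic_Lp L.
have [_ mr' mi'] : measurable_periodic (g j).
  apply: (@measurable_periodic_Lp _ 1); case: (nat_of_ord j) j4 => // i i4.
  by have [] := weak_derivative_Lp1 (gw i i4).
apply: circle_int_ae.
- by apply: measurable_funU; apply: measurable_funX; exact: measurable_normc.
- by apply: measurable_funU; apply: measurable_funX; exact: measurable_normc.
- by apply: ae_to_unit; apply: ae_imply e => x ->.
Qed.

(** Chains of weak derivatives, indexed by the order, unroll the recursion of
    [Sobolev]. *)
Lemma Sobolev_chain k q (f : R -> R[i]) : Sobolev k q f ->
  exists g : nat -> R -> R[i], [/\ g 0%N = f,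
    forall j, (j < k)%N -> weak_derivative (g j) (g j.+1) &
    forall j, (j <= k)%N -> Lp_circle q (g j)].
Proof.
elim: k f => [|k IH] f; first by move=> Lf; exists (fun=> f); split => // -[].
move=> [Lf [g [fg /IH[h [h0 hw hL]]]]].
exists (fun j => if j is i.+1 then h i else f); split => // -[|j] jk //.
  by rewrite h0.
- exact: hw.
- exact: hL.
Qed.

Lemma chain_Sobolev k q (g : nat -> R -> R[i]) :
  (forall j, (j < k)%N -> weak_derivative (g j) (g j.+1)) ->
  (forall j, (j <= k)%N -> Lp_circle q (g j)) -> Sobolev k q (g 0%N).
Proof.
elim: k g => [|k IH] g gw gL; first exact: gL.
split; first exact: gL; exists (g 1%N); split; first exact: gw.
by apply: (IH (fun j => g j.+1)) => j jk; [exact: gw|exact: gL].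
Qed.

Lemma Sobolev_real_chain (S : R -> R) : Sobolev 4 2 (cplx S) ->
  exists f : nat -> R -> R, [/\ f 0%N = S,
    forall j, (j < 4)%N -> real_weak_derivative (f j) (f j.+1),
    forall j, (j <= 4)%N -> intg (fun x => f j x ^+ 2) &
    H_norm 4 (cplx S) = Num.sqrt (\sum_(j < 5) I (fun x => f j x ^+ 2))].
Proof.
move=> /Sobolev_chain[g [g0 gw gL]]; exists (fun j => re (g j)); split.
- by rewrite g0.
- by move=> j /gw/weak_derivative_parts[].
- by move=> j /gL/Lp2_sqr[].
have im0 j : (j <= 4)%N -> {ae mu, forall x, im (g j) x = 0}.
  elim: j => [_|j IH j4]; first by rewrite g0; exact: ae_all.
  have [_ wi] := (weak_derivative_parts _ _).1 (gw j j4).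
  have c0 := circleC1_cst (0 : R); have [_ c p] := c0.
  have w0 : real_weak_derivative (fun=> 0) (fun=> 0) := classical_real_weak_derivative c0.
  exact: (real_weak_derivative_unique wi w0 (IH (ltnW j4))).
rewrite -g0 (H_normE gw); congr Num.sqrt; apply: eq_bigr => j _.
have j4 : (j <= 4)%N by rewrite -ltnS.
have [_ mr mi] := measurable_periodic_Lp (gL j j4).
apply: circle_int_ae.
- by apply: measurable_funU; apply: measurable_funX; exact: measurable_normc.
- by apply: measurable_funU; exact: measurable_funX.
- by apply: ae_to_unit; apply: ae_imply (im0 j j4) => x e; rewrite normc_sqr -!/(im _ _) e expr0n addr0.
Qed.

Lemma H_norm_classical (a b : nat -> R -> R) :
  (forall j, (j < 4)%N -> circleC1 (a j) (a j.+1)) ->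
  (forall j, (j < 4)%N -> circleC1 (b j) (b j.+1)) ->
  H_norm 4 (fun x => a 0%N x +i* b 0%N x) =
    Num.sqrt (\sum_(j < 5) I (fun x => a j x ^+ 2 + b j x ^+ 2)).
Proof.
move=> ca cb.
have gw j : (j < 4)%N -> weak_derivative (fun x => a j x +i* b j x) (fun x => a j.+1 x +i* b j.+1 x).
  by move=> j4; apply: classical_weak_derivative; [exact: ca|exact: cb].
rewrite (H_normE (g := fun j x => a j x +i* b j x) gw); congr Num.sqrt.
by apply: eq_bigr => j _; apply: eq_circle_int => x; rewrite normc_sqr.
Qed.

Lemma Sobolev_classical (a : nat -> R -> R) :
  (forall j, (j < 4)%N -> circleC1 (a j) (a j.+1)) -> Sobolev 4 2 (cplx (a 0%N)).
Proof.
move=> ca; have c0 := circleC1_cst (0 : R).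
apply: (chain_Sobolev (g := fun j x => a j x +i* 0)) => j j4.
  by apply: classical_weak_derivative c0; exact: ca.
have [c p] : continuous (a j) /\ periodic (a j) 1.
  case: j j4 => [_|j j4].
    by have [_ _ p] := ca 0%N isT; split => //; exact: circleC1_continuous (ca 0%N isT).
  by have [_ c _] := ca j j4; split => //; exact: circleC1_periodic (ca j j4).
by apply: (@continuous_periodic_Lp _ 2 (a j) (fun=> 0)) => // x; exact: cvg_cst.
Qed.

End HNorm.

(** * Sums over the integers *)

Section IntegerSums.
Context {R : realType}.

Lemma esum_nat_series (g : nat -> R) (l : R) : (forall n, 0 <= g n) ->
  (fun N => \sum_(n < N) g n) @ \oo --> l -> (\sum_(n <oo) (g n)%:E)%E = l%:E.
Proof.
move=> g0 H; apply: cvg_lim => //.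
rewrite (_ : (fun N => \sum_(0 <= n < N) (g n)%:E)%E = fun N => (\sum_(n < N) g n)%:E).
  by apply/cvg_EFin => //; exact: nearW.
by apply/funext => N; rewrite big_mkord sumEFin.
Qed.

(** A sum over the integers of a function of the absolute value counts every
    positive frequency twice. *)
Lemma esum_int_absz (g : nat -> R) (l : R) : (forall n, 0 <= g n) ->
  (fun N => \sum_(n < N) mult n * g n) @ \oo --> l ->
  \esum_(n in [set: int]) (g `|n|%N)%:E = l%:E.
Proof.
move=> g0 H; pose G N := \sum_(n < N) mult n * g n.
have Gnd : {homo G : n m / (n <= m)%N >-> n <= m}.
  apply/nondecreasing_seqP => n; rewrite /G big_ord_recr/= lerDl.
  by rewrite mulr_ge0// ltW// mult_gt0.
have Gl N : G N <= l.
  have /cvg_lim <- // := H; apply: nondecreasing_cvgn_le => //; apply/cvg_ex; exists l; exact: H.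
pose P N := \sum_(n < N) g n.
have Pnd : {homo P : n m / (n <= m)%N >-> n <= m}.
  by apply/nondecreasing_seqP => n; rewrite /P big_ord_recr/= lerDl.
have PG N : P N <= G N.
  apply: ler_sum => n _; rewrite ler_peMl//.
  by case: (nat_of_ord n) => //= k; rewrite ler1n.
have Pcvg : P @ \oo --> lim (P @ \oo).
  apply: nondecreasing_is_cvgn => //; exists l => _ [N _ <-]; exact: le_trans (PG N) (Gl N).
set p := lim _ in Pcvg.
have Qcvg : (fun N => \sum_(n < N) g n.+1) @ \oo --> p - g 0%N.
  rewrite (_ : (fun N => _) = fun N => P N.+1 - g 0%N); last first.
    by apply/funext => N; rewrite /P big_ord_recl/= addrC addKr; apply: eq_bigr.
  by apply: cvgB; [rewrite -(cvg_shiftS P) in Pcvg; exact: Pcvg|exact: cvg_cst].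
have E : l = p + (p - g 0%N).
  have : (fun N => G N.+1) @ \oo --> p + (p - g 0%N).
    rewrite (_ : (fun N => _) = fun N => P N.+1 + \sum_(n < N) g n.+1); last first.
      apply/funext => N; rewrite /G /P !big_ord_recl/= -addrA -big_split/= mul1r.
      by congr (_ + _); apply: eq_bigr => i _; rewrite /bump /=; ring.
    by apply: cvgD => //; rewrite -(cvg_shiftS P) in Pcvg; exact: Pcvg.
  have : (fun N => G N.+1) @ \oo --> l by rewrite -(cvg_shiftS G) in H; exact: H.
  by move=> /cvg_lim <- // /cvg_lim <-.
rewrite (esumID (range Posz)) => [|i _]; last by rewrite lee_fin.
have -> : [set: int] `&` range Posz = [set Posz n | n in [set: nat]] by rewrite setTI.
have -> : [set: int] `&` ~` range Posz = [set Negz n | n in [set: nat]].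
  rewrite setTI; apply/seteqP; split => [[n|n]|_ [n _ <-] [m _]] //=; last by move=> _; exists n.
  by move=> H1; exfalso; apply: H1; exists n.
rewrite !esum_set_image; try by move=> *; rewrite lee_fin.
- rewrite [X in (X + _)%E](_ : _ = \sum_(n <oo) (g n)%:E)%E; last first.
    by congr (limn _); apply/funext => N; apply: eq_bigl => i; rewrite in_setT.
  rewrite [X in (_ + X)%E](_ : _ = \sum_(n <oo) (g n.+1)%:E)%E; last first.
    by congr (limn _); apply/funext => N; apply: eq_bigl => i; rewrite in_setT.
  rewrite (esum_nat_series (fun n => g0 n) Pcvg) (esum_nat_series (fun n => g0 n.+1) Qcvg).
  by rewrite -EFinD E.
- by move=> i j _ _ [].
- by move=> i j _ _ [].
Qed.

End IntegerSums.

(** * Convergence of the two-sided Fourier series *)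

Section TwoSidedSeries.
Context {R : realType}.
Local Open Scope complex_scope.
Notation I := circle_int.

Lemma circleC1N (f f' : R -> R) : circleC1 f f' -> circleC1 (fun x => - f x) (fun x => - f' x).
Proof.
move=> /(circleC1Z (-1)); rewrite (_ : (fun x => -1 * f x) = fun x => - f x).
  by rewrite (_ : (fun x => -1 * f' x) = fun x => - f' x)//; apply/funext => x; rewrite mulN1r.
by apply/funext => x; rewrite mulN1r.
Qed.

Lemma circleC1B (f f' g g' : R -> R) : circleC1 f f' -> circleC1 g g' ->
  circleC1 (fun x => f x - g x) (fun x => f' x - g' x).
Proof. by move=> cf /circleC1N; exact: circleC1D. Qed.

Lemma fourier_mode_Posz n (x : R) : fourier_mode (Posz n) x = cosn n x +i* sinn n x.
Proof. by rewrite /fourier_mode /cosn /sinn. Qed.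

Lemma fourier_mode_Negz n (x : R) : fourier_mode (Negz n) x = cosn n.+1 x +i* - sinn n.+1 x.
Proof. by rewrite /fourier_mode /cosn /sinn NegzE mulrNz mulrN mulNr cosN sinN. Qed.

Lemma fourier_weightE (n : int) : fourier_weight n = weight `|n|%N :> R.
Proof.
rewrite /fourier_weight /weight; apply: eq_bigr => k _; congr (_ ^+ _).
have -> : freq `|n|%N ^+ 2 = (4 * pi ^+ 2 * (`|n|%N%:R) ^+ 2 : R) by rewrite /freq; ring.
by congr (_ * _); case: n => // n; rewrite NegzE mulrNz sqrrN.
Qed.

Lemma fourier_partial_sum_split (a : int -> R[i]) M N x :
  fourier_partial_sum a M N x =
  \sum_(k < M) a (Negz k) * fourier_mode (Negz k) x +
  \sum_(k < N.+1) a (Posz k) * fourier_mode (Posz k) x.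
Proof.
rewrite /fourier_partial_sum -addnS big_split_ord/=; congr (_ + _).
  rewrite (reindex_inj rev_ord_inj)/=; apply: eq_bigr => k _.
  have -> : (M - k.+1)%N%:Z - M%:Z = Negz k by rewrite -subzn// NegzE; ring.
  by [].
by apply: eq_bigr => k _; have -> : (M + k)%N%:Z - M%:Z = k by rewrite PoszD; ring.
Qed.

(** The quarter-turn of the coefficients of a mode gives its conjugate mode. *)
Definition conj_coef (c : R * R) : R * R := (- c.2, c.1).

Lemma complex_sum n (f g : 'I_n -> R) :
  \sum_k (f k +i* g k) = (\sum_k f k) +i* (\sum_k g k) :> R[i].
Proof.
elim: n f g => [|n IH] f g; first by rewrite !big_ord0.
by rewrite !big_ord_recr/= IH.
Qed.

Lemma fourier_partial_sumE (a : int -> R[i]) (p : nat -> R * R) M N x :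
  (forall n, a (Posz n) = (p n).1 -i* (p n).2) ->
  (forall n, a (Negz n) = (p n.+1).1 +i* (p n.+1).2) ->
  fourier_partial_sum a M N x =
  (\sum_(k < M) dmode 0 k.+1 (p k.+1) x + \sum_(k < N.+1) dmode 0 k (p k) x) +i*
  (\sum_(k < N.+1) dmode 0 k (conj_coef (p k)) x -
   \sum_(k < M) dmode 0 k.+1 (conj_coef (p k.+1)) x).
Proof.
move=> ap an; rewrite fourier_partial_sum_split.
rewrite (eq_bigr (fun k : 'I_M => dmode 0 k.+1 (p k.+1) x +i*
  - dmode 0 k.+1 (conj_coef (p k.+1)) x)); last first.
  by move=> k _; rewrite an fourier_mode_Negz /dmode /mode /=; simpc; congr (_ +i* _); ring.
rewrite (eq_bigr (fun k : 'I_N.+1 => dmode 0 k (p k) x +i*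
  dmode 0 k (conj_coef (p k)) x)); last first.
  by move=> k _; rewrite ap fourier_mode_Posz /dmode /mode /=; simpc; congr (_ +i* _); ring.
by rewrite !complex_sum; simpc; rewrite sumrN; congr (_ +i* _); ring.
Qed.

Lemma dmode_zero j c x : c.1 = 0 -> dmode j 0 c x = 0 :> R.
Proof.
move=> c1; rewrite /dmode /mode cosn0 sinn0.
suff -> : (iter j (rotc (freq 0)) c).1 = 0 by ring.
by case: j => // j; rewrite iterS /rotc /= /freq mulr0 mul0r.
Qed.

Lemma norm1_conj_coef c : norm1 (conj_coef c) = norm1 c :> R.
Proof. by rewrite /norm1 /conj_coef /= normrN addrC. Qed.

Lemma sum_shift (F : nat -> R) N : \sum_(k < N) F k.+1 = \sum_(k < N.+1) F k - F 0%N.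
Proof. by rewrite big_ord_recl addrC addKr. Qed.

(** The real part of a two-sided partial sum is the mean of two one-sided
    partial sums of T; its imaginary part is the difference of two partial sums
    of the conjugate series, which converges by the same bounds. *)
Lemma two_sided_fourier_sum (a : int -> R[i]) (p : nat -> R * R) (T : nat -> R -> R) (M : R) :
  (forall n, a (Posz n) = (p n).1 -i* (p n).2) ->
  (forall n, a (Negz n) = (p n.+1).1 +i* (p n.+1).2) ->
  (p 0%N).2 = 0 ->
  (forall j, (j <= 4)%N -> forall n, freq n ^+ j * norm1 (p n) * (1 + freq n ^+ 2) <= M) ->
  (forall j, (j < 4)%N -> circleC1 (T j) (T j.+1)) ->
  (forall j, (j <= 4)%N -> forall N x,
     `|\sum_(n < N) mult n * dmode j n (p n) x - T j x| <= 6 * M / N.+1%:R) ->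
  is_fourier_sum a (cplx (T 0%N)).
Proof.
move=> ap an p02 pM TC TM.
have M0 : 0 <= M.
  apply: le_trans (pM 0%N isT 0%N).
  by rewrite expr0 mul1r mulr_ge0 ?norm1_ge0// addr_ge0// sqr_ge0.
pose q n := conj_coef (p n).
have H j : exists F : R -> R, (j <= 4)%N -> forall N x,
    `|\sum_(n < N) dmode j n (q n) x - F x| <= 6 * M / N.+1%:R.
  have [j4|] := boolP (j <= 4)%N; last by exists (fun=> 0).
  have [n|F HF] := @mode_series _ j q M; last by exists F.
  by rewrite norm1_conj_coef; exact: pM.
pose re_part j (MN : nat * nat) x :=
  \sum_(k < MN.1) dmode j k.+1 (p k.+1) x + \sum_(k < MN.2.+1) dmode j k (p k) x.
pose im_part j (MN : nat * nat) x :=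
  \sum_(k < MN.2.+1) dmode j k (q k) x - \sum_(k < MN.1) dmode j k.+1 (q k.+1) x.
pose r (MN : nat * nat) : R := 6 * M / MN.1.+1%:R + 6 * M / MN.2.+1%:R.
have tail n : 6 * M / n.+2%:R <= 6 * M / n.+1%:R.
  by rewrite ler_wpM2l ?mulr_ge0// lef_pV2 ?posrE// ler_nat.
have re_bound j MN x : (j <= 4)%N -> `|T j x - re_part j MN x| <= r MN.
  move=> j4; pose P N := \sum_(n < N) mult n * dmode j n (p n) x - T j x.
  have PE N : P N.+1 = 2 * \sum_(n < N.+1) dmode j n (p n) x - dmode j 0 (p 0%N) x - T j x.
    rewrite /P; congr (_ - _); rewrite !big_ord_recl/= mul1r mulrDr mulr_sumr; ring.
  have -> : T j x - re_part j MN x = - (P MN.1.+1 + P MN.2.+1) / 2.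
    rewrite !PE /re_part (sum_shift (fun k => dmode j k (p k) x)); by field.
  rewrite normrM normrN (ger0_norm (_ : 0 <= 2^-1)) ?invr_ge0//.
  apply: (@le_trans _ _ (`|P MN.1.+1| + `|P MN.2.+1|)).
    apply: le_trans (ler_normD _ _); rewrite ler_pdivrMr//.
    by rewrite ler_peMr ?ler1n.
  by apply: lerD; apply: le_trans (TM j j4 _ x) _; exact: tail.
have im_bound j MN x : (j <= 4)%N -> `|im_part j MN x| <= r MN.
  move=> j4; have [F HF] := H j; have {}HF := HF j4.
  have -> : im_part j MN x = (\sum_(n < MN.2.+1) dmode j n (q n) x - F x) -
      (\sum_(n < MN.1.+1) dmode j n (q n) x - F x).
    rewrite /im_part (sum_shift (fun k => dmode j k (q k) x)).
    by rewrite (dmode_zero j (c := q 0%N)) ?oppr_eq0 ?p02 ?/q /= ?p02 ?oppr0//; ring.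
  apply: le_trans (ler_normB _ _) _; rewrite /r addrC.
  by apply: lerD; apply: le_trans (HF _ x) _; exact: tail.
have re_C1 MN j : circleC1 (re_part j MN) (re_part j.+1 MN).
  apply: circleC1D; last exact: (partial_sum_C1 j p).
  by apply: (@circleC1_sum _ _ (fun k => dmode j k.+1 (p k.+1)) (fun k => dmode j.+1 k.+1 (p k.+1))) => k;
    exact: circleC1_dmode.
have im_C1 MN j : circleC1 (fun x => - im_part j MN x) (fun x => - im_part j.+1 MN x).
  apply: circleC1N; apply: circleC1B; first exact: (partial_sum_C1 j q).
  by apply: (@circleC1_sum _ _ (fun k => dmode j k.+1 (q k.+1)) (fun k => dmode j.+1 k.+1 (q k.+1))) => k;
    exact: circleC1_dmode.
have err_C1 MN j : (j < 4)%N -> circleC1 (fun x => T j x - re_part j MN x)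
    (fun x => T j.+1 x - re_part j.+1 MN x).
  by move=> j4; apply: circleC1B; [exact: TC|exact: re_C1].
have r0 MN : 0 <= r MN by rewrite addr_ge0// divr_ge0// mulr_ge0.
have norm_bound MN :
    H_norm 4 (fun x => cplx (T 0%N) x - fourier_partial_sum a MN.1 MN.2 x) <= 4 * r MN.
  rewrite (_ : (fun x => _) = fun x => (T 0%N x - re_part 0%N MN x) +i* - im_part 0%N MN x); last first.
    apply/funext => x; rewrite (fourier_partial_sumE _ _ _ ap an) /cplx /re_part /im_part.
    by simpc.
  rewrite (H_norm_classical (a := fun j x => T j x - re_part j MN x)
    (b := fun j x => - im_part j MN x) (err_C1 MN)) => [|j _]; last exact: im_C1.
  rewrite -[leRHS]ger0_norm ?mulr_ge0// -sqrtr_sqr.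
  apply: ler_wsqrtr.
  apply: (@le_trans _ _ (\sum_(j < 5) (2 * r MN ^+ 2))); last first.
    rewrite !big_ord_recr big_ord0 /= exprMn; have := sqr_ge0 (r MN).
    by move: (r MN ^+ 2) => z z0; lra.
  apply: ler_sum => j _; apply: le_trans (ler_norm _) _.
  have j4 : (j <= 4)%N by rewrite -ltnS.
  have sq (y z : R) : `|y| <= z -> y ^+ 2 <= z ^+ 2.
    by move=> yz; rewrite -[y ^+ 2]ger0_norm ?sqr_ge0// normrX lerXn2r ?nnegrE// (le_trans _ yz).
  apply: norm_circle_int_bounded => [|x _].
    have ce : continuous (fun x => T j x - re_part j MN x).
      case: (nat_of_ord j) j4 => [_|i i4]; first exact: circleC1_continuous (err_C1 MN 0%N isT).
      by have [] := err_C1 MN i i4.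
    have ci := circleC1_continuous (im_C1 MN j).
    by apply: continuous_measurableU; apply: continuousDR; apply: continuousMR.
  rewrite ger0_norm ?addr_ge0 ?sqr_ge0// mulr2n mulrDl !mul1r; apply: lerD; apply: sq.
    exact: re_bound.
  by rewrite normrN; exact: im_bound.
have hM := harmonic_bound_cvg M.
have r_cvg : r MN @[MN --> filter_prod \oo \oo] --> (0 : R).
  rewrite -[0]addr0; apply: cvgD.
    exact: (cvg_comp _ _ (cvg_fst (G := \oo)) hM).
  exact: (cvg_comp _ _ (cvg_snd (F := \oo)) hM).
rewrite /is_fourier_sum; apply: (@squeeze_cvgr _ _ _ _ (fun=> 0) (fun MN => 4 * r MN)).
- by apply: nearW => MN; rewrite norm_bound andbT /H_norm sqrtr_ge0.
- exact: cvg_cst.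
- by rewrite -(mulr0 4); apply: cvgM; [exact: cvg_cst|exact: r_cvg].
Qed.

End TwoSidedSeries.

(** * Maximisation over the unit ball *)

Section Maximiser.
Context {R : realType}.
Local Open Scope complex_scope.
Notation mu := (@lebesgue_measure R).
Notation I := circle_int.
Notation intg := circle_integrable.
Notation U01 := (`[0%R, 1%R]%classic : set (measurableTypeR R)).

Lemma circle_int_eq0 (g : R -> R) : intg g -> (forall x, 0 <= g x) -> I g = 0 ->
  ae_unit (fun x => g x = 0).
Proof.
move=> ig g0 I0; have mg := measurable_int _ ig.
have E : (\int[mu]_(x in `[0%R, 1%R]) `|(EFin \o g) x| = 0)%E.
  transitivity (\int[mu]_(x in `[0%R, 1%R]) (EFin \o g) x)%E.
    by apply: eq_integral => x _; rewrite /= ger0_norm.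
  have h : I g = 0 := I0; rewrite /circle_int /Rintegral in h.
  have fin := integrable_fin_num measurable_unit ig.
  by rewrite -[LHS](fineK fin) h.
have [/(_ E) H _] := @ae_eq_integral_abs _ _ R mu `[0%R, 1%R] measurable_unit _ mg.
by apply: ae_imply H => x H x01; have [] := H x01.
Qed.

(** T is the chain of derivatives of the candidate, a unit vector of H4, and [dot]
    is kappa times the inner product with it. *)
Context (T : nat -> R -> R) (kappa : R) (dot : (R -> R) -> R[i]).
Context (kappa_gt0 : 0 < kappa) (TC : forall j, (j < 4)%N -> circleC1 (T j) (T j.+1)).
Context (T_norm : \sum_(j < 5) I (fun x => T j x ^+ 2) = 1).
Context (dotE : forall f : nat -> R -> R,
  (forall j, (j < 4)%N -> real_weak_derivative (f j) (f j.+1)) ->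
  dot (f 0%N) = (kappa * \sum_(j < 5) I (fun x => f j x * T j x))%:C).

Lemma chain_continuous_periodic j : (j <= 4)%N -> continuous (T j) /\ periodic (T j) 1.
Proof.
case: j => [_|j j4]; last by have [_ c _] := TC j4; split => //; exact: circleC1_periodic (TC j4).
by have [_ _ p] := TC (isT : 0 < 4)%N; split => //; exact: circleC1_continuous (TC (isT : 0 < 4)%N).
Qed.

Lemma H_norm_chain : H_norm 4 (cplx (T 0%N)) = 1.
Proof.
have c0 j : (j < 4)%N -> @circleC1 R (fun=> 0) (fun=> 0) by move=> _; exact: circleC1_cst.
have := H_norm_classical TC (b := fun _ _ => 0) c0; rewrite -[X in H_norm 4 X]/(cplx (T 0%N)) => ->.
rewrite -[RHS]sqrtr1 -T_norm; congr Num.sqrt; apply: eq_bigr => j _.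
by apply: eq_circle_int => x; rewrite expr0n addr0.
Qed.

(** Expanding the squared distance to the unit vector T yields both the bound of
    the inner product with T by 1 on the unit ball and its case of equality. *)
Lemma chain_distance (f : nat -> R -> R) :
  (forall j, (j < 4)%N -> real_weak_derivative (f j) (f j.+1)) ->
  (forall j, (j <= 4)%N -> intg (fun x => f j x ^+ 2)) ->
  (forall j, (j <= 4)%N -> intg (fun x => (f j x - T j x) ^+ 2)) /\
  \sum_(j < 5) I (fun x => (f j x - T j x) ^+ 2) =
    \sum_(j < 5) I (fun x => f j x ^+ 2) - 2 * (\sum_(j < 5) I (fun x => f j x * T j x)) + 1.
Proof.
move=> fw f2.
have ft j : (j <= 4)%N -> intg (fun x => f j x * T j x).
  move=> j4; have [c p] := chain_continuous_periodic j4.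
  have L : circleL1 (f j).
    by case: j j4 {c p} => [|j] j4; [have [] := fw 0%N isT|have [] := fw j j4].
  by have [] := circleL1M L c p.
have t2 j : (j <= 4)%N -> intg (fun x => T j x ^+ 2).
  move=> j4; have [c _] := chain_continuous_periodic j4.
  by apply: continuous_integrable; exact: continuousMR.
have e j x : (f j x - T j x) ^+ 2 = f j x ^+ 2 + (-2 * (f j x * T j x) + T j x ^+ 2) by ring.
have g2 j : (j <= 4)%N -> intg (fun x => -2 * (f j x * T j x) + T j x ^+ 2).
  by move=> j4; apply: circle_integrableD (t2 j j4); apply: circle_integrableZ; exact: ft.
split=> [j j4|].
  apply: (eq_circle_integrable (f := fun x => f j x ^+ 2 + (-2 * (f j x * T j x) + T j x ^+ 2))) => [x|].
    by rewrite e.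
  by apply: circle_integrableD; [exact: f2|exact: g2].
rewrite -[X in _ = _ + X]T_norm mulr_sumr -sumrN -!big_split/=; apply: eq_bigr => j _.
have j4 : (j <= 4)%N by rewrite -ltnS.
rewrite (eq_circle_int (e j)) circle_intD; [|exact: f2|exact: g2].
rewrite circle_intD; [|exact/circle_integrableZ/ft|exact: t2].
by rewrite circle_intZ; [ring|exact: ft].
Qed.

Lemma chain_inner_le1 (f : nat -> R -> R) :
  (forall j, (j < 4)%N -> real_weak_derivative (f j) (f j.+1)) ->
  (forall j, (j <= 4)%N -> intg (fun x => f j x ^+ 2)) ->
  \sum_(j < 5) I (fun x => f j x ^+ 2) <= 1 ->
  \sum_(j < 5) I (fun x => f j x * T j x) <= 1.
Proof.
move=> fw f2 f1; have [_ e] := chain_distance fw f2.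
have : 0 <= \sum_(j < 5) I (fun x => (f j x - T j x) ^+ 2).
  by apply: sumr_ge0 => j _; apply: circle_int_ge0 => x; exact: sqr_ge0.
rewrite e; lra.
Qed.

Lemma chain_inner_eq1 (f : nat -> R -> R) :
  (forall j, (j < 4)%N -> real_weak_derivative (f j) (f j.+1)) ->
  (forall j, (j <= 4)%N -> intg (fun x => f j x ^+ 2)) ->
  \sum_(j < 5) I (fun x => f j x ^+ 2) <= 1 ->
  1 <= \sum_(j < 5) I (fun x => f j x * T j x) -> ae_equal (f 0%N) (T 0%N).
Proof.
move=> fw f2 f1 f3; have [i e] := chain_distance fw f2.
have h0 : I (fun x => (f 0%N x - T 0%N x) ^+ 2) = 0.
  apply/eqP; rewrite eq_le circle_int_ge0 ?andbT => [|x]; last exact: sqr_ge0.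
  have : \sum_(j < 5) I (fun x => (f j x - T j x) ^+ 2) <= 0 by rewrite e; lra.
  apply: le_trans; rewrite big_ord_recl lerDl; apply: sumr_ge0 => j _.
  by apply: circle_int_ge0 => x; exact: sqr_ge0.
have [_ pT] := chain_continuous_periodic (isT : 0 <= 4)%N.
have [[pf _ _] _ _] := fw 0%N isT.
apply: ae_periodic => [x|]; first by rewrite pf pT.
have H := circle_int_eq0 (i 0%N isT) (fun x => sqr_ge0 _) h0.
by apply: ae_imply H => x H x01; have /eqP := H x01; rewrite sqrf_eq0 subr_eq0 => /eqP.
Qed.

Lemma chain_ae (f : nat -> R -> R) :
  (forall j, (j < 4)%N -> real_weak_derivative (f j) (f j.+1)) -> ae_equal (f 0%N) (T 0%N) ->
  forall j, (j <= 4)%N -> ae_equal (f j) (T j).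
Proof.
move=> fw e0; elim=> // j IH j4.
exact: real_weak_derivative_unique (fw j j4) (classical_real_weak_derivative (TC j4)) (IH (ltnW j4)).
Qed.

Lemma dot_chain : dot (T 0%N) = kappa%:C.
Proof.
rewrite (@dotE T) => [|j /TC]; last exact: classical_real_weak_derivative.
congr (_%:C); rewrite -[RHS]mulr1 -T_norm; congr (_ * _).
Qed.

Lemma unit_maximiser S : Sobolev 4 2 (cplx S) -> (maximiser dot S <-> ae_equal S (T 0%N)).
Proof.
move=> HS; have [f [f0 fw f2 fN]] := Sobolev_real_chain HS.
have sum_ge0 (g : nat -> R -> R) : 0 <= \sum_(j < 5) I (fun x => g j x ^+ 2).
  by apply: sumr_ge0 => j _; apply: circle_int_ge0 => x; exact: sqr_ge0.
have sqrt_le1 (y : R) : 0 <= y -> (Num.sqrt y <= 1) = (y <= 1).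
  by move=> y0; rewrite -[X in _ <= X]sqrtr1 ler_psqrt ?nnegrE.
split=> [[_ S1 Smax]|ST].
  have := Smax (T 0%N) (Sobolev_classical TC); rewrite H_norm_chain lexx => /(_ isT).
  rewrite dot_chain -f0 (dotE fw) lecR -[X in X <= _]mulr1 ler_pM2l// => h.
  by apply: chain_inner_eq1 => //; move: S1; rewrite fN sqrt_le1.
have fT := chain_ae fw; rewrite f0 in fT; have {}fT := fT ST.
have Lf j : (j <= 4)%N -> circleL1 (f j).
  by case: j => [|j] j4; [have [] := fw 0%N isT|have [] := fw j j4].
have mf j : (j <= 4)%N -> measurable_fun U01 (f j).
  by move=> /Lf[_ m _]; exact: measurable_funU.
have mT j : (j <= 4)%N -> measurable_fun U01 (T j).
  by move=> /chain_continuous_periodic[c _]; exact: continuous_measurableU.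
have nf : \sum_(j < 5) I (fun x => f j x ^+ 2) = 1.
  rewrite -T_norm; apply: eq_bigr => j _; have j4 : (j <= 4)%N by rewrite -ltnS.
  apply: circle_int_ae; [by apply: measurable_funX; exact: mf|by apply: measurable_funX; exact: mT|].
  by apply: ae_to_unit; apply: ae_imply (fT _ j4) => x ->.
have df : dot S = kappa%:C.
  rewrite -f0 (dotE fw); congr (_%:C); rewrite -[RHS]mulr1 -T_norm; congr (_ * _).
  apply: eq_bigr => j _; have j4 : (j <= 4)%N by rewrite -ltnS.
  apply: circle_int_ae; [by apply: measurable_funM; [exact: mf|exact: mT]|by apply: measurable_funX; exact: mT|].
  by apply: ae_to_unit; apply: ae_imply (fT _ j4) => x ->; rewrite expr2.
split=> //; first by rewrite fN nf sqrtr1.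
move=> S' HS' S'1; have [g [g0 gw g2 gN]] := Sobolev_real_chain HS'.
rewrite df -g0 (dotE gw) lecR -[X in _ <= X]mulr1 ler_pM2l//.
by apply: chain_inner_le1 => //; move: S'1; rewrite gN sqrt_le1.
Qed.

End Maximiser.

(** * The optimal perturbation *)

(** What remains of the dynamics is a real functional J of two derivatives and the
    two formulas that express the response and its complex extension by J. *)
Section OptimalResponse.
Context {R : realType}.
Local Open Scope complex_scope.
Notation mu := (@lebesgue_measure R).
Notation I := circle_int.
Notation intg := circle_integrable.
Context (J : (R -> R) -> (R -> R) -> (R -> R) -> R).
Context (J_lin : forall (x y : R) s s1 s2 t t1 t2, circleC1 s s1 -> circleC1 s1 s2 ->
  circleC1 t t1 -> circleC1 t1 t2 ->
  J (fun z => x * s z + y * t z) (fun z => x * s1 z + y * t1 z) (fun z => x * s2 z + y * t2 z) =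
  x * J s s1 s2 + y * J t t1 t2).
Context (J_bound : exists C : R, 0 <= C /\ forall s s1 s2 (B : R),
  circleC1 s s1 -> circleC1 s1 s2 -> (forall x, `|s x| <= B) -> (forall x, `|s1 x| <= B) ->
  (forall x, `|s2 x| <= B) -> `|J s s1 s2| <= C * B).
Context (dot : (R -> R) -> R[i]) (formula : (R -> R[i]) -> R[i]).
Context (dotE : forall S s s1 s2 : R -> R, periodic S 1 -> measurable_fun setT S ->
  circleC1 s s1 -> circleC1 s1 s2 -> {ae mu, forall x, S x = s x} -> dot S = (J s s1 s2)%:C).
Context (formulaE : forall (h : R -> R[i]) (a a1 a2 b b1 b2 : R -> R), measurable_periodic h ->
  circleC1 a a1 -> circleC1 a1 a2 -> circleC1 b b1 -> circleC1 b1 b2 ->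
  ae_equal h (fun x => a x +i* b x) -> formula h = J a a1 a2 -i* J b b1 b2).
Context (dot_neq0 : exists2 S : R -> R, Sobolev 4 2 (cplx S) & dot S != 0).

Notation A := (cos_response J).
Notation B := (sin_response J).
Let coef (nu : R) (n : int) := formula (fourier_mode n) / (2 * nu * fourier_weight n)%:C.
Let half_coef (kappa : R) n : R * R := (A n / (kappa * weight n), B n / (kappa * weight n)).

Let J0 : J (fun=> 0) (fun=> 0) (fun=> 0) = 0.
Proof.
have c0 := @circleC1_cst R 0; have := J_lin 0 0 c0 c0 c0 c0.
rewrite (_ : (fun=> 0 * 0 + 0 * 0) = fun=> 0).
  by rewrite mul0r addr0.
by apply/funext => x; rewrite mulr0 addr0.
Qed.

Let sin_response0 : B 0%N = 0.
Proof.
by rewrite -[RHS]J0 /sin_response /on_mode; congr J; apply/funext => x; exact: dmode_zero.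
Qed.

Let formula_mode n (y : R) :
  formula (fun x => cosn n x +i* (y * sinn n x)) = A n -i* (y * B n).
Proof.
rewrite (@formulaE _ (dmode 0 n (1, 0)) (dmode 1 n (1, 0)) (dmode 2 n (1, 0))
  (dmode 0 n (0, y)) (dmode 1 n (0, y)) (dmode 2 n (0, y))); try exact: circleC1_dmode.
- rewrite -/(on_mode J n (1, 0)) -/(on_mode J n (0, y)) !(on_modeE J_lin) /=.
  by congr (_ +i* _); ring.
- split.
  + move=> x; congr (_ +i* _); first exact: periodic_cosn.
    by congr (_ * _); exact: periodic_sinn.
  + by apply: continuous_measurable; exact: (@continuous_cosn R n).
  + by apply: continuous_measurable; apply: continuousZR; exact: (@continuous_sinn R n).
- by apply: ae_all => x; rewrite /dmode /mode /=; congr (_ +i* _); ring.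
Qed.

Let formula_Posz n : formula (fourier_mode (Posz n)) = A n -i* B n.
Proof.
rewrite -[B n]mul1r -formula_mode; congr formula; apply/funext => x.
by rewrite fourier_mode_Posz mul1r.
Qed.

Let formula_Negz n : formula (fourier_mode (Negz n)) = A n.+1 +i* B n.+1.
Proof.
rewrite -[B _]opprK -[- B _]mulN1r -formula_mode; congr formula; apply/funext => x.
by rewrite fourier_mode_Negz mulN1r.
Qed.

Let divcR (x y c : R) : (x +i* y) / c%:C = (x / c) +i* (y / c).
Proof.
have [->|c0] := eqVneq c 0; first by rewrite !invr0 !mulr0.
by rewrite -(rmorphV _) ?unitfE//; simpc.
Qed.

Let coef_Posz nu n : coef nu (Posz n) = (half_coef (2 * nu) n).1 -i* (half_coef (2 * nu) n).2.
Proof. by rewrite /coef formula_Posz divcR fourier_weightE /= mulNr. Qed.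

Let coef_Negz nu n : coef nu (Negz n) = (half_coef (2 * nu) n.+1).1 +i* (half_coef (2 * nu) n.+1).2.
Proof. by rewrite /coef formula_Negz divcR fourier_weightE. Qed.

Let energy n := (A n ^+ 2 + B n ^+ 2) / weight n.

Let energy_ge0 n : 0 <= energy n.
Proof. by rewrite divr_ge0 ?addr_ge0 ?sqr_ge0// ltW// weight_gt0. Qed.

Let coef_energy nu n : 0 < nu ->
  fourier_weight n * Normc.normc (coef nu n) ^+ 2 = energy `|n|%N / (2 * nu) ^+ 2.
Proof.
move=> nu0; rewrite fourier_weightE.
have -> : Normc.normc (coef nu n) ^+ 2 =
    (half_coef (2 * nu) `|n|%N).1 ^+ 2 + (half_coef (2 * nu) `|n|%N).2 ^+ 2.
  case: n => n; first by rewrite coef_Posz normc_sqr sqrrN.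
  by rewrite coef_Negz normc_sqr.
have w0 := lt0r_neq0 (@weight_gt0 R `|n|%N); have n0 := lt0r_neq0 nu0.
by rewrite /half_coef /energy /=; field; rewrite w0 n0.
Qed.

Lemma optimal_response :
  let a := coef in
  let normalised (nu : R) :=
    \esum_(n in [set: int])
      (fourier_weight n * Normc.normc (a nu n) ^+ 2)%:E = 1%E in
  (exists2 nu : R, 0 < nu & normalised nu) /\
  forall nu : R, 0 < nu -> normalised nu ->
    exists Tdot : R -> R,
      [/\ Sobolev 4 2 (cplx Tdot),
          is_fourier_sum (a nu) (cplx Tdot),
          H_norm 4 (cplx Tdot) = 1,
          forall S : R -> R, Sobolev 4 2 (cplx S) ->
            (maximiser dot S <-> ae_equal S Tdot) &
          dot Tdot = formula (cplx Tdot)].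
Proof.
move=> a normalised.
have [T [TC [M TM] Zlim Triesz]] := riesz_representative J_lin J_bound.
set Z := J _ _ _ in Zlim.
have Tweak j : (j < 4)%N -> real_weak_derivative (T j) (T j.+1).
  by move=> j4; exact: classical_real_weak_derivative (TC j j4).
have ZE : Z = \sum_(j < 5) I (fun x => T j x ^+ 2).
  have [s [s1 [s2 [Ts cs cs1 <- _]]]] := Triesz T Tweak.
  have [[pT mT _] _ _] := Tweak 0%N isT.
  have T1 := dotE pT mT (TC 0%N isT) (TC 1%N isT) (ae_all (fun x => erefl (T 0%N x))).
  by have := dotE pT mT cs cs1 Ts; rewrite T1 => -[].
have dot_chain_riesz f : (forall j, (j < 4)%N -> real_weak_derivative (f j) (f j.+1)) ->
    dot (f 0%N) = (\sum_(j < 5) I (fun x => f j x * T j x))%:C.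
  move=> fw; have [s [s1 [s2 [fs cs cs1 <- _]]]] := Triesz f fw.
  by have [[pf mf _] _ _] := fw 0%N isT; exact: dotE pf mf cs cs1 fs.
have term_ge0 n : 0 <= mult n * energy n by rewrite mulr_ge0// ltW// mult_gt0.
have {}Zlim : (fun N => \sum_(n < N) mult n * energy n) @ \oo --> Z.
  by under eq_fun do under eq_bigr do rewrite mulrA.
have Zpos : 0 < Z.
  rewrite lt_neqAle; apply/andP; split; last first.
    have /cvg_lim <- // := Zlim; apply: limr_ge; first by apply/cvg_ex; exists Z.
    by apply: nearW => N; exact: sumr_ge0.
  apply/eqP => Z0; have [S /Sobolev_real_chain[f [<- fw _ _]] /eqP] := dot_neq0; apply.
  (* A vanishing limit of a nondecreasing sequence of partial sums kills every term. *)
  have energy0 n : energy n = 0.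
    have : mult n * energy n <= 0.
      apply: (@le_trans _ _ (\sum_(k < n.+1) mult k * energy k)).
        by rewrite big_ord_recr/= lerDr sumr_ge0.
      pose P N := \sum_(k < N) mult k * energy k.
      have P_nd : {homo P : k l / (k <= l)%N >-> k <= l}.
        by apply/nondecreasing_seqP => k; rewrite /P big_ord_recr/= lerDl.
      have Plim : P @ \oo --> Z := Zlim.
      have Pcvg : cvgn P by apply/cvg_ex; exists Z.
      have := nondecreasing_cvgn_le P_nd Pcvg n.+1.
      by move/cvg_lim : Plim => -> //; rewrite -Z0.
    by rewrite pmulr_rle0 ?mult_gt0// => e; apply/eqP; rewrite eq_le e energy_ge0.
  have AB0 n : A n = 0 /\ B n = 0.
    have /eqP := energy0 n; rewrite /energy mulf_eq0 invr_eq0 (negPf (lt0r_neq0 (weight_gt0 n))) orbF.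
    by rewrite paddr_eq0 ?sqr_ge0// !sqrf_eq0 => /andP[/eqP-> /eqP->].
  have [s [s1 [s2 [fs cs cs1 _ lim]]]] := Triesz f fw.
  have [[pf mf _] _ _] := fw 0%N isT; rewrite (dotE pf mf cs cs1 fs).
  move/cvg_lim : lim => <- //.
  rewrite (_ : (fun N => _) = fun=> 0); first by rewrite lim_cst.
  apply/funext => N; apply: big1 => n _; have [-> ->] := AB0 n; ring.
have normalisedE nu : 0 < nu -> normalised nu <-> (2 * nu) ^+ 2 = Z.
  move=> nu0; rewrite /normalised.
  have k0 : 0 < (2 * nu) ^+ 2 by rewrite exprn_gt0// mulr_gt0.
  rewrite (eq_esum (b := fun n => (energy `|n|%N / (2 * nu) ^+ 2)%:E)) => [|n _]; last first.
    by rewrite coef_energy.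
  rewrite (@esum_int_absz _ (fun n => energy n / (2 * nu) ^+ 2) (Z / (2 * nu) ^+ 2)).
  - split=> [[] /(congr1 ( *%R^~ ((2 * nu) ^+ 2)))|<-]; last by rewrite divff ?lt0r_neq0.
    by rewrite divfK ?lt0r_neq0// mul1r.
  - by move=> n; rewrite divr_ge0 ?energy_ge0// ltW.
  - rewrite (_ : (fun N => _) = fun N => (\sum_(n < N) mult n * energy n) / (2 * nu) ^+ 2).
      by apply: cvgM => //; exact: cvg_cst.
    by apply/funext => N; rewrite big_distrl/=; apply: eq_bigr => n _; rewrite mulrA.
split.
  have sZ : 0 < Num.sqrt Z / 2 by rewrite divr_gt0// sqrtr_gt0.
  exists (Num.sqrt Z / 2) => //; apply/(normalisedE _ sZ).
  by rewrite mulrC divfK// sqr_sqrtr// ltW.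
move=> nu nu0 /(normalisedE nu nu0) nuZ; set kappa := 2 * nu in nuZ *.
have kappa0 : 0 < kappa by rewrite mulr_gt0.
have kn := lt0r_neq0 kappa0.
pose U j x := kappa^-1 * T j x.
have UC j : (j < 4)%N -> circleC1 (U j) (U j.+1) by move=> j4; apply: circleC1Z; exact: TC.
have Tcont j : (j <= 4)%N -> continuous (T j) /\ periodic (T j) 1.
  by move=> j4; exact: (chain_continuous_periodic TC j4).
have U_norm : \sum_(j < 5) I (fun x => U j x ^+ 2) = 1.
  rewrite (eq_bigr (fun j : 'I_5 => kappa ^- 2 * I (fun x => T j x ^+ 2))) => [|j _].
    by rewrite -mulr_sumr -ZE -nuZ mulVf// expf_neq0.
  have [c _] := Tcont j (ltn_ord j).
  rewrite -circle_intZ; last by apply: continuous_integrable; exact: continuousMR.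
  by apply: eq_circle_int => x; rewrite /U exprMn exprVn.
have dotU f : (forall j, (j < 4)%N -> real_weak_derivative (f j) (f j.+1)) ->
    dot (f 0%N) = (kappa * \sum_(j < 5) I (fun x => f j x * U j x))%:C.
  move=> fw; rewrite dot_chain_riesz//; congr (_%:C); rewrite mulr_sumr; apply: eq_bigr => j _.
  have [c p] := Tcont j (ltn_ord j).
  have L : circleL1 (f j).
    by case: j c p => -[|j] j4 c p /=; [have [] := fw 0%N isT|have [] := fw j j4].
  rewrite (_ : I (fun x => f j x * U j x) = kappa^-1 * I (fun x => f j x * T j x)).
    by rewrite mulVKf.
  rewrite -circle_intZ; last by have [] := circleL1M L c p.
  by apply: eq_circle_int => x; rewrite /U; ring.
exists (U 0%N); split.
- exact: Sobolev_classical UC.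
- have [M' HM'] := optimal_coef_bound J_bound.
  have mult_ge1 n : 1 <= mult n :> R by case: n => //= n; rewrite ler1n.
  have wn n := lt0r_neq0 (@weight_gt0 R n).
  have half_coefE n : optimal_coef J n =
      (kappa * mult n * (half_coef kappa n).1, kappa * mult n * (half_coef kappa n).2).
    by rewrite /optimal_coef /half_coef /=; congr (_, _); field; rewrite kn wn.
  apply: (@two_sided_fourier_sum _ _ (half_coef kappa) U (Num.max (M' / kappa) (M / kappa))) => //.
  + by rewrite /half_coef /= sin_response0 mul0r.
  + move=> j j4 n; rewrite le_max; apply/orP; left; rewrite ler_pdivlMr//.
    apply: le_trans (HM' j j4 n); have km : 0 < kappa * mult n by rewrite mulr_gt0// mult_gt0.
    have -> : norm1 (optimal_coef J n) = kappa * mult n * norm1 (half_coef kappa n).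
      by rewrite half_coefE /norm1 /= !(normrM (kappa * mult n)) (gtr0_norm km) mulrDr.
    have w0 : 0 <= freq n ^+ j :> R by rewrite exprn_ge0// freq_ge0.
    have s0 : 0 <= 1 + freq n ^+ 2 :> R by rewrite addr_ge0// sqr_ge0.
    have h0 := norm1_ge0 (half_coef kappa n); have m1 := mult_ge1 n.
    apply: (@le_trans _ _ (freq n ^+ j * (kappa * norm1 (half_coef kappa n)) * (1 + freq n ^+ 2))).
      by rewrite [leLHS](_ : _ = freq n ^+ j * (kappa * norm1 (half_coef kappa n)) * (1 + freq n ^+ 2)) //; ring.
    apply: (ler_wpM2r s0); apply: (ler_wpM2l w0); apply: (ler_wpM2r h0).
    by rewrite ler_peMr// ltW.
  + move=> j j4 N x; have := TM j j4 N x.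
    have -> : \sum_(n < N) mult n * dmode j n (half_coef kappa n) x - U j x =
        kappa^-1 * (\sum_(n < N) dmode j n (optimal_coef J n) x - T j x).
      rewrite mulrBr mulr_sumr; congr (_ - _); apply: eq_bigr => n _.
      by rewrite half_coefE dmode_scale mulrA mulKf.
    move=> h; rewrite normrM (gtr0_norm (_ : 0 < kappa^-1)) ?invr_gt0//.
    apply: (@le_trans _ _ (kappa^-1 * (6 * M / N.+1%:R))).
      by rewrite ler_wpM2l// invr_ge0 ltW.
    have n0 : 0 <= (N.+1%:R)^-1 :> R by rewrite invr_ge0.
    rewrite mulrA (ler_wpM2r n0)// mulrCA ler_wpM2l// mulrC le_max lexx orbT//.
- exact: H_norm_chain UC U_norm.
- move=> S HS; exact: (unit_maximiser kappa0 UC U_norm dotU HS).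
- have [[pU mU _] _ _] := classical_real_weak_derivative (UC 0%N isT).
  rewrite (dotE pU mU (UC 0%N isT) (UC 1%N isT) (ae_all (fun x => erefl (U 0%N x)))).
  have c0 := @circleC1_cst R 0.
  rewrite (formulaE (measurable_periodic_cplx pU mU) (UC 0%N isT) (UC 1%N isT) c0 c0); last exact: ae_all.
  by rewrite J0 oppr0.
Qed.

End OptimalResponse.

(** * The theorem *)

Local Open Scope complex_scope.

Theorem theorem11 (R : realType) (tau : R -> R) (alpha lambda0 : R)
  (phi : (R -> R[i]) -> R[i]) (v0 : R -> R[i]) (phi0 : R -> R)
  (tau_lift : circle_lift tau)
  (A0 : C_class 4 tau)
  (alpha01 : 0 < alpha < 1)
  (A1 : forall x, alpha^-1 <= `|derive1 tau x|)
  (lambda0_gt : alpha < lambda0)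
  (lambda0_simple : simple_eigenvalue tau lambda0%:C)
  (lambda0_isolated : isolated_in_spectrum tau lambda0%:C)
  (phi_eigen : eigenfunctional tau lambda0%:C phi)
  (phi_one : phi (fun=> 1) = 1)
  (v0_eigen : eigenfunction tau lambda0%:C v0)
  (phi_v0 : phi v0 = 1)
  (phi0_H1 : Sobolev 1 2 (cplx phi0))
  (phi_repr : forall f : R -> R, Sobolev 1 2 (cplx f) ->
     phi (cplx f) =
       circle_cint (fun x => (phi0 x)%:C * (cplx f x)^*) +
       circle_cint (fun x => wderiv (cplx phi0) x * (wderiv (cplx f) x)^*))
  (response_neq0 : exists2 S : R -> R, Sobolev 4 2 (cplx S) &
     dot_lambda tau phi v0 S != 0) :
  let a := opt_coeff tau v0 phi0 in
  let normalised (nu : R) :=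
    \esum_(n in [set: int])
      (fourier_weight n * Normc.normc (a nu n) ^+ 2)%:E = 1%E in
  (exists2 nu : R, 0 < nu & normalised nu) /\
  forall nu : R, 0 < nu -> normalised nu ->
    exists Tdot : R -> R,
      [/\ Sobolev 4 2 (cplx Tdot),
          is_fourier_sum (a nu) (cplx Tdot),
          H_norm 4 (cplx Tdot) = 1,
          forall S : R -> R, Sobolev 4 2 (cplx S) ->
            (maximiser (dot_lambda tau phi v0) S <-> ae_equal S Tdot) &
          dot_lambda tau phi v0 Tdot =
            response_formula tau v0 phi0 (cplx Tdot)].

Proof.
have [sigma [p [p1 [p2 [D [eps E]]]]]] := expanding_lift_exists tau_lift A0 alpha01 A1.
have [phi_dual _] := phi_eigen.
have [v [v1 [v2 [v0v cv cv1]]]] := eigenfunction_real_C2 E lambda0_gt lambda0_simple phi_dual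
  phi0_H1 phi_repr v0_eigen phi_v0.
have v0_meas : measurable_periodic v0 by have [[[pv mr mi _] _] _ _] := v0_eigen.
apply: (optimal_response (response_lin E phi0_H1 cv cv1) (response_bound E phi0_H1 cv cv1)) => //.
  exact: (dot_lambdaE E phi_dual phi0_H1 phi_repr v0_meas v0v cv cv1).
exact: (response_formulaE E phi0_H1 v0_meas v0v cv cv1).
Qed.
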